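(* Suppose that $1<q\le p<\infty$. Let $\phi\in\mathcal{G}_{q,p}$ be a surjective function $(0,\infty)\to(0,\infty)$ such that there is a constant $C>0$ with $$\int_{r}^{\infty}\phi^{q}(t)\,t^{\frac{dq}{p}-1}\,dt\le C\,\phi^{q}(r)\,r^{\frac{dq}{p}}\quad\text{for every } r>0.$$ Let $\bar q,\bar p$ be positive real exponents with $\frac{q}{\bar q}=\frac{p}{\bar p}<1$, and put $\frac1l=\frac1p-\frac1{\bar p}$ and $\frac1s=\frac1q-\frac1{\bar q}$. Let $\rho:(0,\infty)\to(0,\infty)$ satisfy the doubling condition: there is a constant $C_1>0$ such that for all $r,t>0$, $$\frac12\le\frac rt\le2\ \Longrightarrow\ \frac1{C_1}\le\frac{\rho(r)}{\rho(t)}\le C_1 ,$$ and assume that there is a constant $C'>0$ such that for every $r>0$, $$\int_{0}^{r}\frac{\rho(t)}{t}\,dt\le C'\,\phi(r)^{\frac{q}{\bar q}-1}\qquad\text{and}\qquad \int_{r}^{\infty}\frac{\rho(t)\phi(t)}{t}\,dt\le C'\,\phi(r)^{\frac{q}{\bar q}} .$$ Then there is a constant $K>0$ such that for all $W\in(L^{s},L^{l})^{\phi^{q/s}}(\mathbb{R}^{d})$ and all $f\in(L^{q},L^{p})^{\phi}(\mathbb{R}^{d})$, $$\|W\cdot T_{\rho}f\|_{(L^{q},L^{p})^{\phi}(\mathbb{R}^{d})}\le K\,\|W\|_{(L^{s},L^{l})^{\phi^{q/s}}(\mathbb{R}^{d})}\,\|f\|_{(L^{q},L^{p})^{\phi}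(\mathbb{R}^{d})}.$$
   Context: Convention: $\frac1\infty=0$. $L^{0}(\mathbb{R}^{d})$ is the space of (a.e. equivalence classes of) Lebesgue measurable complex-valued functions on $\mathbb{R}^d$; $B(y,r)$ is the open ball with center $y\in\mathbb{R}^d$ and radius $r>0$. For $1\le q\le p\le\infty$, $\mathcal{G}_{q,p}$ is the set of all functions $\phi:(0,\infty)\to(0,\infty)$ such that $t\mapsto\phi(t)t^{d/p}$ is almost decreasing (there is $C>0$ with $\phi(s)s^{d/p}\le C\phi(r)r^{d/p}$ whenever $0<r\le s<\infty$) and $t\mapsto\phi(t)t^{d/q}$ is almost increasing (there is $C>0$ with $\phi(r)r^{d/q}\le C\phi(s)s^{d/q}$ whenever $0<r\le s<\infty$). For $r>0$ and $f\in L^0(\mathbb{R}^d)$, put ${}_{r}\|f\|_{q,p}=\left\|\left[\int_{\mathbb{R}^d}|f\chi_{B(y,r)}|^{q}(x)\,dx\right]^{1/q}\right\|_{p}$, the $L^{p}(\mathbb{R}^d)$-norm being taken in the variable $y$ (usual modification if $q=\infty$). For $\phi\in\mathcal{G}_{q,p}$ the generalized Fofana space $(L^{q},L^{p})^{\phi}(\mathbb{R}^{d})$ is the set of all $f\in L^{0}(\mathbb{R}^{d})$ with $$\|f\|_{(L^{q},L^{p})^{\phi}(\mathbb{R}^{d})}=\sup_{r>0}\frac{1}{\phi(r)}\,r^{d(-\frac1q-\frac1p)}\;{}_{r}\|f\|_{q,p}<\infty.$$ For $\rho:(0,\infty)\to(0,\infty)$, the generalized fractional integral operator is $T_{\rho}f(x)=\int_{\mathbb{R}^{d}}\frac{\rho(|x-y|)}{|x-y|^{d}}f(y)\,dy$,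 $x\in\mathbb{R}^d$. Here $\phi^{q/s}$ denotes the function $r\mapsto(\phi(r))^{q/s}$, and $W\cdot T_\rho f$ is the pointwise product. *)

(* Defs.v *)
From HB Require Import structures.
From mathcomp Require Import all_boot all_order all_algebra.
From mathcomp Require Import all_classical all_reals all_analysis.
From mathcomp Require Import complex.

Set Implicit Arguments.
Unset Strict Implicit.
Unset Printing Implicit Defensive.

Import Order.TTheory GRing.Theory Num.Theory.
Import numFieldNormedType.Exports.

Local Open Scope classical_set_scope.
Local Open Scope ring_scope.

(* R^n is 'rV[R]_n, with the Borel sigma-algebra generated by the coordinates. *)
Definition rV_display : measure_display.
Proof. exact: default_measure_display. Qed.

Section rV_measurable.
Context (R : realType) (n : nat).

Let coord (i : 'I_n) (x : 'rV[R]_n) : measurableTypeR R := x ord0 i.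

Let rV_set0 : g_sigma_preimage coord set0.
Proof. exact: sigma_algebra0. Qed.

Let rV_setC A : g_sigma_preimage coord A -> g_sigma_preimage coord (~` A).
Proof. exact: sigma_algebraC. Qed.

Let rV_bigcup (F : _^nat) : (forall i, g_sigma_preimage coord (F i)) ->
  g_sigma_preimage coord (\bigcup_i (F i)).
Proof. exact: sigma_algebra_bigcup. Qed.

HB.instance Definition _ := @isMeasurable.Build rV_display
  'rV[R]_n (g_sigma_preimage coord) rV_set0 rV_setC rV_bigcup.

Lemma measurable_coord (i : 'I_n) :
  measurable_fun [set: 'rV[R]_n] (fun x => x ord0 i : measurableTypeR R).
Proof.
move=> _ Y mY; rewrite setTI; apply: sub_sigma_algebra => /=.
rewrite -bigcup_seq/=; exists i => /=; first by rewrite mem_index_enum.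
by exists Y => //; rewrite setTI.
Qed.

Lemma measurable_fun_coord d (T : measurableType d) (f : T -> 'rV[R]_n) :
  (forall i, measurable_fun [set: T] (fun t => f t ord0 i : measurableTypeR R)) ->
  measurable_fun [set: T] f.
Proof.
move=> mf.
have sub : g_sigma_preimage (fun i t => f t ord0 i : measurableTypeR R)
    `<=` measurable.
  apply: smallest_sub; first exact: sigma_algebra_measurable.
  rewrite -bigcup_seq; apply: bigcup_sub => i _ A [B mB <-].
  exact: mf.
move=> _ A mA; apply: sub.
by rewrite (g_sigma_preimage_comp coord f); exists A.
Qed.

End rV_measurable.

Section lebesgue_rV.
Context (R : realType).

Definition cons_rV n (p : measurableTypeR R * 'rV[R]_n) : 'rV[R]_n.+1 :=
  row_mx (const_mx (p.1 : R) : 'rV[R]_1) p.2.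

Lemma cons_rV0 n p : cons_rV p ord0 (ord0 : 'I_n.+1) = p.1.
Proof.
have -> : ord0 = lshift n (ord0 : 'I_1) :> 'I_(1 + n) by exact/val_inj.
by rewrite (@row_mxEl _ 1 1 n) mxE.
Qed.

Lemma cons_rV_lift n p (j : 'I_n) : cons_rV p ord0 (lift ord0 j) = p.2 ord0 j.
Proof.
have -> : lift ord0 j = rshift 1 j :> 'I_(1 + n) by exact/val_inj.
by rewrite (@row_mxEr _ 1 1 n).
Qed.

Lemma measurable_cons_rV n : measurable_fun setT (@cons_rV n).
Proof.
apply: measurable_fun_coord => i; have [j ->|->] := unliftP ord0 i.
  have -> : (fun p : measurableTypeR R * 'rV[R]_n =>
      cons_rV p ord0 (lift ord0 j) : measurableTypeR R) =
      (fun v : 'rV[R]_n => v ord0 j : measurableTypeR R) \o snd.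
    by apply/funext => p; rewrite cons_rV_lift.
  by apply: measurableT_comp => //; exact: measurable_coord.
have -> : (fun p : measurableTypeR R * 'rV[R]_n =>
    cons_rV p ord0 ord0 : measurableTypeR R) = fst.
  by apply/funext => p; rewrite cons_rV0.
exact: measurable_fst.
Qed.

Section cons_measure.
Context n (m : {sigma_finite_measure set 'rV[R]_n -> \bar R}).

(* Lebesgue measure on R times m, carried to R^(n+1) = R * R^n. *)
Definition cons_measure : set 'rV[R]_n.+1 -> \bar R :=
  pushforward (@lebesgue_measure R \x m)%E (@cons_rV n).

Let mcons := @measurable_cons_rV n.

Let cons_measure0 : cons_measure set0 = 0%E.
Proof. by rewrite /cons_measure /pushforward preimage_set0 measure0. Qed.

Let cons_measure_ge0 A : (0 <= cons_measure A)%E.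
Proof. exact: measure_ge0. Qed.

Let cons_measure_sigma_additive : semi_sigma_additive cons_measure.
Proof.
exact: (@measure_semi_sigma_additive _ _ _
  (measure_function_pushforward__canonical__measure_function_Measure
    (@lebesgue_measure R \x m)%E mcons)).
Qed.

HB.instance Definition _ := isMeasure.Build _ _ _ cons_measure
  cons_measure0 cons_measure_ge0 cons_measure_sigma_additive.

Let cons_measure_sigma_finite : sigma_finite setT cons_measure.
Proof.
have [F TF Foo] : sigma_finite setT (@lebesgue_measure R \x m)%E.
  have /sigma_finiteP[G [TG ndG Goo]] := sigma_finiteT (@lebesgue_measure R).
  have /sigma_finiteP[H [TH ndH Hoo]] := sigma_finiteT m.
  exists (fun k => G k `*` H k).
    rewrite -setXTT TG TH predeqE => -[x y]; split.
      move=> [/= [i _ Gix] [k _ Hky]]; exists (maxn i k) => //; split.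
      - by move: x Gix; exact/subsetPset/ndG/leq_maxl.
      - by move: y Hky; exact/subsetPset/ndH/leq_maxr.
    by move=> [i _ []/= ? ?]; split; exists i.
  move=> k; have [? ?] := Goo k; have [? ?] := Hoo k.
  split; first exact: measurableX.
  by rewrite product_measure1E// lte_mul_pinfty// ge0_fin_numE.
pose u (v : 'rV[R]_n.+1) : measurableTypeR R * 'rV[R]_n :=
  (v ord0 ord0, \row_j v ord0 (lift ord0 j)).
have mu_ : measurable_fun setT u.
  apply/measurable_fun_pairP; split; first exact: measurable_coord.
  apply: measurable_fun_coord => i /=.
  rewrite [X in measurable_fun _ X](_ : _ =
    fun v : 'rV[R]_n.+1 => v ord0 (lift ord0 i) : measurableTypeR R).
    exact: measurable_coord.
  by apply/funext => v /=; rewrite mxE.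
have consK p : u (cons_rV p) = p.
  case: p => x v; rewrite /u cons_rV0; congr pair.
  by apply/rowP => j; rewrite mxE cons_rV_lift.
exists (fun k => u @^-1` F k).
  by rewrite -preimage_bigcup -TF preimage_setT.
move=> k; have [mFk Fkoo] := Foo k; split.
  by rewrite -[X in measurable X]setTI; exact: mu_.
rewrite /cons_measure /pushforward -comp_preimage.
by rewrite (_ : u \o _ = id)//; apply/funext => p; exact: consK.
Qed.

HB.instance Definition _ := Measure_isSigmaFinite.Build _ _ _ cons_measure
  cons_measure_sigma_finite.

End cons_measure.

Fixpoint borel_lebesgue_rV n : {sigma_finite_measure set 'rV[R]_n -> \bar R} :=
  match n with
  | 0 => \d_ (0 : 'rV[R]_0)
  | k.+1 => cons_measure (borel_lebesgue_rV k)
  end.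

End lebesgue_rV.

(* Lebesgue, rather than Borel, measurability of a function of a real variable. *)
Definition lebesgue_measurable_on (R : realType) (D : set R) (g : R -> R) :
    Prop :=
  @measurable_fun _ _
    (caratheodory_type ((@wlength R idfun)^*)%mu) (measurableTypeR R) D g.

Section fofana.
Context (R : realType) (d : nat).

(* R^d with its Lebesgue sigma-algebra; the carrier is 'rV[R]_d. *)
Definition lebesgueSpace : measurableType _ :=
  caratheodory_type ((borel_lebesgue_rV R d)^*)%mu.

Definition leb : {measure set lebesgueSpace -> \bar R} :=
  @completed_measure_extension _ _ _ (borel_lebesgue_rV R d).

(* The norm `|x| that the library puts on 'rV[R]_d is the sup norm. *)
Definition enorm (x : 'rV[R]_d) : R := Num.sqrt (\sum_i (x ord0 i) ^+ 2).

Definition eball (y : 'rV[R]_d) (r : R) : set 'rV[R]_d :=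
  [set x | enorm (x - y) < r].

Definition cabs (z : R[i]) : R := ComplexField.Normc.normc z.

(* L^0 is given by representatives; the norms below depend only on the class of
   f modulo equality almost everywhere. *)
Definition L0 (f : 'rV[R]_d -> R[i]) : Prop :=
  measurable_fun [set: lebesgueSpace] (fun x : lebesgueSpace => complex.Re (f x)) /\
  measurable_fun [set: lebesgueSpace] (fun x : lebesgueSpace => complex.Im (f x)).

Definition cintegrable (f : 'rV[R]_d -> R[i]) : Prop :=
  leb.-integrable setT (fun x : lebesgueSpace => (complex.Re (f x))%:E) /\
  leb.-integrable setT (fun x : lebesgueSpace => (complex.Im (f x))%:E).

Definition cintegral (f : 'rV[R]_d -> R[i]) : R[i] :=
  Complex (\int[leb]_x complex.Re (f x)) (\int[leb]_x complex.Im (f x)).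

(* 1/p, with 1/oo = 0. *)
Definition recip (p : \bar R) : R := fine (p^-1)%E.

(* A function (0, oo) -> (0, oo) is a function R -> R of which only the values
   on (0, oo) are used. *)
Definition Gclass (q p : \bar R) (phi : R -> R) : Prop :=
  [/\ forall t : R, 0 < t -> 0 < phi t,
      exists2 C : R, 0 < C & forall r s : R, 0 < r -> r <= s ->
        phi s * s `^ (d%:R * recip p) <= C * (phi r * r `^ (d%:R * recip p)) &
      exists2 C : R, 0 < C & forall r s : R, 0 < r -> r <= s ->
        phi r * r `^ (d%:R * recip q) <= C * (phi s * s `^ (d%:R * recip q))].

Definition amalgam_norm (r : R) (q p : \bar R) (f : 'rV[R]_d -> R[i]) : \bar R :=
  Lnorm leb p (fun y : lebesgueSpace =>
    Lnorm leb q (fun x : lebesgueSpace => (cabs (f x) * \1_(eball y r) x)%:E)).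

Definition fofana_norm (q p : \bar R) (phi : R -> R) (f : 'rV[R]_d -> R[i]) :
    \bar R :=
  ereal_sup [set (((phi r)^-1 * r `^ (d%:R * (- recip q - recip p)))%:E *
                  amalgam_norm r q p f)%E | r in [set r : R | 0 < r]].

Definition fofana (q p : \bar R) (phi : R -> R) : set ('rV[R]_d -> R[i]) :=
  [set f | L0 f /\ (fofana_norm q p phi f < +oo)%E].

(* At y = x the library's 0^-1 = 0 gives the kernel the value 0. *)
Definition rho_kernel (rho : R -> R) (x y : 'rV[R]_d) : R :=
  rho (enorm (x - y)) / enorm (x - y) ^+ d.

Definition Trho (rho : R -> R) (f : 'rV[R]_d -> R[i]) (x : 'rV[R]_d) : R[i] :=
  cintegral (fun y => (rho_kernel rho x y)%:C%C * f y).

(* The integral that defines Trho rho f x converges absolutely. *)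
Definition Trho_defined (rho : R -> R) (f : 'rV[R]_d -> R[i]) (x : 'rV[R]_d) :
    Prop :=
  cintegrable (fun y => (rho_kernel rho x y)%:C%C * f y).

End fofana.

(* Main.v *)
(* Put th = q / qbar = p / pbar, so that q / s = p / l = 1 - th and l / s = p / q.
   Splitting the integral of T_rho |f| at radius r into dyadic rings bounds it
   by C (phi(r)^(th - 1) Mf + phi(r)^th ||f||): inside, the averages of |f| are
   at most the maximal function Mf; outside, they are at most C phi ||f||.  As
   phi is surjective one may choose phi(r) = Mf / ||f||, which gives Hedberg's
   pointwise bound |T_rho f| <= C ||f||^(1 - th) (Mf)^th.  Two applications of
   Hoelder's inequality with exponents 1/(1 - th) and 1/th, on balls and then
   in their centers, bound the norm of W T_rho f by the norms of W, f and Mf.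
   The maximal function is bounded on the Fofana space: on B(y,r) it is at most
   that of f cut off to a larger ball, controlled in L^q, plus the averages of
   |f| on the balls B(y, 2^i r), whose sum converges by the integral condition
   on phi.  The L^q bound follows from Doob's inequality for shifted dyadic
   grids. *)
Require Import Defs.
From HB Require Import structures.
From mathcomp Require Import all_boot all_order all_algebra.
From mathcomp Require Import all_classical all_reals all_analysis.
From mathcomp Require Import complex.
From mathcomp Require Import measurable_realfun zify ring lra.

Import Order.TTheory GRing.Theory Num.Theory.
Import numFieldNormedType.Exports.
Local Open Scope classical_set_scope.
Local Open Scope ring_scope.

Set Implicit Arguments.
Unset Strict Implicit.
Unset Printing Implicit Defensive.

(** * Convexity inequalities *)

(** Three obstacles shape the proof. First, [rho] is only Lebesgue measurable, and composing it with
    the distance could destroy measurability; the kernel is therefore exchanged for a Borel one,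
    which agrees with it for almost every y because the distance to a fixed point pulls null sets
    back to null sets. Second, the integral condition on [phi] controls q-th powers, while the
    amalgam norm calls for sums of p-th powers; the surplus exponent p - q is paid for by the almost
    monotonicity of phi(r) r^(d/p). Third, Hedberg's choice of radius divides by the norm of f,
    which may vanish, so every estimate is made with an arbitrary F above the norm, and F tends to
    the norm at the end. All estimates concern powers of norms: with e = p/q, the p-th power of the
    amalgam norm is the integral over y of the e-th power of the integral of |f|^q over B(y,r). In
    this form Hoelder's inequality applies twice in the same way, and the e-th power of a supremum
    is bounded by the sum of e-th powers, which stands in for the triangle inequality in L^p. *)

Section hoelder_powers.
Context {R : realType}.
Implicit Types th q : R.

Lemma weighted_AGM (x y th : R) : (0 < th < 1) -> (0 <= x) -> (0 <= y) ->
  (x `^ (1 - th) * y `^ th <= (1 - th) * x + th * y).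
Proof.
move=> /andP[th0 th1] x0 y0.
have th10 : (0 < 1 - th) by rewrite subr_gt0.
have := @conjugate_powR R (x `^ (1 - th)) (y `^ th) (1 - th)^-1 th^-1.
rewrite !powR_ge0 !invr_gt0 !invrK subrK -!powRrM !mulfV ?gt_eqF//.
rewrite !powRr1//; move=> /(_ erefl erefl th10 th0 erefl).
by rewrite ![(_ * (1 - th))]mulrC ![(_ * th)]mulrC.
Qed.

Local Open Scope ereal_scope.

Lemma le_poweR (x y : \bar R) (r : R) :
  (0 <= r)%R -> 0 <= x -> x <= y -> x `^ r <= y `^ r.
Proof.
move=> r0 x0 xy; apply: gt0_ler_poweR => //.
- by rewrite in_itv/= x0 leey.
- by rewrite in_itv/= (le_trans x0 xy) leey.
Qed.

(** The scales [a] and [b] are free so that they can be set to the integrals of the two functions: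
    the bracket then integrates to 1, and the factor in front is the Hoelder bound. *)
Lemma poweR_weighted_AGM (x y : \bar R) (a b th : R) :
  (0 < th < 1)%R -> (0 < a)%R -> (0 < b)%R -> 0 <= x -> 0 <= y ->
  x `^ (1 - th) * y `^ th <=
  (a `^ (1 - th) * b `^ th)%:E * (((1 - th) / a)%:E * x + (th / b)%:E * y).
Proof.
move=> /andP[th0 th1] a0 b0.
have th10 : (0 < 1 - th)%R by rewrite subr_gt0.
have ab0 : (0 < a `^ (1 - th) * b `^ th)%R by rewrite mulr_gt0 ?powR_gt0.
have [u0 v0] : (0 < (1 - th) / a)%R /\ (0 < th / b)%R by rewrite !divr_gt0.
case: x => [x| |]// x0; case: y => [y| |]// y0; rewrite ?lee_fin in x0 y0.
- rewrite /= lee_fin.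
  have := @weighted_AGM (x / a) (y / b) th.
  rewrite th0 th1 !divr_ge0 ?(ltW a0) ?(ltW b0)// => /(_ erefl erefl erefl).
  move=> H; rewrite -(ler_pM2l ab0) in H.
  have -> : ((1 - th) / a * x + th / b * y = (1 - th) * (x / a) + th * (y / b))%R.
    by ring.
  apply: le_trans H; rewrite mulrACA -!powRM ?divr_ge0 ?(ltW a0) ?(ltW b0)//.
  by rewrite ![(_ * (_ / _))%R]mulrC !divfK ?gt_eqF.
- by rewrite gt0_muley ?lte_fin// addey ?gt0_muley ?lte_fin// ?leey// -EFinM.
- by rewrite gt0_muley ?lte_fin// addye ?gt0_muley ?lte_fin// ?leey// -EFinM.
- by rewrite !gt0_muley ?lte_fin ?addye ?gt0_muley ?lte_fin// leey.
Qed.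

Lemma ge0_integral_hoelder d (T : measurableType d)
    (mu : {measure set T -> \bar R}) (u v : T -> \bar R) (th : R) :
  measurable_fun setT u -> measurable_fun setT v ->
  (forall x, 0 <= u x) -> (forall x, 0 <= v x) -> (0 < th < 1)%R ->
  \int[mu]_x (u x `^ (1 - th) * v x `^ th) <=
  (\int[mu]_x u x) `^ (1 - th) * (\int[mu]_x v x) `^ th.
Proof.
move=> mu_ mv u0 v0 th01; have /andP[th0 th1] := th01.
have th10 : (0 < 1 - th)%R by rewrite subr_gt0.
have mp (w : T -> \bar R) r : measurable_fun setT w ->
    measurable_fun setT (fun x => w x `^ r).
  by move=> mw; apply: (measurableT_comp (measurable_poweR r)).
(* Normalizing by the two integrals requires them to be positive and finite. A function of integral
   zero vanishes almost everywhere, hence so does the product. *)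
have zero (w z : T -> \bar R) r : (0 < r)%R -> measurable_fun setT w ->
    measurable_fun setT z -> (forall x, 0 <= w x) -> (forall x, 0 <= z x) ->
    \int[mu]_x w x = 0 -> \int[mu]_x (w x `^ r * z x) = 0.
  move=> r0 mw mz w0 z0 iw.
  have : ae_eq mu setT w (cst 0).
    apply/ae_eq_integral_abs => //.
    by rewrite -[RHS]iw; apply: eq_integral => x _; rewrite gee0_abs.
  move=> wae; rewrite -[RHS](integral0 mu setT); apply: ge0_ae_eq_integral => //.
  - by apply: emeasurable_funM => //; exact: mp.
  - by move=> x _; rewrite mule_ge0 ?poweR_ge0.
  - by apply: filterS wae => x /= xw /xw ->; rewrite poweR0r ?gt_eqF// mul0e.
have [A0|A0] := eqVneq (\int[mu]_x u x) 0.
  rewrite (zero _ _ _ th10)// ?mule_ge0 ?poweR_ge0//; first exact: mp.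
  by move=> x; exact: poweR_ge0.
have [B0|B0] := eqVneq (\int[mu]_x v x) 0.
  under eq_integral do rewrite muleC.
  rewrite (zero _ _ _ th0)// ?mule_ge0 ?poweR_ge0//; first exact: mp.
  by move=> x; exact: poweR_ge0.
have {A0}A0 : 0 < \int[mu]_x u x by rewrite lt0e A0 integral_ge0.
have {B0}B0 : 0 < \int[mu]_x v x by rewrite lt0e B0 integral_ge0.
have [Aoo|Aoo] := eqVneq (\int[mu]_x u x) +oo.
  by rewrite Aoo poweRyr ?gt_eqF// gt0_mulye ?leey// poweR_gt0.
have [Boo|Boo] := eqVneq (\int[mu]_x v x) +oo.
  by rewrite Boo poweRyr ?gt_eqF// gt0_muley ?leey// poweR_gt0.
have fA : \int[mu]_x u x \is a fin_num by rewrite ge0_fin_numE ?ltW// ltey.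
have fB : \int[mu]_x v x \is a fin_num by rewrite ge0_fin_numE ?ltW// ltey.
set a := fine (\int[mu]_x u x); set b := fine (\int[mu]_x v x).
have a0 : (0 < a)%R by rewrite fine_gt0// A0 ltey.
have b0 : (0 < b)%R by rewrite fine_gt0// B0 ltey.
have [c1 c2] : (0 <= (1 - th) / a)%R /\ (0 <= th / b)%R.
  by split; rewrite divr_ge0 ?(ltW a0) ?(ltW b0) ?(ltW th0) ?(ltW th10).
have c0 : (0 <= a `^ (1 - th) * b `^ th)%R by rewrite mulr_ge0 ?powR_ge0.
have m1 : measurable_fun setT (fun x => ((1 - th) / a)%:E * u x).
  exact: measurable_funeM.
have m2 : measurable_fun setT (fun x => (th / b)%:E * v x).
  exact: measurable_funeM.
apply: (@le_trans _ _ (\int[mu]_x ((a `^ (1 - th) * b `^ th)%:E *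
    (((1 - th) / a)%:E * u x + (th / b)%:E * v x)))).
  apply: ge0_le_integral => //.
  - by move=> x _; rewrite mule_ge0 ?poweR_ge0.
  - by apply: emeasurable_funM; exact: mp.
  - by apply: measurable_funeM; exact: emeasurable_funD.
  - by move=> x _; exact: poweR_weighted_AGM.
rewrite ge0_integralZl//; last 2 first.
- exact: emeasurable_funD.
- by move=> x _; rewrite adde_ge0 ?mule_ge0 ?lee_fin.
rewrite ge0_integralD//; last 2 first.
- by move=> x _; rewrite mule_ge0 ?lee_fin.
- by move=> x _; rewrite mule_ge0 ?lee_fin.
rewrite !ge0_integralZl ?lee_fin// -(fineK fA) -(fineK fB) -/a -/b.
rewrite /= lee_fin !divfK ?gt_eqF// subrK mulr1.
by rewrite lexx.
Qed.

(** Jensen's inequality for averages over [A], obtained from Hoelder's inequality against the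
    indicator of [A] with weights 1/q and 1 - 1/q. *)
Lemma poweR_integral_indic_le d (T : measurableType d)
    (mu : {measure set T -> \bar R}) (A : set T) (g : T -> \bar R) (q : R) :
  measurable A -> measurable_fun setT g -> (forall x, 0 <= g x) -> (1 < q)%R ->
  (\int[mu]_x (g x * (\1_A x)%:E)) `^ q <=
  mu A `^ (q - 1) * \int[mu]_x (g x `^ q * (\1_A x)%:E).
Proof.
move=> mA mg g0 q1.
have q0 : (0 < q)%R by exact: lt_trans q1.
have m1A : measurable_fun setT (fun x => (\1_A x : R)%:E).
  by apply/measurable_EFinP; exact: measurable_indic.
have mgq : measurable_fun setT (fun x => g x `^ q).
  exact: (measurableT_comp (measurable_poweR q)).
pose th := (1 - q^-1)%R.
have th01 : (0 < th < 1)%R.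
  by rewrite subr_gt0 invf_lt1// q1 ltrBlDr ltrDl invr_gt0.
have := @ge0_integral_hoelder d T mu (fun x => g x `^ q * (\1_A x)%:E)
  (fun x => (\1_A x)%:E) th (emeasurable_funM mgq m1A) m1A.
have -> : (1 - th = q^-1)%R by rewrite /th subKr.
move=> /(_ _ _ th01) H.
have {H} := H (fun x => mule_ge0 (poweR_ge0 _ _) _) _.
rewrite (_ : \int[mu]_x (\1_A x)%:E = mu A); last by rewrite integral_indic// setIT.
have -> : \int[mu]_x ((g x `^ q * (\1_A x)%:E) `^ q^-1 * (\1_A x)%:E `^ th) =
    \int[mu]_x (g x * (\1_A x)%:E).
  apply: eq_integral => x _; rewrite indicE; case: (x \in A) => /=.
    by rewrite !powR1 !mule1 -poweRrM mulfV ?gt_eqF// poweRe1.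
  rewrite !powR0 ?mule0//.
  by case/andP: th01 => /lt0r_neq0.
move=> H.
have {}H := H (fun x => ltac:(by rewrite lee_fin)) (fun x => ltac:(by rewrite lee_fin)).
apply: (le_trans (le_poweR (ltW q0) _ H)).
  by apply: integral_ge0 => x _; rewrite mule_ge0// lee_fin.
rewrite poweRM ?poweR_ge0// -!poweRrM mulVf ?gt_eqF// poweRe1; last first.
  by apply: integral_ge0 => x _; rewrite mule_ge0 ?poweR_ge0// lee_fin.
by rewrite muleC mulrBl mul1r mulVf ?gt_eqF.
Qed.

End hoelder_powers.

(* The integral of a nonnegative function is a supremum over simple functions,
   so it is monotone even on nonmeasurable functions. *)
Lemma le_ge0_integral (R : realType) dsp (T : measurableType dsp)
    (mu : {measure set T -> \bar R}) (D : set T) (f g : T -> \bar R) :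
  (forall x, D x -> 0 <= f x)%E -> (forall x, D x -> f x <= g x)%E ->
  (\int[mu]_(x in D) f x <= \int[mu]_(x in D) g x)%E.
Proof.
move=> f0 fg; rewrite !ge0_integralE//; last first.
  by move=> x Dx; rewrite (le_trans (f0 _ Dx)) ?fg.
apply: le_ereal_sup => _ [h hf <-]; exists h => // x.
rewrite (le_trans (hf x))// /patch; case: ifPn => // /set_mem; exact: fg.
Qed.

(** * Euclidean balls and Lebesgue measure *)

Section euclidean_norm.
Context {R : realType} {d : nat}.
Implicit Types x y z : 'rV[R]_d.

Lemma enorm_ge0 x : 0 <= enorm x.
Proof. exact: sqrtr_ge0. Qed.

Lemma enorm_sqr x : enorm x ^+ 2 = \sum_i x ord0 i ^+ 2.
Proof. by rewrite sqr_sqrtr// sumr_ge0// => i _; rewrite sqr_ge0. Qed.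

Lemma ler_coord_enorm x i : `|x ord0 i| <= enorm x.
Proof.
rewrite -(ler_pXn2r (ltn0Sn 1)) ?nnegrE ?enorm_ge0// enorm_sqr real_normK ?num_real//.
by rewrite (bigD1 i)//= lerDl sumr_ge0// => j _; rewrite sqr_ge0.
Qed.

Lemma enorm_le_bound x t : 0 <= t -> (forall i, `|x ord0 i| <= t) ->
  enorm x <= d%:R * t.
Proof.
move=> t0 xt; rewrite -(ler_pXn2r (ltn0Sn 1)) ?nnegrE ?enorm_ge0 ?mulr_ge0//.
rewrite enorm_sqr exprMn; apply: (@le_trans _ _ (\sum_(i < d) t ^+ 2)).
  by apply: ler_sum => i _; rewrite -real_normK ?num_real// lerXn2r ?nnegrE.
rewrite sumr_const card_ord -[leLHS]mulr_natl ler_wpM2r ?sqr_ge0//.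
by rewrite -natrX ler_nat; case: d => // n; rewrite expnS expn1 leq_pmulr.
Qed.

Lemma enorm_eq0 x : enorm x = 0 -> x = 0.
Proof.
move=> x0; apply/rowP => i; rewrite mxE; apply/normr0_eq0/eqP.
by rewrite eq_le normr_ge0 andbT -x0 ler_coord_enorm.
Qed.

Lemma enormN x : enorm (- x) = enorm x.
Proof. by congr Num.sqrt; apply: eq_bigr => i _; rewrite mxE sqrrN. Qed.

Lemma enormB x y : enorm (x - y) = enorm (y - x).
Proof. by rewrite -enormN opprB. Qed.

(** With a and b the two norms, each coordinate satisfies 2 a b u v <= (b u)^2 + (a v)^2, and the
    right-hand sides sum to 2 (a b)^2. *)
Lemma ler_dot_enorm x y : \sum_i x ord0 i * y ord0 i <= enorm x * enorm y.
Proof.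
have [/eqP/enorm_eq0 ->|x0] := boolP (enorm x == 0).
  by rewrite big1 ?mulr_ge0 ?enorm_ge0// => i _; rewrite mxE mul0r.
have [/eqP/enorm_eq0 ->|y0] := boolP (enorm y == 0).
  by rewrite big1 ?mulr_ge0 ?enorm_ge0// => i _; rewrite mxE mulr0.
set a := enorm x; set b := enorm y.
have a0 : 0 < a by rewrite lt_def x0 enorm_ge0.
have b0 : 0 < b by rewrite lt_def y0 enorm_ge0.
have -> : a * b = \sum_i (b / a * x ord0 i ^+ 2 + a / b * y ord0 i ^+ 2) / 2.
  rewrite -big_distrl big_split/= -!big_distrr/= -!enorm_sqr -/a -/b.
  by field; rewrite !gt_eqF.
apply: ler_sum => i _; rewrite -subr_ge0.
set u := x _ _; set v := y _ _.
have -> : (b / a * u ^+ 2 + a / b * v ^+ 2) / 2 - u * v =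
    (b * u - a * v) ^+ 2 / (2 * a * b) by field; rewrite !gt_eqF.
by rewrite divr_ge0 ?sqr_ge0// !mulr_ge0// ltW.
Qed.

Lemma ler_enormD x y : enorm (x + y) <= enorm x + enorm y.
Proof.
rewrite -(ler_pXn2r (ltn0Sn 1)) ?nnegrE ?addr_ge0 ?enorm_ge0//.
rewrite sqrrD !enorm_sqr.
under eq_bigr do rewrite mxE sqrrD.
rewrite !big_split/= lerD2r lerD2l.
by rewrite -mulr2n lerMn2r ler_dot_enorm orbT.
Qed.

Lemma ler_enormBD z x y : enorm (x - y) <= enorm (x - z) + enorm (z - y).
Proof. by rewrite (le_trans _ (ler_enormD _ _))// addrA subrK. Qed.

Lemma eball_sub (x y : 'rV[R]_d) (r t : R) : enorm (x - y) + r <= t ->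
  eball x r `<=` eball y t.
Proof.
move=> xyr z; rewrite /eball/= => zx.
by rewrite (le_lt_trans (ler_enormBD x _ _))// (lt_le_trans _ xyr)// addrC ltrD2l.
Qed.

End euclidean_norm.

Section boxes.
Context {R : realType}.

Definition box d (a b : 'I_d -> R) : set 'rV[R]_d :=
  [set x | forall i, a i <= x ord0 i < b i].

Lemma measurable_rV_box d (a b : 'I_d -> R) : measurable (box a b).
Proof.
rewrite (_ : box a b = \bigcap_(i in [set: 'I_d])
    ((fun x : 'rV[R]_d => x ord0 i : measurableTypeR R) @^-1` `[a i, b i[)).
  apply: fin_bigcap_measurable => // i _; rewrite -[X in measurable X]setTI.
  by apply: measurable_coord => //; exact: measurable_itv.
apply/seteqP; split => [x bx i _|x bx i].
  by rewrite /= in_itv/= bx.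
by have := bx i I; rewrite /= in_itv.
Qed.

Lemma cons_rV_box d (a b : 'I_d.+1 -> R) :
  @cons_rV R d @^-1` box a b = `[a ord0, b ord0[ `*`
    box (fun i => a (lift ord0 i)) (fun i => b (lift ord0 i)).
Proof.
apply/seteqP; split => [p pab|p [/= p1 p2]].
  split; first by have := pab ord0; rewrite cons_rV0 /= in_itv.
  by move=> i; have := pab (lift ord0 i); rewrite cons_rV_lift.
move=> i; have [j ->|->] := unliftP ord0 i; first by rewrite cons_rV_lift.
by rewrite cons_rV0; rewrite in_itv in p1.
Qed.

Lemma borel_lebesgue_rV_box d (a b : 'I_d -> R) : (forall i, a i <= b i) ->
  borel_lebesgue_rV R d (box a b) = (\prod_i (b i - a i))%:E.
Proof.
elim: d a b => [|d IH] a b ab.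
  rewrite /= big_ord0 diracE mem_set//.
  by move=> [].
rewrite /= /cons_measure /pushforward cons_rV_box product_measure1E; last 2 first.
- exact: (@measurable_itv R).
- exact: measurable_rV_box.
rewrite IH// big_ord_recl EFinM; congr (_ * _)%E.
transitivity (lebesgue_measure (`[a ord0, b ord0[%classic : set R)) => //.
rewrite lebesgue_measure_itv/= lte_fin; case: ltP => // ba.
by rewrite (@le_anti _ _ (a ord0) (b ord0)) ?subrr// ba ab.
Qed.

End boxes.

Lemma measurable_sqrt (R : realType) : measurable_fun setT (@Num.sqrt R).
Proof. by apply: continuous_measurable_fun; exact: sqrt_continuous. Qed.

Lemma measurable_enorm_coord (R : realType) d d' (U : measurableType d')
    (f g : U -> 'rV[R]_d) :
  (forall i, measurable_fun setT (fun u => f u ord0 i : R)) ->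
  (forall i, measurable_fun setT (fun u => g u ord0 i : R)) ->
  measurable_fun setT (fun u => enorm (f u - g u)).
Proof.
move=> mf mg.
suff : measurable_fun setT (fun u => \sum_i (f u ord0 i - g u ord0 i) ^+ 2).
  move/(measurableT_comp (@measurable_sqrt R)); apply: eq_measurable_fun => u _.
  by congr Num.sqrt; apply: eq_bigr => i _; rewrite !mxE.
by apply: measurable_sum => i; apply: measurable_funX; exact: measurable_funB.
Qed.

Section lebesgue_space.
Context {R : realType} {d : nat}.
Local Notation T := (lebesgueSpace R d).
Local Notation mu := (leb R d).

Lemma measurable_lebesgueSpace (A : set 'rV[R]_d) :
  measurable A -> measurable (A : set T).
Proof. exact: caratheodory_measurable_mu_ext. Qed.

Lemma lebE (A : set 'rV[R]_d) : measurable A -> mu A = borel_lebesgue_rV R d A.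
Proof. by move=> mA; exact: measurable_mu_extE. Qed.

Lemma leb_box (a b : 'I_d -> R) : (forall i, a i <= b i) ->
  mu (box a b) = (\prod_i (b i - a i))%:E.
Proof.
by move=> ab; rewrite lebE ?borel_lebesgue_rV_box//; exact: measurable_rV_box.
Qed.

Lemma measurable_box (a b : 'I_d -> R) : measurable (box a b : set T).
Proof. by apply: measurable_lebesgueSpace; exact: measurable_rV_box. Qed.

Lemma measurable_lebesgue_coord i :
  measurable_fun setT (fun x : T => x ord0 i : R).
Proof.
move=> _ Y mY; apply: measurable_lebesgueSpace.
by have := @measurable_coord R d i measurableT Y mY.
Qed.

Lemma measurable_enorm d' (U : measurableType d') (f g : U -> T) :
  measurable_fun setT f -> measurable_fun setT g ->
  measurable_fun setT (fun u => enorm (f u - g u)).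
Proof.
move=> mf mg; apply: measurable_enorm_coord => i.
  exact: (measurableT_comp (measurable_lebesgue_coord i) mf).
exact: (measurableT_comp (measurable_lebesgue_coord i) mg).
Qed.

Lemma mem_eball (x y : 'rV[R]_d) r : (x \in eball y r) = (enorm (x - y) < r).
Proof. by apply/idP/idP => [/set_mem|?]//; exact: mem_set. Qed.

Lemma measurable_indic_eball d' (U : measurableType d') (f g : U -> T) (r : R) :
  measurable_fun setT f -> measurable_fun setT g ->
  measurable_fun setT (fun u => \1_(eball (g u) r) (f u) : R).
Proof.
move=> mf mg.
rewrite (_ : (fun _ => _) =
    (fun u => if enorm (f u - g u) < r then 1 else 0)); last first.
  by apply/funext => u; rewrite indicE mem_eball; case: ifP.
apply: measurable_fun_ifT => //.
by apply: measurable_fun_ltr => //; exact: measurable_enorm.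
Qed.

Lemma measurable_eball (y : 'rV[R]_d) (r : R) : measurable (eball y r : set T).
Proof.
apply/(@measurable_indicP _ T R).
exact: (measurable_indic_eball (f := id) (g := cst y)).
Qed.

Lemma leb_eball_le (y : 'rV[R]_d) r : 0 <= r ->
  (mu (eball y r) <= (2 ^+ d * r ^+ d)%:E)%E.
Proof.
move=> r0; rewrite -exprMn.
have -> : (2 * r) ^+ d = \prod_(i < d) ((y ord0 i + r) - (y ord0 i - r)).
  by rewrite (eq_bigr (fun=> 2 * r)) ?prodr_const ?card_ord// => i _; ring.
rewrite -leb_box => [|i]; last by rewrite lerD2l ge0_cp.
apply: le_measure; rewrite ?inE.
- exact: measurable_eball.
- exact: measurable_box.
- move=> x yx i; have := le_lt_trans (ler_coord_enorm _ i) yx.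
  by rewrite !mxE ltr_distl => /andP[/ltW -> ->].
Qed.

(** The cube of half side [r / d.+1] fits into the open ball: its points are at distance at most d r
    / (d + 1) from the center, which is strictly below r. *)
Lemma leb_eball_ge (y : 'rV[R]_d) r : 0 < r ->
  (((2 / d.+1%:R) ^+ d * r ^+ d)%:E <= mu (eball y r))%E.
Proof.
move=> r0; rewrite -exprMn; set t := r / d.+1%:R.
have t0 : 0 < t by rewrite divr_gt0.
have -> : (2 / d.+1%:R * r) ^+ d = \prod_(i < d) ((y ord0 i + t) - (y ord0 i - t)).
  rewrite (eq_bigr (fun=> 2 / d.+1%:R * r)) ?prodr_const ?card_ord// => i _.
  by rewrite /t; field.
rewrite -leb_box => [|i]; last by rewrite lerD2l ge0_cp// ltW.
apply: le_measure; rewrite ?inE.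
- exact: measurable_box.
- exact: measurable_eball.
- move=> x yx; rewrite /eball/=.
  apply: (@le_lt_trans _ _ (d%:R * t)).
    apply: enorm_le_bound; first exact: ltW.
    move=> i; rewrite !mxE ler_distl; have /andP[-> /ltW ->] := yx i.
    by [].
  by rewrite /t mulrCA -[ltRHS]mulr1 ltr_pM2l// ltr_pdivrMr// mul1r ltr_nat.
Qed.

End lebesgue_space.

Section leb_sigma_finite.
Context {R : realType} {d : nat}.
Local Notation T := (lebesgueSpace R d).
Local Notation mu := (leb R d).

Let mubar := @completed_measure_extension _ _ _ (borel_lebesgue_rV R d).

HB.instance Definition _ := Measure.on mubar.

Let mubar_sigma_finite : sigma_finite setT mubar.
Proof. exact/completed_measure_extension_sigma_finite/sigma_finiteT. Qed.

HB.instance Definition _ := Measure_isSigmaFinite.Build _ _ _ mubar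
  mubar_sigma_finite.

(** The same measure as [leb], carrying the sigma-finite structure that Tonelli's theorem asks
    for. *)
Definition leb_sigma_finite : {sigma_finite_measure set T -> \bar R} := mubar.

Local Open Scope ereal_scope.

Lemma measurable_leb_integral (f : T * T -> \bar R) :
  measurable_fun setT f -> (forall x, 0 <= f x) ->
  measurable_fun setT (fun x => \int[mu]_y f (x, y)).
Proof. exact: (@measurable_fun_fubini_tonelli_F _ _ _ _ _ leb_sigma_finite). Qed.

Lemma leb_complete : measure_is_complete mu.
Proof. exact: measure_is_complete_caratheodory. Qed.

End leb_sigma_finite.

(** * Null sets of radii and the distance to a point *)

Section null_sets.
Context {R : realType}.
Local Notation lambda := (@lebesgue_measure R).
Implicit Types (A S N : set R).

(** The maximum with 0 gives length 0 to pairs with reversed endpoints, whose interval is empty. *)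
Lemma lebesgue_null_open_cover N (e : R) : lambda N = 0%E -> 0 < e ->
  exists2 ab : nat -> R * R,
    N `<=` \bigcup_k `](ab k).1, (ab k).2[%classic &
    (\sum_(k <oo) (Num.max 0 ((ab k).2 - (ab k).1))%:E <= e%:E)%E.
Proof.
move=> N0 e0.
have H : lambda N = ereal_inf [set (\sum_(k <oo) wlength idfun (F k))%E |
    F in open_itv_cover N] by exact: outer_measure_open_itv_cover.
rewrite N0 in H.
have [_/= [F [Fi NF] <-]] := @lb_ereal_inf_adherent R
  [set (\sum_(k <oo) wlength idfun (F k))%E | F in open_itv_cover N] e e0
  ltac:(by rewrite -H).
rewrite -H => Fe.
have /choice[ab abF] : forall k, exists ab : R * R, F k = `]ab.1, ab.2[%classic.
  by move=> k; have [ab ?] := Fi k; exists ab.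
exists ab; first by move=> x /NF[k _]; rewrite abF; exists k.
rewrite add0e in Fe; apply: le_trans (ltW Fe); apply: lee_nneseries => k _.
  by rewrite lee_fin le_max lexx.
rewrite abF wlength_itv/= lte_fin; case: ltP => ab12.
  by rewrite -EFinB lee_fin ge_max lexx subr_ge0 ltW.
by rewrite lee_fin ge_max lexx subr_le0.
Qed.

(** Since [h] expands distances by at least [kappa], the points of [A] sent into an interval of
    length L lie within L / kappa of any one of them. A cover of [N] of total length e kappa / 2
    thus yields a cover of [S] of total length at most e. *)
Lemma lebesgue_null_expanding A N (h : R -> R) (kappa : R) : 0 < kappa ->
  (forall u v, A u -> A v -> kappa * `|u - v| <= `|h u - h v|) ->
  lambda N = 0%E -> forall S, measurable S -> S `<=` A `&` h @^-1` N ->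
  lambda S = 0%E.
Proof.
move=> k0 hA N0 S mS SA.
apply/eqP; rewrite eq_le measure_ge0 andbT; apply/lee_addgt0Pr => e e0.
rewrite add0e.
have [ab Nab abe] := @lebesgue_null_open_cover N (e * kappa / 2) N0
  (divr_gt0 (mulr_gt0 e0 k0) (ltr0Sn _ 1)).
pose P k u := S u /\ (ab k).1 < h u < (ab k).2.
(* A point of the k-th piece of [S]; the default 0 for an empty piece only adds a harmless
   interval. *)
pose c k := xget 0 (P k).
pose l k := Num.max 0 ((ab k).2 - (ab k).1) / kappa.
pose J k : set R := `[c k - l k, c k + l k]%classic.
have lJ k : lambda (J k) = (2 / kappa * Num.max 0 ((ab k).2 - (ab k).1))%:E.
  rewrite /J lebesgue_measure_itv/= lte_fin.
  have l0 : 0 <= l k by rewrite divr_ge0 ?le_max ?lexx// ltW.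
  rewrite (_ : 2 / kappa * _ = 2 * l k); last by rewrite /l; ring.
  case: ltP => lk; first by rewrite -EFinB; congr EFin; ring.
  by congr EFin; lra.
apply: (@le_trans _ _ (\sum_(k <oo) lambda (J k))%E).
  apply: measure_sigma_subadditive => //.
    by move=> n; exact: measurable_itv.
  move=> u Su; have [/= Au /Nab[k _ /=]] := SA _ Su.
  rewrite in_itv/= => abk; exists k => //; rewrite /J/= in_itv/=.
  have Pu : P k u by [].
  have [/SA[/= Ac _] hc] : P k (c k) by rewrite /c; exact: (xgetI 0 Pu).
  rewrite -ler_distl /l ler_pdivlMr// mulrC (le_trans (hA _ _ Au Ac))//.
  have : (ab k).2 - (ab k).1 <= Num.max 0 ((ab k).2 - (ab k).1).
    by rewrite le_max lexx orbT.
  by rewrite ler_norml => ?; lra.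
under eq_eseriesr do rewrite lJ EFinM.
rewrite nneseriesZl//; last by move=> n _; rewrite lee_fin le_max lexx.
apply: (@le_trans _ _ ((2 / kappa)%:E * (e * kappa / 2)%:E)%E).
  by rewrite lee_pmul2l// lte_fin divr_gt0.
rewrite -EFinM lee_fin (_ : 2 / kappa * (e * kappa / 2) = e)//.
by field; rewrite gt_eqF.
Qed.

(** The map t -> sqrt((x - t)^2 + c) folds the line at x and, for c > 0, flattens there. The line
    without x is exhausted by the pieces [B sg n], on the side given by the sign [sg], where |x - t|
    lies between 1/(n+1) and n. There the values a, b at u, v satisfy |a - b| (a + b) = |u - v| |x -
    u + x - v| >= 2 |u - v| / (n+1), while a + b is bounded. *)
Lemma lebesgue_null_preimage_sqrt N (x c : R) : 0 <= c ->
  lambda N = 0%E -> forall S, measurable S ->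
  S `<=` [set t | N (Num.sqrt ((x - t) ^+ 2 + c))] -> lambda S = 0%E.
Proof.
move=> c0 N0 S mS SN.
pose B sg n : set R := (fun t => sg * (x - t)) @^-1` `[n.+1%:R^-1, n%:R]%classic.
have mB sg n : measurable (B sg n).
  rewrite -[X in measurable X]setTI.
  suff : measurable_fun setT (fun t : R => sg * (x - t)).
    by move=> mf; apply: mf => //; exact: (@measurable_itv R).
  by apply: measurable_funM => //; exact: measurable_funB.
have B0 sg n : sg ^+ 2 = 1 -> lambda.-negligible (S `&` B sg n).
  move=> sg1; apply/negligibleP; first exact: (@measurableI _ R _ _ mS (mB _ _)).
  (* A bound for the values of the map on [B sg n]; the added 1 keeps it positive. *)
  pose H := Num.sqrt (n%:R ^+ 2 + c) + 1.
  have H0 : 0 < H by rewrite ltr_wpDl ?sqrtr_ge0.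
  have k0 : 0 < n.+1%:R^-1 / H by rewrite divr_gt0.
  apply: (@lebesgue_null_expanding (B sg n) N
    (fun t => Num.sqrt ((x - t) ^+ 2 + c)) _ k0) => //; last 2 first.
  - exact: (@measurableI _ R _ _ mS (mB _ _)).
  - by move=> t [/SN ? ?].
  have hH t : B sg n t -> Num.sqrt ((x - t) ^+ 2 + c) <= H.
    rewrite /B/= in_itv/= => /andP[t1 t2].
    rewrite /H -[leLHS]addr0 lerD// ler_wsqrtr// lerD2r.
    have -> : (x - t) ^+ 2 = (sg * (x - t)) ^+ 2 by rewrite exprMn sg1 mul1r.
    by rewrite lerXn2r ?nnegrE// (le_trans _ t1).
  move=> u v Bu Bv; have Hu := hH _ Bu; have Hv := hH _ Bv.
  set a := Num.sqrt _ in Hu *; set b := Num.sqrt _ in Hv *.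
  have a0 : 0 <= a by exact: sqrtr_ge0.
  have b0 : 0 <= b by exact: sqrtr_ge0.
  rewrite mulrAC ler_pdivrMr// mulrC.
  have : `|a - b| * (a + b) <= `|a - b| * (2 * H).
    by rewrite ler_wpM2l// mulr2n mulrDl !mul1r lerD.
  rewrite -{1}(ger0_norm (addr_ge0 a0 b0)) -normrM -subr_sqr.
  rewrite !sqr_sqrtr ?addr_ge0 ?sqr_ge0//.
  have -> : (x - u) ^+ 2 + c - ((x - v) ^+ 2 + c) =
      (v - u) * ((x - u) + (x - v)) by ring.
  rewrite normrM [`|v - u|]distrC => H1.
  have H2 : 2 * n.+1%:R^-1 <= `|x - u + (x - v)|; last first.
    rewrite -(@ler_pM2l _ 2)// [leRHS]mulrCA; apply: le_trans H1.
    by rewrite mulrCA ler_wpM2l.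
  have -> : `|x - u + (x - v)| = `|sg * (x - u) + sg * (x - v)|.
    rewrite -mulrDr normrM; have -> : `|sg| = 1; last by rewrite mul1r.
    by apply/eqP; rewrite -(@pexpr_eq1 _ _ 2)// real_normK ?num_real// sg1.
  move: Bu Bv; rewrite /B/= !in_itv/= => /andP[u1 _] /andP[v1 _].
  by rewrite ler_normr; apply/orP; left; rewrite mulr_natl mulr2n lerD.
have SB : S `<=` [set x] `|` \bigcup_n ((S `&` B 1 n) `|` (S `&` B (-1) n)).
  move=> t St; have [->|tx] := eqVneq t x; first by left.
  right.
  have t0 : 0 < `|x - t| by rewrite normr_gt0 subr_eq0 eq_sym.
  pose n := maxn (Num.bound `|x - t|) (Num.bound `|x - t|^-1).
  have n1 : `|x - t| <= n%:R.
    by rewrite (le_trans (ltW (archi_boundP _)))// ler_nat leq_maxl.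
  have n2 : n.+1%:R^-1 <= `|x - t|.
    rewrite -[leRHS]invrK lef_pV2 ?posrE ?invr_gt0//.
    rewrite (le_trans (ltW (archi_boundP _))) ?invr_ge0// ler_nat.
    exact: leq_trans (leq_maxr _ _) (leqnSn _).
  exists n => //; have [xt|xt] := leP 0 (x - t).
    by left; split => //; rewrite /B/= in_itv/= mul1r -(ger0_norm xt) n1 n2.
  by right; split => //; rewrite /B/= in_itv/= mulN1r -(ltr0_norm xt) n1 n2.
apply/negligibleP => //.
apply: (@negligibleS _ (measurableTypeR R) R lambda _ _ SB).
apply: negligibleU.
  by apply/negligibleP; [exact: measurable_set1|exact: lebesgue_measure_set1].
apply: negligible_bigcup => n; apply: negligibleU; apply: B0.
  by rewrite expr1n.
by rewrite sqrrN expr1n.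
Qed.

End null_sets.

Section null_distances.
Context {R : realType}.
Local Notation lambda := (@lebesgue_measure R).

Lemma measurable_enormB_borel d (x : 'rV[R]_d) :
  measurable_fun setT (fun z : 'rV[R]_d => enorm (x - z)).
Proof. by apply: measurable_enorm_coord => i //; exact: measurable_coord. Qed.

Lemma enormB_cons_rV n (x : 'rV[R]_n.+1) (t : R) (z : 'rV[R]_n) :
  enorm (x - cons_rV (t, z)) = Num.sqrt ((x ord0 ord0 - t) ^+ 2 +
    \sum_i (x ord0 (lift ord0 i) - z ord0 i) ^+ 2).
Proof.
congr Num.sqrt; rewrite big_ord_recl; congr (_ + _).
  by rewrite 2!mxE cons_rV0.
by apply: eq_bigr => i _; rewrite 2!mxE cons_rV_lift.
Qed.

(** By Tonelli it suffices that every line parallel to the first axis meets the set in a null set;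
    on such a line the distance to x has the form sqrt((x_0 - t)^2 + c). *)
Lemma leb_null_distance d (x : 'rV[R]_d) (N : set R) : (0 < d)%N ->
  lambda.-negligible N -> (leb R d).-negligible [set z | N (enorm (x - z))].
Proof.
case: d x => // n x _ [M [mM M0 NM]].
pose E : set 'rV[R]_n.+1 := (fun z => enorm (x - z)) @^-1` M.
have mE : measurable E.
  by rewrite -[E]setTI; apply: measurable_enormB_borel.
exists E; split; [exact: measurable_lebesgueSpace| |by move=> z /NM].
rewrite lebE//= /cons_measure /pushforward.
pose F := @cons_rV R n @^-1` E.
have mF : measurable F by rewrite -[F]setTI; apply: measurable_cons_rV.
pose m := borel_lebesgue_rV R n.
transitivity (\int[(lambda \x m)%E]_p (\1_F p)%:E)%E.
  by rewrite integral_indic// setIT.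
rewrite (@fubini_tonelli2 _ _ _ _ _ _ m)//; last first.
  by apply/measurable_EFinP; exact: measurable_indic.
apply: integral0_eq => z _; rewrite /fubini_G.
transitivity (\int[lambda]_t (\1_(ysection F z) t)%:E)%E.
  apply: eq_integral => t _; rewrite !indicE; congr ((_ : bool)%:R)%:E.
  by apply/idP/idP; rewrite !inE /ysection/= ?inE.
rewrite integral_indic//; last exact: measurable_ysection.
rewrite setIT; apply: (@lebesgue_null_preimage_sqrt _ M (x ord0 ord0)
  (\sum_i (x ord0 (lift ord0 i) - z ord0 i) ^+ 2)) => //.
- by apply: sumr_ge0 => i _; rewrite sqr_ge0.
- exact: measurable_ysection.
- by move=> t; rewrite /ysection/= inE /F /E/= enormB_cons_rV.
Qed.

(** Each superlevel set of [g] at a rational level is Borel up to a null set. Off a Borel null set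
    containing these countably many exceptions [g] is Borel, because a superlevel set at a real
    level is the union of those at larger rational levels. *)
Lemma lebesgue_measurable_borel (D : set R) (g : R -> R) :
  measurable D -> lebesgue_measurable_on D g ->
  exists E, [/\ measurable E, E `<=` D, lambda.-negligible (D `\` E) &
    measurable_fun setT (g \_ E)].
Proof.
move=> mD mg.
have key (a : R) : exists AN : set R * set R,
    [/\ measurable AN.1, lambda.-negligible AN.2 &
    D `&` g @^-1` `]a, +oo[ = AN.1 `|` AN.2].
  have : @measurable _ (caratheodory_type (wlength (@idfun R))^*%mu)
      (D `&` g @^-1` `]a, +oo[).
    by apply: mg; [exact: sub_caratheodory|exact: measurable_itv].
  rewrite -completed_caratheodory_measurable g_sigma_completed_algebra_genE.
  by move=> [A mA [N nN <-]]; exists (A, N).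
have [AN AN_] := choice key.
pose a_ n : R := ratr (odflt 0%Q (unpickle n)).
have a_dense x y : x < y -> exists n, x < a_ n < y.
  move=> /rat_in_itvoo[r]; rewrite in_itv/= => xry.
  by exists (pickle r); rewrite /a_ pickleK.
have [Z [mZ Z0 NZ]] : lambda.-negligible (\bigcup_n (AN (a_ n)).2).
  by apply: negligible_bigcup => n; have [] := AN_ (a_ n).
have mDZ : measurable (D `\` Z) by exact: (@measurableD _ R).
exists (D `\` Z); split; [by []|by move=> t []| | ].
  by exists Z; split => // t [Dt nE]; apply: contrapT => Zt; exact: nE.
apply/(measurable_restrictT _ mDZ).
apply: (measurability _ (RGenOInfty.measurableE R)) => _ [_ [x ->] <-].
rewrite (_ : _ `&` _ = \bigcup_n (if x < a_ n then (D `\` Z) `&` (AN (a_ n)).1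
    else set0)).
  apply: bigcupT_measurable => n; case: ifPn => // _; apply: measurableI => //.
  by have [] := AN_ (a_ n).
apply/seteqP; split => [t [[Dt Zt]]|t [n _]]/=.
  rewrite in_itv/= andbT => /a_dense[n /andP[xn ng]].
  exists n => //; rewrite xn; split => //.
  have [_ _ H] := AN_ (a_ n).
  have : (D `&` g @^-1` `]a_ n, +oo[) t by split => //=; rewrite in_itv/= andbT.
  by rewrite H => -[//|N]; exfalso; apply/Zt/NZ; exists n.
case: ifPn => // xn [[Dt Zt] At]; split => //.
have [_ _ H] := AN_ (a_ n).
have : (D `&` g @^-1` `]a_ n, +oo[) t by rewrite H; left.
by move=> [_] /=; rewrite !in_itv/= !andbT; exact: lt_trans.
Qed.

End null_distances.

(** * Maximal functions *)

Section doob_maximal.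
Context dsp (T : measurableType dsp) (R : realType).
Variable mu : {sigma_finite_measure set T -> \bar R}.
Variables (e : nat -> T -> T -> bool) (m : nat -> R).
(* [e j] relates the points of a common block of the j-th partition. *)
Hypothesis e_sym : forall j x y, e j x y = e j y x.
Hypothesis e_trans : forall j x y z, e j x y -> e j y z -> e j x z.
Hypothesis e_nested : forall j x y, e j.+1 x y -> e j x y.
Hypothesis m_gt0 : forall j, 0 < m j.
Hypothesis measurable_e :
  forall j, measurable_fun setT (fun p : T * T => (e j p.1 p.2)%:R : R).
Hypothesis mu_e : forall j x, mu [set y | e j x y] = (m j)%:E.

Definition block_integral j (g : T -> R) x : \bar R :=
  (\int[mu]_y (g y * (e j x y)%:R)%:E)%E.

Definition block_avg j g x : R := fine (block_integral j g x) / m j.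

Let indic_e j x y : (e j x y)%:R = \1_[set z | e j x z] y :> R.
Proof.
by rewrite indicE; congr ((_ : bool)%:R); apply/idP/idP; rewrite inE.
Qed.

Let measurable_block j x : measurable [set y | e j x y].
Proof.
apply/(@measurable_indicP _ T R).
apply: eq_measurable_fun (measurable_fun_pair2 x (measurable_e j)) => y _ /=.
by rewrite indic_e.
Qed.

Section block_avg.
Variables (j : nat) (g : T -> R).
Hypothesis mg : measurable_fun setT g.
Hypothesis g0 : forall x, 0 <= g x.
Hypothesis gfin : forall x, (block_integral j g x < +oo)%E.

Let measurable_kernel :
  measurable_fun setT (fun p : T * T => (g p.2 * (e j p.1 p.2)%:R)%:E).
Proof.
apply/measurable_EFinP; apply: measurable_funM; last exact: measurable_e.
exact: (measurableT_comp mg measurable_snd).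
Qed.

Let kernel_ge0 (p : T * T) : (0 <= (g p.2 * (e j p.1 p.2)%:R)%:E)%E.
Proof. by rewrite lee_fin mulr_ge0. Qed.

Lemma block_avg_ge0 x : 0 <= block_avg j g x.
Proof.
rewrite divr_ge0 ?(ltW (m_gt0 j))// fine_ge0// integral_ge0// => y _.
exact: (kernel_ge0 (x, y)).
Qed.

Lemma measurable_block_avg : measurable_fun setT (block_avg j g).
Proof.
apply: measurable_funM => //; apply: (measurableT_comp (fine_measurable measurableT)).
exact: (@measurable_fun_fubini_tonelli_F _ _ _ _ _ mu _ measurable_kernel kernel_ge0).
Qed.

Lemma eq_block_avg x y : e j x y -> block_avg j g x = block_avg j g y.
Proof.
move=> xy; congr (fine _ / _); apply: eq_integral => z _.
congr (_ * (_ : bool)%:R)%:E; apply/idP/idP => [xz|yz].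
  by apply: e_trans xz; rewrite e_sym.
exact: e_trans xy yz.
Qed.

Lemma block_avgE x : ((block_avg j g x)%:E = (m j)^-1%:E * block_integral j g x)%E.
Proof.
rewrite /block_avg mulrC EFinM fineK// ge0_fin_numE// integral_ge0// => y _.
exact: (kernel_ge0 (x, y)).
Qed.

(** Averaging over blocks is a conditional expectation, and a weight constant on blocks passes
    through it. After Tonelli and the symmetry of [e], the integral in x is the measure of a block,
    which cancels the normalization [m j]. *)
Lemma integral_block_avg (w : T -> R) : measurable_fun setT w ->
  (forall x, 0 <= w x) -> (forall x y, e j x y -> w x = w y) ->
  (\int[mu]_x (block_avg j g x * w x)%:E = \int[mu]_x (g x * w x)%:E)%E.
Proof.
move=> mw w0 wE.
have mf : measurable_fun setT (fun p : T * T =>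
    ((m j)^-1 * (g p.2 * (e j p.1 p.2)%:R) * w p.1)%:E).
  apply/measurable_EFinP; apply: measurable_funM.
    by apply: measurable_funM => //; exact/measurable_EFinP.
  exact: (measurableT_comp mw measurable_fst).
transitivity (\int[mu]_x \int[mu]_y
    ((m j)^-1 * (g y * (e j x y)%:R) * w x)%:E)%E.
  apply: eq_integral => x _; rewrite EFinM block_avgE.
  rewrite -ge0_integralZl//; last 3 first.
  - exact: (measurable_fun_pair2 x measurable_kernel).
  - by move=> y _; exact: (kernel_ge0 (x, y)).
  - by rewrite lee_fin invr_ge0 ltW.
  rewrite -ge0_integralZr//.
  - by apply: measurable_funeM; exact: (measurable_fun_pair2 x measurable_kernel).
  - move=> y _; rewrite mule_ge0 ?lee_fin ?invr_ge0 ?(ltW (m_gt0 j))//.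
    by rewrite mulr_ge0.
  - by rewrite lee_fin.
have f0 (p : T * T) :
    (0 <= ((m j)^-1 * (g p.2 * (e j p.1 p.2)%:R) * w p.1)%:E)%E.
  by rewrite lee_fin mulr_ge0// mulr_ge0 ?mulr_ge0// invr_ge0 ltW.
rewrite (fubini_tonelli _ mf f0).
apply: eq_integral => y _ /=.
transitivity (\int[mu]_x ((g y * w y / m j)%:E * (\1_[set z | e j y z] x)%:E))%E.
  apply: eq_integral => x _; rewrite -indic_e e_sym -EFinM; congr EFin.
  have [/wE ->|_] := boolP (e j y x); last by rewrite /= !mulr0 mul0r.
  by rewrite /=; ring.
rewrite ge0_integralZl//; last 2 first.
- by apply/measurable_EFinP; exact: measurable_indic.
- by rewrite lee_fin divr_ge0 ?mulr_ge0// ltW.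
rewrite integral_indic// setIT.
rewrite [X in (_ * X)%E](_ : _ = (m j)%:E); last exact: mu_e.
by rewrite -EFinM divfK ?gt_eqF.
Qed.

End block_avg.

Section maximal.
Variables (g : T -> R) (q : R).
Hypothesis mg : measurable_fun setT g.
Hypothesis g0 : forall x, 0 <= g x.
Hypothesis q1 : 1 < q.
Hypothesis gq : (\int[mu]_x (g x `^ q)%:E < +oo)%E.

Let q0 : 0 < q. Proof. exact: lt_trans q1. Qed.

Let mgq : measurable_fun setT (fun x => g x `^ q).
Proof. exact: (measurableT_comp (measurable_powR q)). Qed.

Let gq_ge0 x : 0 <= g x `^ q. Proof. exact: powR_ge0. Qed.

Lemma block_integral_powR_lty j x :
  (block_integral j (fun y => (g y `^ q)%R) x < +oo)%E.
Proof.
apply: le_lt_trans gq; apply: ge0_le_integral => //.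
- by move=> y _; rewrite lee_fin mulr_ge0 ?powR_ge0.
- apply/measurable_EFinP; apply: measurable_funM => //.
  exact: (measurable_fun_pair2 x (measurable_e j)).
- exact/measurable_EFinP.
- move=> y _; rewrite lee_fin ler_piMr ?powR_ge0//.
  by case: (e j x y); rewrite ?lexx// ler01.
Qed.

Lemma block_integral_poweR_le j x : (block_integral j g x `^ q <=
  (m j `^ (q - 1))%:E * block_integral j (fun y => (g y `^ q)%R) x)%E.
Proof.
have := @poweR_integral_indic_le R _ T mu [set y | e j x y] (EFin \o g) q
  (measurable_block j x).
move=> /(_ (iffRL (measurable_EFinP _ _) mg) _ q1) H.
have {H} := H (fun x => ltac:(by rewrite /= lee_fin)).
rewrite [X in (_ <= X `^ _ * _)%E](_ : _ = (m j)%:E); last exact: mu_e.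
rewrite poweR_EFin => H; apply: le_trans (le_trans H _).
  rewrite /block_integral le_eqVlt; apply/orP; left; apply/eqP; congr (_ `^ _)%E.
  by apply: eq_integral => y _; rewrite /= -indic_e EFinM.
rewrite le_eqVlt; apply/orP; left; apply/eqP; congr (_ * _)%E.
by apply: eq_integral => y _; rewrite /= -indic_e EFinM.
Qed.

Lemma block_integral_lty j x : (block_integral j g x < +oo)%E.
Proof.
apply: (@lty_poweRy _ _ q); first by rewrite gt_eqF.
apply: (le_lt_trans (block_integral_poweR_le j x)).
by rewrite lte_mul_pinfty ?lee_fin ?powR_ge0// block_integral_powR_lty.
Qed.

Let S j := block_avg j g.

Let S_ge0 j x : 0 <= S j x. Proof. exact: block_avg_ge0. Qed.

Let mS j : measurable_fun setT (S j). Proof. exact: measurable_block_avg. Qed.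

Lemma block_avg_powR_le j x :
  S j x `^ q <= block_avg j (fun y => (g y `^ q)%R) x.
Proof.
rewrite -lee_fin block_avgE//; last exact: block_integral_powR_lty.
rewrite -poweR_EFin.
rewrite block_avgE//; last exact: block_integral_lty.
rewrite poweRM ?lee_fin ?invr_ge0 ?(ltW (m_gt0 j))//; last first.
  by apply: integral_ge0 => y _; rewrite lee_fin mulr_ge0.
rewrite poweR_EFin.
apply: (le_trans (lee_wpmul2l _ (block_integral_poweR_le j x))).
  by rewrite lee_fin powR_ge0.
rewrite muleA -EFinM -powR_inv1 ?(ltW (m_gt0 j))// -powRrM -powRD; last first.
  by rewrite (gt_eqF (m_gt0 j)) implybT.
by rewrite (_ : -1 * q + (q - 1) = - 1)//; ring.
Qed.

Lemma integral_block_avg_powR_le j :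
  (\int[mu]_x (S j x `^ q)%:E <= \int[mu]_x (g x `^ q)%:E)%E.
Proof.
apply: (@le_trans _ _
  (\int[mu]_x (block_avg j (fun y => (g y `^ q)%R) x * cst 1 x)%:E)%E).
  apply: ge0_le_integral => //.
  - by move=> x _; rewrite lee_fin powR_ge0.
  - by apply/measurable_EFinP; apply: (measurableT_comp (measurable_powR q)).
  - apply/measurable_EFinP; apply: measurable_funM => //.
    exact: measurable_block_avg.
  - by move=> x _; rewrite lee_fin mulr1 block_avg_powR_le.
rewrite integral_block_avg//; last exact: block_integral_powR_lty.
by under eq_integral do rewrite mulr1.
Qed.

Fixpoint block_max n x : R :=
  if n is k.+1 then Num.max (block_max k x) (S n x) else S 0 x.

Lemma block_max_ge0 n x : 0 <= block_max n x.
Proof. by case: n => [|n] /=; rewrite ?le_max ?S_ge0 ?orbT. Qed.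

Lemma le_block_max n j x : (j <= n)%N -> S j x <= block_max n x.
Proof.
elim: n => [|n IH]/=; first by rewrite leqn0 => /eqP ->.
rewrite leq_eqVlt => /orP[/eqP ->|/IH H]; first by rewrite le_max lexx orbT.
by rewrite le_max H.
Qed.

Lemma measurable_block_max n : measurable_fun setT (block_max n).
Proof. by elim: n => [|n IH]//=; exact: measurable_maxr. Qed.

Lemma eq_block_max n x y : e n x y -> block_max n x = block_max n y.
Proof.
elim: n => [|n IH]/= xy; first exact: eq_block_avg.
have -> : S n.+1 x = S n.+1 y by exact: eq_block_avg.
by rewrite (IH (e_nested xy)).
Qed.

Lemma block_max_powR_le_sum n x :
  block_max n x `^ q <= \sum_(j < n.+1) S j x `^ q.
Proof.
elim: n => [|n IH]/=; first by rewrite big_ord1.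
rewrite big_ord_recr/=; case: (leP (block_max n x) (S n.+1 x)) => _.
  by rewrite -[leLHS]add0r lerD// ?sumr_ge0// => j _; rewrite powR_ge0.
by rewrite -[leLHS]addr0 lerD// powR_ge0.
Qed.

(* Summation by parts of S against the increments of block_max ^ (q - 1). *)
Fixpoint increment_sum n x : R :=
  if n is k.+1 then increment_sum k x +
    S n x * (block_max n x `^ (q - 1) - block_max k x `^ (q - 1))
  else S 0 x * block_max 0 x `^ (q - 1).

Lemma block_max_mono n x :
  0 <= block_max n.+1 x `^ (q - 1) - block_max n x `^ (q - 1).
Proof.
rewrite subr_ge0 ge0_ler_powR ?nnegrE ?block_max_ge0 ?subr_ge0 ?(ltW q1)//.
by rewrite /= le_max lexx.
Qed.

Lemma increment_sum_ge0 n x : 0 <= increment_sum n x.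
Proof.
elim: n => [|n IH]; first by rewrite mulr_ge0 ?powR_ge0.
by rewrite addr_ge0// mulr_ge0// block_max_mono.
Qed.

(** When the maximum jumps from a to b, the weighted mean inequality b a^(q-1) <= b^q / q + (1 -
    1/q) a^q makes the increment b (b^(q-1) - a^(q-1)) at least (1 - 1/q) (b^q - a^q), and these
    lower bounds telescope. A step without a jump adds 0. *)
Lemma block_max_le_increment_sum n x :
  (1 - q^-1) * block_max n x `^ q <= increment_sum n x.
Proof.
have th01 : 0 < 1 - q^-1 < 1.
  by rewrite subr_gt0 invf_lt1// q1 ltrBlDr ltrDl invr_gt0.
elim: n => [|n IH]/=.
  rewrite mulr_powRB1// ler_piMl ?powR_ge0//.
  by case/andP: th01 => _ /ltW.
set a := block_max n x in IH *; set b := S n.+1 x.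
have a0 : 0 <= a by exact: block_max_ge0.
have b0 : 0 <= b by exact: S_ge0.
case: (leP a b) => ab; last by rewrite subrr mulr0 addr0.
have H := @weighted_AGM R (b `^ q) (a `^ q) (1 - q^-1) th01
  (powR_ge0 _ _) (powR_ge0 _ _).
rewrite subKr -!powRrM mulfV ?gt_eqF// powRr1// in H.
rewrite (_ : q * (1 - q^-1) = q - 1) in H; last first.
  by rewrite mulrBr mulr1 mulfV ?gt_eqF.
rewrite mulrBr mulr_powRB1//.
set A := a `^ q in IH H *; set B := b `^ q in H *; set D := b * _ in H *.
by lra.
Qed.

Lemma measurable_increment_sum n : measurable_fun setT (increment_sum n).
Proof.
have mM k : measurable_fun setT (fun x => block_max k x `^ (q - 1)).
  exact: (measurableT_comp (measurable_powR _) (measurable_block_max k)).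
elim: n => [|n IH]; first exact: measurable_funM.
apply: measurable_funD => //; apply: measurable_funM => //.
exact: measurable_funB.
Qed.

(** The difference of powers that multiplies the k-th average is constant on the k-th blocks,
    because the partitions refine each other. Under the integral [g] may therefore replace each
    average, and the differences telescope. *)
Lemma integral_increment_sum n : (\int[mu]_x (increment_sum n x)%:E =
  \int[mu]_x (g x * block_max n x `^ (q - 1))%:E)%E.
Proof.
have mM k : measurable_fun setT (fun x => block_max k x `^ (q - 1)).
  exact: (measurableT_comp (measurable_powR _) (measurable_block_max k)).
elim: n => [|n IH].
  apply: (@integral_block_avg 0 g mg g0 (block_integral_lty 0) _ (mM 0)).
    by move=> x; exact: powR_ge0.
  by move=> x y /eq_block_max ->.
have mw : measurable_fun setT
    (fun x => block_max n.+1 x `^ (q - 1) - block_max n x `^ (q - 1)).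
  exact: measurable_funB.
have wE x y : e n.+1 x y ->
    block_max n.+1 x `^ (q - 1) - block_max n x `^ (q - 1) =
    block_max n.+1 y `^ (q - 1) - block_max n y `^ (q - 1).
  by move=> xy; rewrite (eq_block_max xy) (eq_block_max (e_nested xy)).
have step := @integral_block_avg n.+1 g mg g0 (block_integral_lty n.+1) _ mw
  (block_max_mono n) wE.
transitivity (\int[mu]_x ((increment_sum n x)%:E + (S n.+1 x *
    (block_max n.+1 x `^ (q - 1) - block_max n x `^ (q - 1)))%:E))%E;
  first by [].
rewrite ge0_integralD; last 5 first.
- exact: measurableT.
- by move=> x _; rewrite lee_fin increment_sum_ge0.
- by apply/measurable_EFinP; exact: measurable_increment_sum.
- by move=> x _; rewrite lee_fin mulr_ge0// block_max_mono.
- by apply/measurable_EFinP; exact: measurable_funM.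
rewrite IH step -ge0_integralD; last 5 first.
- exact: measurableT.
- by move=> x _; rewrite lee_fin mulr_ge0 ?powR_ge0.
- by apply/measurable_EFinP; exact: measurable_funM.
- by move=> x _; rewrite lee_fin mulr_ge0// block_max_mono.
- by apply/measurable_EFinP; exact: measurable_funM.
by apply: eq_integral => x _; rewrite -EFinD -mulrDr addrC subrK.
Qed.

(** With M the maximum and c = 1 - 1/q, the increment sum shows that c times the integral of M^q is
    at most the integral of g M^(q-1). Where g <= (c/2) M the integrand is at most (c/2) M^q, which
    is absorbed on the left; elsewhere M <= (2/c) g. The resulting constant is the same for all
    n. *)
Lemma doob_maximal n : (\int[mu]_x (block_max n x `^ q)%:E <=
  ((2 / (1 - q^-1)) `^ q)%:E * \int[mu]_x (g x `^ q)%:E)%E.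
Proof.
set c := 1 - q^-1.
have c0 : 0 < c by rewrite subr_gt0 invf_lt1.
have mMq : measurable_fun setT (fun x => block_max n x `^ q).
  exact: (measurableT_comp (measurable_powR _) (measurable_block_max n)).
have mMq1 : measurable_fun setT (fun x => block_max n x `^ (q - 1)).
  exact: (measurableT_comp (measurable_powR _) (measurable_block_max n)).
have Mfin : (\int[mu]_x (block_max n x `^ q)%:E)%E \is a fin_num.
  rewrite ge0_fin_numE; last first.
    by apply: integral_ge0 => x _; rewrite lee_fin powR_ge0.
  apply: (@le_lt_trans _ _ (\int[mu]_x (\sum_(j < n.+1) (S j x `^ q)%:E)))%E.
    apply: ge0_le_integral => //.
    - by move=> x _; rewrite lee_fin powR_ge0.
    - exact/measurable_EFinP.
    - apply: emeasurable_sum => j; apply/measurable_EFinP.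
      exact: (measurableT_comp (measurable_powR _) (mS j)).
    - by move=> x _; rewrite sumEFin lee_fin block_max_powR_le_sum.
  rewrite ge0_integral_sum//; last 2 first.
  - move=> j; apply/measurable_EFinP.
    exact: (measurableT_comp (measurable_powR _) (mS j)).
  - by move=> j x _; rewrite lee_fin powR_ge0.
  apply: lte_sum_pinfty => j _.
  exact: le_lt_trans (integral_block_avg_powR_le j) gq.
have gfin : (\int[mu]_x (g x `^ q)%:E)%E \is a fin_num.
  by rewrite ge0_fin_numE// integral_ge0// => x _; rewrite lee_fin powR_ge0.
have mMqE := iffRL (measurable_EFinP _ _) mMq.
have mgqE := iffRL (measurable_EFinP _ _) mgq.
have Mq0 x : [set: T] x -> (0 <= (block_max n x `^ q)%:E)%E.
  by rewrite lee_fin powR_ge0.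
have gq0 x : [set: T] x -> (0 <= (g x `^ q)%:E)%E by rewrite lee_fin powR_ge0.
have main : (c%:E * \int[mu]_x (block_max n x `^ q)%:E <=
    (c / 2)%:E * \int[mu]_x (block_max n x `^ q)%:E +
    ((2 / c) `^ (q - 1))%:E * \int[mu]_x (g x `^ q)%:E)%E.
  rewrite -!ge0_integralZl ?lee_fin ?powR_ge0 ?divr_ge0 ?(ltW c0)//.
  apply: (@le_trans _ _ (\int[mu]_x (increment_sum n x)%:E)%E).
    apply: ge0_le_integral => //.
    - by move=> x _; rewrite mule_ge0 ?lee_fin ?powR_ge0 ?(ltW c0).
    - by apply: measurable_funeM; exact/measurable_EFinP.
    - by apply/measurable_EFinP; exact: measurable_increment_sum.
    - by move=> x _; rewrite lee_fin block_max_le_increment_sum.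
  rewrite integral_increment_sum -ge0_integralD//; last 4 first.
  - by move=> x _; rewrite mule_ge0 ?lee_fin ?powR_ge0 ?divr_ge0 ?(ltW c0).
  - by apply: measurable_funeM; exact/measurable_EFinP.
  - by move=> x _; rewrite mule_ge0 ?lee_fin ?powR_ge0.
  - by apply: measurable_funeM; exact/measurable_EFinP.
  apply: ge0_le_integral => //.
  - by move=> x _; rewrite lee_fin mulr_ge0 ?powR_ge0.
  - by apply/measurable_EFinP; exact: measurable_funM.
  - by apply: emeasurable_funD; apply: measurable_funeM; exact/measurable_EFinP.
  move=> x _; rewrite -!EFinM -EFinD lee_fin.
  set M := block_max n x; have M0 : 0 <= M by exact: block_max_ge0.
  have [gM|Mg] := leP (g x) (c / 2 * M).
    apply: (@le_trans _ _ (c / 2 * M * M `^ (q - 1))).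
      by rewrite ler_wpM2r ?powR_ge0.
    by rewrite -mulrA mulr_powRB1// lerDl mulr_ge0 ?powR_ge0.
  have {}Mg : M <= 2 / c * g x.
    rewrite -(ler_pM2l (divr_gt0 c0 (ltr0Sn R 1))).
    rewrite (_ : c / 2 * (2 / c * g x) = g x) ?ltW//.
    by field; rewrite gt_eqF.
  apply: (@le_trans _ _ (g x * (2 / c * g x) `^ (q - 1))).
    rewrite ler_wpM2l// ge0_ler_powR ?nnegrE ?subr_ge0 ?(ltW q1)//.
    exact: le_trans Mg.
  rewrite powRM ?divr_ge0 ?(ltW c0)// mulrCA mulr_powRB1// lerDr.
  by rewrite mulr_ge0 ?powR_ge0// divr_ge0 ?(ltW c0).
move: main; rewrite -(fineK Mfin) -(fineK gfin) -!EFinM -EFinD !lee_fin.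
set I := fine _; set J := fine (integral _ _ (fun x => (g x `^ q)%:E)).
have c20 : 0 < 2 / c by rewrite divr_gt0.
move=> H; rewrite -[leRHS]mulrC -(mulr_powRB1 (ltW c20) q0).
set K := (2 / c) `^ (q - 1) in H *.
have {}H : c / 2 * I <= K * J by lra.
rewrite -(ler_pM2l c20) (_ : 2 / c * (c / 2 * I) = I) in H; last first.
  by field; rewrite gt_eqF.
by apply: le_trans H _; rewrite mulrA mulrC.
Qed.

End maximal.
End doob_maximal.

(** * Shifted dyadic grids *)

Section dyadic_cells.
Context {R : realType}.

Lemma floor_eq_itv (x : R) (k : int) :
  k%:~R <= x -> x < k%:~R + 1 -> Num.floor x = k.
Proof. by move=> kx xk; apply: floor_def; rewrite kx intrD. Qed.

(** As 3 never divides 2^j, the shift 2^j / 3 has fractional part 1/3 or 2/3, so it stays away from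
    the integers at every level. *)
Lemma expn2_mod3 j : exists w r : nat, (2 ^ j = 3 * w + r)%N /\ (r == 1 \/ r == 2)%N.
Proof.
elim: j => [|j [w [r [IH r12]]]]; first by exists 0, 1; split => //; left.
case: r12 => /eqP r12; rewrite expnS IH r12.
  by exists (2 * w), 2; split; [lia|right].
by exists (2 * w).+1, 1; split; [lia|left].
Qed.

(* One third trick: two grids shifted by a third of a coarser dyadic length
   never have close endpoints, so a short interval lies in a cell of one of
   them. *)
Lemma floor_third_shift (a : R) j :
  (forall b, `|b - a| < 6^-1 -> Num.floor b = Num.floor a) \/
  (forall b, `|b - a| < 6^-1 ->
     Num.floor (b + 2 ^+ j / 3) = Num.floor (a + 2 ^+ j / 3)).
Proof.
pose k := Num.floor a; pose f := a - k%:~R.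
have f0 : 0 <= f by rewrite subr_ge0 floor_le.
have f1 : f < 1 by have := floorD1_gt a; rewrite intrD /f -/k; lra.
(* If a is within 1/6 of the integer p, then b is within 1/3 of p, and the shift by w + r/3 with r =
   1 or 2 brings both into [p + w, p + w + 1). *)
have near (p : int) : `|a - p%:~R| < 6^-1 -> forall b, `|b - a| < 6^-1 ->
    Num.floor (b + 2 ^+ j / 3) = Num.floor (a + 2 ^+ j / 3).
  rewrite ltr_norml => ap b; rewrite ltr_norml => ba.
  have [w [r [wr r12]]] := expn2_mod3 j.
  have E : (2 : R) ^+ j = 3 * w%:R + r%:R by rewrite -natrX wr natrD natrM.
  have Z : (p + w%:Z)%:~R = p%:~R + w%:R :> R by rewrite intrD.
  by case: r12 E => /eqP -> E; rewrite !(@floor_eq_itv _ (p + w%:Z)) ?Z ?E//; lra.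
have [f6|f6] := ltP f 6^-1.
  by right; apply: (near k); rewrite -/f ger0_norm.
have [f56|f56] := ltP (5 / 6) f.
  right; apply: (near (k + 1)); rewrite intrD ltr_norml.
  by move: f1 f56; rewrite /f => ? ?; lra.
left => b; rewrite ltr_norml => ba; apply: floor_eq_itv; move: f6 f56; rewrite /f; lra.
Qed.

Context {d : nat}.
Local Notation T := (lebesgueSpace R d).
Local Notation mu := (leb R d).

(** The index of the half-open cube of side [h] around x in the grid translated by [- tau]. *)
Definition cell (tau : 'rV[R]_d) (h : R) (x : 'rV[R]_d) : 'rV[int]_d :=
  \row_i Num.floor ((x ord0 i + tau ord0 i) / h).

Definition same_cell tau h x y := cell tau h x == cell tau h y.

Lemma same_cellP (tau : 'rV[R]_d) (h : R) (x y : 'rV[R]_d) : reflect (forall i,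
    Num.floor ((x ord0 i + tau ord0 i) / h) = Num.floor ((y ord0 i + tau ord0 i) / h))
  (same_cell tau h x y).
Proof.
apply: (iffP eqP) => [/rowP H i|H]; first by have := H i; rewrite !mxE.
by apply/rowP => i; rewrite !mxE.
Qed.

(** The nesting of dyadic cells in one coordinate: an integer strictly separating x from y would,
    once doubled, separate 2x from 2y. *)
Lemma floor_half (x y : R) : Num.floor (2 * x) = Num.floor (2 * y) ->
  Num.floor x = Num.floor y.
Proof.
wlog xy : x y / x <= y => [H|] E.
  by have [/H|/ltW /H] := leP x y; [exact|move=> /(_ (esym E))].
apply/eqP; rewrite eq_le le_floor//= leNgt; apply/negP.
rewrite -lezD1 floor_ge_int intrD => xy1.
have : (2 * (Num.floor x + 1) <= Num.floor (2 * y))%R.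
  by rewrite floor_ge_int intrM intrD ler_pM2l.
rewrite -E leNgt => /negP; apply.
by rewrite floor_lt_int intrM ltr_pM2l// floorD1_gt.
Qed.

Lemma same_cell_double (tau : 'rV[R]_d) (h : R) (x y : 'rV[R]_d) : 0 < h ->
  same_cell tau h x y -> same_cell tau (2 * h) x y.
Proof.
move=> h0 /same_cellP xy; apply/same_cellP => i; apply: floor_half.
rewrite [LHS](_ : _ = Num.floor ((x ord0 i + tau ord0 i) / h)); last first.
  by congr Num.floor; field; rewrite gt_eqF.
by rewrite xy; congr Num.floor; field; rewrite gt_eqF.
Qed.

Lemma measurable_floor : measurable_fun setT (fun x : R => (Num.floor x)%:~R : R).
Proof.
apply: nondecreasing_measurable => // x y xy.
by rewrite ler_int; exact: le_floor.
Qed.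

Lemma measurable_same_cell (tau : 'rV[R]_d) (h : R) :
  measurable_fun setT (fun p : T * T => (same_cell tau h p.1 p.2)%:R : R).
Proof.
pose F (i : 'I_d) (x : T) : R := (Num.floor ((x ord0 i + tau ord0 i) / h))%:~R.
have mF i : measurable_fun setT (F i).
  apply: (measurableT_comp measurable_floor).
  apply: measurable_funM; last exact: measurable_cst.
  apply: measurable_funD; last exact: measurable_cst.
  exact: measurable_lebesgue_coord.
rewrite (_ : (fun _ => _) = (fun p : T * T =>
    \prod_i (if F i p.1 == F i p.2 then 1 else 0 : R))); last first.
  apply/funext => p; case: same_cellP => [H|H].
    by rewrite big1// => i _; rewrite /F H eqxx.
  have /existsNP[i /eqP Hi] := H.
  by rewrite (bigD1 i)//= /F eqr_int (negbTE Hi) mul0r.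
apply: measurable_prod => i _; apply: measurable_fun_ifT => //.
apply: measurable_fun_eqr.
  exact: (measurableT_comp (mF i) measurable_fst).
exact: (measurableT_comp (mF i) measurable_snd).
Qed.

Lemma leb_cell (tau : 'rV[R]_d) (h : R) (x : 'rV[R]_d) : 0 < h ->
  mu [set y | same_cell tau h x y] = (h ^+ d)%:E.
Proof.
move=> h0; pose a i := h * (Num.floor ((x ord0 i + tau ord0 i) / h))%:~R - tau ord0 i.
rewrite (_ : [set y | _] = box a (fun i => a i + h)).
  rewrite leb_box => [|i]; last by rewrite lerDl ltW.
  congr EFin; rewrite (eq_bigr (fun=> h)) ?prodr_const ?card_ord// => i _; ring.
apply/seteqP; split => y /=.
  move=> /same_cellP H i; rewrite /a H.
  have := floor_itv ((y ord0 i + tau ord0 i) / h).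
  by rewrite ler_pdivlMr// ltr_pdivrMr// intrD => /andP[? ?]; lra.
move=> H; apply/same_cellP => i; apply/esym/floor_eq_itv.
  by rewrite ler_pdivlMr//; have := H i; rewrite /a; lra.
by rewrite ltr_pdivrMr//; have := H i; rewrite /a; lra.
Qed.

End dyadic_cells.

(** * The maximal function over balls and its strong type bound *)

Section maximal_function.
Context {R : realType} {d : nat}.
Local Notation T := (lebesgueSpace R d).
Local Notation mu := (leb R d).
Implicit Types (G : T -> R) (x y : T) (r t q : R) (N j : nat).

Definition ball_integral G x t : \bar R :=
  (\int[mu]_y (G y * \1_(eball x t) y)%:E)%E.

Lemma ball_integral_ge0 G x t : (forall y, 0 <= G y) ->
  (0 <= ball_integral G x t)%E.
Proof. by move=> G0; apply: integral_ge0 => y _; rewrite lee_fin mulr_ge0. Qed.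

Lemma measurable_ball_integrand G x t : measurable_fun setT G ->
  measurable_fun setT (fun y : T => G y * \1_(eball x t) y).
Proof.
move=> mG; apply: (measurable_funM mG).
exact: (measurable_indic_eball (f := id) (g := cst x)).
Qed.

Lemma measurable_ball_integral G t : measurable_fun setT G ->
  (forall y, 0 <= G y) -> measurable_fun setT (ball_integral G ^~ t).
Proof.
move=> mG G0.
apply: (@measurable_leb_integral R d
  (fun p => (G p.2 * \1_(eball p.1 t) p.2)%:E)).
  apply/measurable_EFinP; apply: measurable_funM.
    exact: (measurableT_comp mG measurable_snd).
  exact: measurable_indic_eball.
by move=> p; rewrite lee_fin mulr_ge0.
Qed.

Lemma le_ball_integral G x y r t :
  (forall y, 0 <= G y) -> eball x r `<=` eball y t ->
  (ball_integral G x r <= ball_integral G y t)%E.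
Proof.
move=> G0 xy; apply: le_ge0_integral => z _; first by rewrite lee_fin mulr_ge0.
rewrite lee_fin ler_wpM2l// !indicE ler_nat.
by have [/set_mem/xy/mem_set ->//|] := boolP (z \in eball x r).
Qed.

Definition dyadic N j : R := 2 ^+ N / 2 ^+ j.

Lemma dyadic_gt0 N j : 0 < dyadic N j.
Proof. by rewrite divr_gt0 ?exprn_gt0. Qed.

Lemma dyadicS N j : dyadic N.+1 j.+1 = dyadic N j.
Proof. by rewrite /dyadic !exprS -mulf_div divff// mul1r. Qed.

Lemma dyadicSr N j : dyadic N j = 2 * dyadic N j.+1.
Proof. by rewrite /dyadic exprS; field; rewrite expf_neq0. Qed.

(** The shift is a third of the coarsest side 2^N. Divided by the side [dyadic N j] it becomes 2^j /
    3, as in [floor_third_shift]; since it does not depend on j, the cells belonging to one shift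
    are nested. *)
Definition grid_shift N (sg : {ffun 'I_d -> bool}) : 'rV[R]_d :=
  \row_i (if sg i then 2 ^+ N / 3 else 0).

(** The choice between shift and no shift is made in each coordinate separately, whence 2^d
    grids. *)
Lemma ball_in_cell N j x : exists sg, forall y,
  enorm (y - x) < dyadic N j / 6 -> same_cell (grid_shift N sg) (dyadic N j) x y.
Proof.
have h0 := dyadic_gt0 N j.
have /choice[s Hs] : forall i, exists b : bool, forall z : R,
    `|z - x ord0 i| < dyadic N j / 6 ->
    Num.floor ((x ord0 i + (if b then 2 ^+ N / 3 else 0)) / dyadic N j) =
    Num.floor ((z + (if b then 2 ^+ N / 3 else 0)) / dyadic N j).
  move=> i.
  have close (z : R) : `|z - x ord0 i| < dyadic N j / 6 ->
      `|z / dyadic N j - x ord0 i / dyadic N j| < 6^-1.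
    move=> zx; rewrite -mulrBl normrM (gtr0_norm (_ : 0 < (dyadic N j)^-1)).
      by rewrite ltr_pdivrMr// mulrC.
    by rewrite invr_gt0.
  have [H|H] := floor_third_shift (x ord0 i / dyadic N j) j.
    by exists false => z /close/H E; rewrite !addr0 E.
  exists true => z /close/H; rewrite !mulrDl.
  by have -> : 2 ^+ N / 3 / dyadic N j = 2 ^+ j / 3 :> R
    by rewrite /dyadic; field; rewrite !expf_neq0.
exists [ffun i => s i] => y yx; apply/same_cellP => i; rewrite !mxE ffunE.
by apply: Hs; apply: le_lt_trans yx; rewrite -[X in `|X|]/((y ord0 i) - _);
  have := ler_coord_enorm (y - x) i; rewrite !mxE.
Qed.

(* The radii are 2^N, 2^(N-1), ..., 2^-N. *)
Definition max_trunc G N x : \bar R :=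
  \big[maxe/0%E]_(j < N.*2.+1)
    ((dyadic N j ^+ d)^-1%:E * ball_integral G x (dyadic N j))%E.

(** Dyadic radii make measurability a countable matter; [ball_integral_le_maxfun] recovers all radii
    at the price of a factor 2^d. The averages are normalized by t^d instead of the measure of the
    ball. *)
Definition maxfun G x : \bar R := ereal_sup (range (fun N => max_trunc G N x)).

Lemma max_trunc_ge0 G N x : (0 <= max_trunc G N x)%E.
Proof. by apply: bigmax_ge_id. Qed.

Lemma maxfun_ge0 G x : (0 <= maxfun G x)%E.
Proof.
by apply: (le_trans (max_trunc_ge0 G 0 x)); apply: ereal_sup_ubound; exists 0%N.
Qed.

Lemma max_trunc_nondecreasing G x : nondecreasing_seq (max_trunc G ^~ x).
Proof.
apply/nondecreasing_seqP => N; apply/bigmax_leP; split; first exact: max_trunc_ge0.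
move=> j _; rewrite -dyadicS.
have j' : (j.+1 < N.+1.*2.+1)%N by rewrite doubleS !ltnS ltnW// ltn_ord.
exact: (@le_bigmax_cond _ _ _ _ (Ordinal j') xpredT
  (fun j : 'I__ => ((dyadic N.+1 j ^+ d)^-1%:E *
    ball_integral G x (dyadic N.+1 j))%E)).
Qed.

Lemma measurable_max_trunc G N : measurable_fun setT G ->
  (forall y, 0 <= G y) -> measurable_fun setT (max_trunc G N).
Proof.
move=> mG G0; rewrite /max_trunc.
elim: (index_enum _) => [|j s IH].
  by under eq_fun do rewrite big_nil; exact: measurable_cst.
under eq_fun do rewrite big_cons/=.
apply: measurable_maxe; last exact: IH.
by apply: measurable_funeM; exact: measurable_ball_integral.
Qed.

Lemma measurable_maxfun G : measurable_fun setT G ->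
  (forall y, 0 <= G y) -> measurable_fun setT (maxfun G).
Proof.
move=> mG G0; apply: (emeasurable_fun_cvg (max_trunc G)).
  by move=> N; exact: measurable_max_trunc.
by move=> x _; apply: ereal_nondecreasing_cvgn; exact: max_trunc_nondecreasing.
Qed.

Lemma maxfun_le G x (c : \bar R) : (0 <= c)%E ->
  (forall t, 0 < t -> ((t ^+ d)^-1%:E * ball_integral G x t <= c)%E) ->
  (maxfun G x <= c)%E.
Proof.
move=> c0 H; apply: ge_ereal_sup => _ [N _ <-].
by apply/bigmax_leP; split => // j _; apply: H; exact: dyadic_gt0.
Qed.

Lemma dyadic_approx t : 0 < t -> exists N (j : 'I_(N.*2.+1)),
  t <= dyadic N j <= 2 * t.
Proof.
move=> t0.
(* Both t and 1/t are at most 2^N, so t lies between the extreme radii 2^-N and 2^N. The smallest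
   listed radius that is at least t then does not exceed 2t. *)
pose N := maxn (Num.bound t) (Num.bound t^-1).
have bnd (u : R) : 0 <= u -> (Num.bound u <= N)%N -> u <= 2 ^+ N.
  move=> u0 uN; rewrite (le_trans (ltW (archi_boundP u0)))// -natrX ler_nat.
  by rewrite (leq_trans uN)// ltnW// ltn_expl.
have tN : t <= dyadic N 0 by rewrite /dyadic divr1 bnd ?(ltW t0)// leq_maxl.
have [j /andP[jN tj] jmax] : exists2 j, (j <= N.*2)%N && (t <= dyadic N j) &
    forall i, (i <= N.*2)%N && (t <= dyadic N i) -> (i <= j)%N.
  have ex : exists j, (j <= N.*2)%N && (t <= dyadic N j) by exists 0%N.
  have ub i : (i <= N.*2)%N && (t <= dyadic N i) -> (i <= N.*2)%N by case/andP.
  by case: (ex_maxnP ex ub) => j ? ?; exists j.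
exists N, (Ordinal (jN : (j < N.*2.+1)%N)); rewrite tj/=.
have [jN2|jN2] := ltnP j N.*2.
  have := jmax j.+1; rewrite jN2 ltnn /=.
  move=> H; rewrite dyadicSr ler_pM2l// leNgt; apply/negP => /ltW tj1.
  by have := H tj1.
have {jN jN2} -> : j = N.*2 by apply/eqP; rewrite eqn_leq jN.
have -> : dyadic N N.*2 = (2 ^+ N)^-1.
  by rewrite /dyadic -addnn exprD invfM mulrA divff ?mul1r ?expf_neq0.
apply: (@le_trans _ _ t); last by lra.
by rewrite -[leRHS]invrK lef_pV2 ?posrE ?invr_gt0 ?exprn_gt0// bnd ?invr_ge0 ?(ltW t0) ?leq_maxr.
Qed.

Lemma ball_integral_le_maxfun G x t : measurable_fun setT G ->
  (forall y, 0 <= G y) -> 0 < t ->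
  (ball_integral G x t <= (2 ^+ d * t ^+ d)%:E * maxfun G x)%E.
Proof.
move=> mG G0 t0; have [N [j /andP[tj jt]]] := dyadic_approx t0.
set h := dyadic N j in tj jt; have h0 : 0 < h by exact: dyadic_gt0.
have B0 : (0 <= ball_integral G x h)%E by exact: ball_integral_ge0.
apply: (@le_trans _ _ (ball_integral G x h)).
  by apply: le_ball_integral => // y; rewrite /eball/= => /lt_le_trans; apply.
apply: (@le_trans _ _ ((h ^+ d)%:E * ((h ^+ d)^-1%:E * ball_integral G x h))%E).
  by rewrite muleA -EFinM divff ?mul1e// expf_neq0// gt_eqF.
apply: lee_pmul.
- by rewrite lee_fin exprn_ge0// ltW.
- by rewrite mule_ge0// lee_fin invr_ge0 exprn_ge0// ltW.
- by rewrite lee_fin -exprMn lerXn2r ?nnegrE// ltW ?mulr_gt0.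
apply: (@le_trans _ _ (max_trunc G N x)); last by apply: ereal_sup_ubound; exists N.
exact: (@le_bigmax_cond _ _ _ _ j xpredT (fun j : 'I__ =>
  ((dyadic N j ^+ d)^-1%:E * ball_integral G x (dyadic N j))%E)).
Qed.

End maximal_function.

Opaque same_cell.

Section strong_type.
Context {R : realType} {d : nat}.
Local Notation T := (lebesgueSpace R d).
Local Notation mu := (leb R d).

(** The factors are the number of grids, the comparison of a ball with a cell whose side is 8 times
    its radius, and the constant of Doob's inequality. *)
Definition maxfun_cst (q : R) : R :=
  #|{ffun 'I_d -> bool}|%:R * ((8 ^+ d) `^ q * (2 / (1 - q^-1)) `^ q).

Lemma maxfun_cst_gt0 (q : R) : 1 < q -> 0 < maxfun_cst q.
Proof.
move=> q1; rewrite mulr_gt0 ?mulr_gt0//.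
- by rewrite ltr0n; apply/card_gt0P; exists [ffun=> true].
- by rewrite powR_gt0// divr_gt0// subr_gt0 invf_lt1// (lt_trans _ q1).
Qed.

Variables (G : T -> R) (q : R).
Hypothesis mG : measurable_fun setT G.
Hypothesis G0 : forall x, 0 <= G x.
Hypothesis q1 : 1 < q.

Let q0 : 0 < q. Proof. exact: lt_trans q1. Qed.

Let ms (M : nat) sg : forall j, measurable_fun setT
  (fun p : T * T => (same_cell (grid_shift M sg) (dyadic M j) p.1 p.2)%:R : R).
Proof. by move=> j; exact: measurable_same_cell. Qed.

(** The grid starts three levels higher because a sixth of the side must reach the radius: the side
    is 8 radii, and 8/6 > 1. *)
Lemma ball_integral_le_cell N j sg (x : T) :
  (forall y : T, enorm (y - x) < dyadic N.+3 j / 6 ->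
    same_cell (grid_shift N.+3 sg) (dyadic N.+3 j) x y) ->
  (ball_integral G x (dyadic N j) <= \int[mu]_y
    (G y * (same_cell (grid_shift N.+3 sg) (dyadic N.+3 j) x y)%:R)%:E)%E.
Proof.
move=> cellx; apply: ge0_le_integral.
- by [].
- by move=> y _; rewrite lee_fin mulr_ge0.
- by apply/measurable_EFinP; exact: measurable_ball_integrand.
- have m1 := measurable_fun_pair2 x (ms N.+3 sg j).
  have m2 := measurable_funM mG m1.
  apply/measurable_EFinP.
  exact: m2.
- move=> y _; rewrite lee_fin ler_wpM2l// indicE ler_nat.
  have [yx|//] := boolP (y \in eball x (dyadic N j)).
  rewrite cellx//; move: yx; rewrite mem_eball => /lt_le_trans; apply.
  have := @dyadic_gt0 R N j; rewrite -3!addn1 /dyadic !exprD; lra.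
Qed.

Section truncated.
Hypothesis Gq : (\int[mu]_x (G x `^ q)%:E < +oo)%E.
Variable N : nat.

Let M := N.+3.

Let e sg j : T -> T -> bool := same_cell (grid_shift M sg) (@dyadic R M j).

Let m j : R := dyadic M j ^+ d.

Let es sg j x y : e sg j x y = e sg j y x. Proof. exact: eq_sym. Qed.

Let et sg j x y z : e sg j x y -> e sg j y z -> e sg j x z.
Proof. by move=> /eqP xy /eqP yz; apply/eqP; rewrite xy. Qed.

Let en sg j x y : e sg j.+1 x y -> e sg j x y.
Proof. by move=> xy; rewrite /e dyadicSr; exact: same_cell_double (dyadic_gt0 _ _) xy. Qed.

Let m0 j : 0 < m j. Proof. by rewrite exprn_gt0// dyadic_gt0. Qed.

Let me sg j x : leb_sigma_finite [set y | e sg j x y] = (m j)%:E.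
Proof. by apply: leb_cell; exact: dyadic_gt0. Qed.

Let B sg x : R := block_max leb_sigma_finite (e sg) m G N.*2 x.

Let B_ge0 sg x : 0 <= B sg x.
Proof. exact: (block_max_ge0 _ _ m0 G0). Qed.

Let mB sg : measurable_fun setT (B sg).
Proof. exact: (measurable_block_max leb_sigma_finite m (ms M sg) mG G0). Qed.

Let ball_avg_le (j : nat) x : (j <= N.*2)%N -> exists sg,
  ((dyadic N j ^+ d)^-1%:E * ball_integral G x (dyadic N j) <=
   (8 ^+ d * B sg x)%:E)%E.
Proof.
move=> jN; have [sg cellx] := ball_in_cell M j x; exists sg.
have h0 : 0 < @dyadic R N j ^+ d by rewrite exprn_gt0// dyadic_gt0.
apply: (le_trans (lee_wpmul2l _ (ball_integral_le_cell cellx))).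
  by rewrite lee_fin invr_ge0 ltW.
have fin y : (block_integral leb_sigma_finite (e sg) j G y < +oo)%E.
  exact: (block_integral_lty (ms M sg) (me sg) mG G0 q1 Gq).
rewrite [X in (_ * X)%E](_ : _ =
    ((m j)%:E * (block_avg leb_sigma_finite (e sg) m j G x)%:E)%E); last first.
  transitivity (block_integral leb_sigma_finite (e sg) j G x); first by [].
  rewrite (block_avgE m G0 fin) muleA -EFinM divff ?mul1e// gt_eqF//; exact: m0.
rewrite muleA -!EFinM lee_fin (_ : (dyadic N j ^+ d)^-1 * m j = 8 ^+ d).
  by rewrite ler_wpM2l ?exprn_ge0//; exact: (le_block_max leb_sigma_finite (e sg) m G x jN).
rewrite /m -exprVn -exprMn; congr (_ ^+ d).
by rewrite /M /dyadic !exprS; field; rewrite !expf_neq0.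
Qed.

Let max_trunc_powR_le x :
  (max_trunc G N x `^ q <= \sum_sg (((8 ^+ d) `^ q)%:E * (B sg x `^ q)%:E))%E.
Proof.
pose S := \sum_sg ((8 ^+ d) `^ q * B sg x `^ q).
have S0 : 0 <= S by apply: sumr_ge0 => sg _; rewrite mulr_ge0 ?powR_ge0.
have -> : (\sum_sg (((8 ^+ d) `^ q)%:E * (B sg x `^ q)%:E) = (S `^ q^-1)%:E `^ q)%E.
  rewrite poweR_EFin -powRrM mulVf ?gt_eqF// powRr1// -sumEFin.
  by apply: eq_bigr => sg _; rewrite EFinM.
apply: le_poweR; [exact: ltW|exact: max_trunc_ge0|].
apply/bigmax_leP; split; first by rewrite lee_fin powR_ge0.
move=> j _; have [sg /le_trans] := @ball_avg_le j x (ltn_ord j); apply.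
have B8 : 0 <= 8 ^+ d * B sg x by rewrite mulr_ge0 ?exprn_ge0.
rewrite lee_fin -[leLHS]powRr1// -[X in _ `^ X](mulfV (lt0r_neq0 q0)) powRrM.
rewrite ge0_ler_powR ?nnegrE ?invr_ge0 ?powR_ge0 ?(ltW q0)//.
rewrite powRM ?exprn_ge0// /S (bigD1 sg)//= lerDl sumr_ge0// => i _.
by rewrite mulr_ge0 ?powR_ge0.
Qed.

Lemma integral_max_trunc_le : (\int[mu]_x (max_trunc G N x `^ q) <=
  (maxfun_cst q)%:E * \int[mu]_x (G x `^ q)%:E)%E.
Proof.
have mBq sg : measurable_fun setT (fun x => (B sg x `^ q)%:E).
  by apply/measurable_EFinP; exact: (measurableT_comp (measurable_powR q)).
apply: (@le_trans _ _
    (\int[mu]_x \sum_sg (((8 ^+ d) `^ q)%:E * (B sg x `^ q)%:E))%E).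
  apply: le_ge0_integral => x _; first exact: poweR_ge0.
  exact: max_trunc_powR_le.
have mcB sg : measurable_fun setT
    (fun x => ((8 ^+ d) `^ q)%:E * (B sg x `^ q)%:E)%E.
  exact: measurable_funeM.
have cB0 sg x : [set: T] x -> (0 <= ((8 ^+ d) `^ q)%:E * (B sg x `^ q)%:E)%E.
  by rewrite mule_ge0 ?lee_fin ?powR_ge0.
rewrite (ge0_integral_sum mu measurableT mcB cB0).
have step sg : (\int[mu]_x (((8 ^+ d) `^ q)%:E * (B sg x `^ q)%:E) <=
    ((8 ^+ d) `^ q * (2 / (1 - q^-1)) `^ q)%:E * \int[mu]_x (G x `^ q)%:E)%E.
  rewrite ge0_integralZl ?lee_fin ?powR_ge0//; last first.
    by move=> x _; rewrite lee_fin powR_ge0.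
  rewrite EFinM -muleA lee_wpmul2l ?lee_fin ?powR_ge0//.
  have H := doob_maximal (es sg) (@et sg) (@en sg) m0 (ms M sg) (me sg) mG G0 q1 Gq N.*2.
  exact: H.
apply: (@le_trans _ _ (\sum_(sg : {ffun 'I_d -> bool})
    ((8 ^+ d) `^ q * (2 / (1 - q^-1)) `^ q)%:E * \int[mu]_x (G x `^ q)%:E)%E).
  by apply: lee_sum => sg _; exact: step.
rewrite -ge0_sume_distrl; last by move=> sg _; rewrite lee_fin mulr_ge0 ?powR_ge0.
rewrite sumEFin sumr_const -[X in (X%:E * _)%E]mulr_natl le_eqVlt; apply/orP; left.
by apply/eqP; congr (_%:E * _)%E.
Qed.

End truncated.

(** The truncations increase to the maximal function and their bound is uniform in N, so monotone
    convergence applies. *)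
Lemma maxfun_strong_type : (\int[mu]_x (maxfun G x `^ q) <=
  (maxfun_cst q)%:E * \int[mu]_x (G x `^ q)%:E)%E.
Proof.
have [Gq|] := ltP (\int[mu]_x (G x `^ q)%:E)%E +oo%E; last first.
  by rewrite leye_eq => /eqP ->; rewrite gt0_muley ?leey// lte_fin maxfun_cst_gt0.
have nd x : nondecreasing_seq (fun N => max_trunc G N x `^ q)%E.
  move=> a b ab; apply: le_poweR; [exact: ltW|exact: max_trunc_ge0|].
  exact: max_trunc_nondecreasing.
have mt N : measurable_fun setT (fun x => max_trunc G N x `^ q)%E.
  by apply: (measurableT_comp (measurable_poweR q)); exact: measurable_max_trunc.
apply: (@le_trans _ _ (\int[mu]_x (limn (fun N => max_trunc G N x `^ q)))%E).
  apply: ge0_le_integral; first by [].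
  - by move=> x _; exact: poweR_ge0.
  - by apply: (measurableT_comp (measurable_poweR q)); exact: measurable_maxfun.
  - apply: (emeasurable_fun_cvg (fun N x => max_trunc G N x `^ q)%E) => //.
    by move=> x _; apply: ereal_nondecreasing_is_cvgn; exact: nd.
  - move=> x _.
    have -> : limn (fun N => max_trunc G N x `^ q)%E =
        ereal_sup (range (fun N => max_trunc G N x `^ q)%E).
      by apply/cvg_lim => //; exact: ereal_nondecreasing_cvgn.
    set L := ereal_sup _.
    have L0 : (0 <= L)%E.
      by apply: (@le_trans _ _ (max_trunc G 0 x `^ q)%E); rewrite ?poweR_ge0//;
        apply: ereal_sup_ubound; exists 0%N.
    have -> : L = ((L `^ q^-1) `^ q)%E.
      by rewrite -poweRrM mulVf ?gt_eqF// poweRe1.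
    apply: le_poweR; [exact: ltW|exact: maxfun_ge0|].
    apply: ge_ereal_sup => _ [N _ <-].
    rewrite -[leLHS]poweRe1 ?max_trunc_ge0// -(mulfV (lt0r_neq0 q0)) poweRrM.
    apply: le_poweR; [by rewrite invr_ge0 ltW|exact: poweR_ge0|].
    by apply: ereal_sup_ubound; exists N.
rewrite (monotone_convergence _ measurableT mt); last 2 first.
- by move=> N x _; exact: poweR_ge0.
- by move=> x _; exact: nd.
apply: lime_le.
  apply: ereal_nondecreasing_is_cvgn => a b ab; apply: ge0_le_integral; first by [].
  - by move=> x _; exact: poweR_ge0.
  - exact: mt.
  - exact: mt.
  - by move=> x _; exact: nd.
by apply: nearW => N; exact: integral_max_trunc_le.
Qed.

End strong_type.

(** * Sums over dyadic radii from the integral conditions *)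

Section dyadic_sums.
Context {R : realType}.

Local Notation lambda := (@completed_lebesgue_measure R).

Lemma completed_lebesgue_measure_itv_oo (a b : R) : a <= b ->
  lambda `]a, b[%classic = (b - a)%:E.
Proof.
move=> ab; transitivity (lebesgue_measure (`]a, b[%classic : set R)) => //.
rewrite lebesgue_measure_itv/= lte_fin; case: ltP => // ba.
by rewrite (@le_anti _ _ a b) ?subrr// ab ba.
Qed.

(** On (u_i, 2 u_i), of length u_i, the hypothesis gives g(t) >= a_i / t >= a_i / (2 u_i), so this
    interval contributes at least a_i / 2. The comparison is with a step function below [g] on
    disjoint intervals, hence it is monotonicity alone and covers a [g] of unknown measurability. *)
Lemma dyadic_sum_le_integral (D : set R) (g : R -> R) (u a : nat -> R) n :
  measurable D -> (forall t, D t -> 0 <= g t) ->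
  (forall i, 0 < u i) -> (forall i, 0 <= a i) ->
  (forall i, `]u i, 2 * u i[ `<=` D) ->
  trivIset setT (fun i => `]u i, 2 * u i[%classic) ->
  (forall i t, u i < t < 2 * u i -> a i <= t * g t) ->
  ((\sum_(i < n) a i)%:E <= 2%:E * \int[lambda]_(t in D) (g t)%:E)%E.
Proof.
move=> mD g0 u0 a0 uD uI ag.
have cara (A : set R) : measurable A -> @measurable _
    (caratheodory_type (wlength (@idfun R))^*%mu) A.
  by move=> mA; exact: sub_caratheodory.
pose J i : set R := `]u i, 2 * u i[%classic.
have mI i : @measurable _ (caratheodory_type (wlength (@idfun R))^*%mu) (J i).
  by apply: cara; exact: measurable_itv.
have mD' := cara _ mD.
have mind i : @measurable_fun _ _
    (caratheodory_type (wlength (@idfun R))^*%mu) _ D (fun t => (\1_(J i) t : R)%:E).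
  by apply/measurable_EFinP; exact: measurable_indic.
pose c i := a i / (2 * u i).
have c0 i : 0 <= c i by rewrite divr_ge0// mulr_ge0// ltW.
have cI0 i t : D t -> (0 <= (c i)%:E * (\1_(J i) t)%:E)%E.
  by move=> _; rewrite -EFinM lee_fin mulr_ge0.
have mcI i : @measurable_fun _ _
    (caratheodory_type (wlength (@idfun R))^*%mu) _ D
    (fun t => (c i)%:E * (\1_(J i) t)%:E)%E.
  by apply: measurable_funeM; exact: mind.
apply: (@le_trans _ _ (2%:E *
    \int[lambda]_(t in D) (\sum_(i < n) ((c i)%:E * (\1_(J i) t)%:E)))%E); last first.
  apply: lee_wpmul2l; first by rewrite lee_fin.
  apply: le_ge0_integral => [t Dt|t Dt]; first by apply: sume_ge0 => i _; exact: cI0.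
  have [[k kn kt]|H] := pselect (exists2 k : 'I_n, true & J k t); last first.
    rewrite big1 ?lee_fin ?g0// => i _; rewrite indicE memNset ?mule0// => It.
    by apply: H; exists i.
  rewrite (bigD1 k)//= big1 ?adde0 => [|i ik]; last first.
    rewrite indicE memNset ?mule0// => It.
    have /val_inj ik' := uI i k I I (ex_intro _ t (conj It kt)).
    by rewrite ik' eqxx in ik.
  rewrite indicE mem_set// mule1 lee_fin /c.
  have /andP[t1 t2] : u k < t < 2 * u k by move: kt; rewrite /J/= in_itv.
  have t0 : 0 < t by exact: lt_trans t1.
  rewrite ler_pdivrMr ?mulr_gt0//.
  have := ag k t; rewrite t1 t2 => /(_ erefl)/le_trans; apply.
  by rewrite mulrC ler_wpM2l ?g0// ltW.
rewrite (@ge0_integral_sum _ _ _ lambda _ mD' _ (fun (i : 'I_n) t =>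
  (c i)%:E * (\1_(J i) t)%:E)%E (fun i => mcI i) (fun i => @cI0 i)).
rewrite (eq_bigr (fun i : 'I_n => (a i / 2)%:E)) => [|i _]; last first.
  rewrite (ge0_integralZl _ mD' (mind i)) ?lee_fin//.
  rewrite integral_indic//.
  rewrite setIidl//.
  rewrite [X in (_ * X)%E](_ : _ = (2 * u i - u i)%:E); last first.
    by apply: completed_lebesgue_measure_itv_oo; rewrite mulr_natl mulr2n lerDl ltW.
    by rewrite -EFinM; congr EFin; rewrite /c; field; rewrite gt_eqF.
  exact: uD.
by rewrite sumEFin -EFinM lee_fin -mulr_suml mulrC divfK.
Qed.

End dyadic_sums.

Lemma le_powR (R : realType) (x y r : R) :
  0 <= r -> 0 <= x -> x <= y -> x `^ r <= y `^ r.
Proof.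
by move=> r0 x0 xy; apply: ge0_ler_powR; rewrite ?nnegrE// (le_trans x0).
Qed.

Section growth_classes.
Context {R : realType} {d : nat}.
Variables (q p : R) (phi : R -> R).
Hypotheses (q1 : 1 < q) (qp : q <= p) (Gphi : Gclass d q%:E p%:E phi).

Let q0 : 0 < q. Proof. exact: lt_trans q1. Qed.
Let p0 : 0 < p. Proof. exact: lt_le_trans qp. Qed.

Lemma recipE (a : R) : a != 0 -> recip a%:E = a^-1.
Proof. by move=> a0; rewrite /recip inver (negbTE a0). Qed.

Lemma Gclass_gt0 t : 0 < t -> 0 < phi t. Proof. by case: Gphi => H _ _; exact: H. Qed.

Let dp0 : 0 <= d%:R / p. Proof. by rewrite divr_ge0// ltW. Qed.

Lemma Gclass_almost_decreasing : exists2 C : R, 0 < C &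
  forall r s, 0 < r -> r <= s ->
    phi s * s `^ (d%:R / p) <= C * (phi r * r `^ (d%:R / p)).
Proof.
by case: Gphi => _ [C C0 H] _; exists C => // r s; have := H r s;
  rewrite recipE// gt_eqF.
Qed.

Lemma Gclass_le : exists2 C : R, 0 < C &
  forall r s, 0 < r -> r <= s -> phi s <= C * phi r.
Proof.
have [C C0 H] := Gclass_almost_decreasing; exists C => // r s r0 rs.
have s0 : 0 < s by exact: lt_le_trans rs.
rewrite -(@ler_pM2r _ (s `^ (d%:R / p))) ?powR_gt0//.
apply: (le_trans (H _ _ r0 rs)); rewrite -mulrA ler_wpM2l ?(ltW C0)//.
rewrite ler_wpM2l ?(ltW (Gclass_gt0 r0))// ge0_ler_powR ?nnegrE ?(ltW r0)//.
exact: ltW.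
Qed.

(** The condition with exponent q keeps [phi] from dropping too fast: up to the constant C, doubling
    the radius costs at most 2^(d/q). *)
Lemma Gclass_doubling : exists2 C : R, 0 < C &
  forall u t, 0 < u -> u <= t -> t <= 2 * u -> phi u <= C * phi t.
Proof.
case: Gphi => _ _ [C C0 H]; rewrite recipE ?gt_eqF// in H.
have dq0 : 0 <= d%:R / q by rewrite divr_ge0// ltW.
exists (C * 2 `^ (d%:R / q)); first by rewrite mulr_gt0 ?powR_gt0.
move=> u t u0 ut t2; have t0 : 0 < t by exact: lt_le_trans ut.
rewrite -(@ler_pM2r _ (u `^ (d%:R / q))) ?powR_gt0//.
apply: (le_trans (H _ _ u0 ut)); rewrite -!mulrA ler_wpM2l ?(ltW C0)//.
rewrite mulrCA ler_wpM2l ?(ltW (Gclass_gt0 t0))//.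
rewrite -powRM ?(ltW u0)//; apply: ge0_ler_powR => //.
  by rewrite nnegrE ltW.
by rewrite nnegrE mulr_ge0// ltW.
Qed.

Lemma trivIset_dyadic_up (r : R) : 0 < r ->
  trivIset setT (fun i => `]r * 2 ^+ i, 2 * (r * 2 ^+ i)[%classic).
Proof.
move=> r0.
have key i j t : (i < j)%N -> r * 2 ^+ i < t < 2 * (r * 2 ^+ i) ->
    r * 2 ^+ j < t < 2 * (r * 2 ^+ j) -> False.
  move=> ij /andP[_ t1] /andP[t2 _]; have := lt_trans t2 t1.
  by rewrite mulrCA ltr_pM2l// -exprS ltr_eXn2l ?ltr1n// ltnNge ij.
move=> i j _ _ [t []] /=; rewrite !in_itv/= => ti tj.
by have [/key/(_ ti tj)|/key/(_ tj ti)|] := ltngtP i j.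
Qed.

Lemma trivIset_dyadic_down (r : R) : 0 < r ->
  trivIset setT (fun i => `]r / 2 ^+ i.+1, 2 * (r / 2 ^+ i.+1)[%classic).
Proof.
move=> r0.
have key i j t : (i < j)%N -> r / 2 ^+ i.+1 < t < 2 * (r / 2 ^+ i.+1) ->
    r / 2 ^+ j.+1 < t < 2 * (r / 2 ^+ j.+1) -> False.
  move=> ij /andP[t1 _] /andP[_ t2]; have := lt_trans t1 t2.
  have -> : 2 * (r / 2 ^+ j.+1) = r / 2 ^+ j by rewrite exprS; field; rewrite expf_neq0.
  by rewrite ltr_pM2l// ltf_pV2 ?posrE ?exprn_gt0// ltr_eXn2l ?ltr1n// ltnNge ij.
move=> i j _ _ [t []] /=; rewrite !in_itv/= => ti tj.
by have [/key/(_ ti tj)|/key/(_ tj ti)|] := ltngtP i j.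
Qed.

Local Notation lambda := (@completed_lebesgue_measure R).

(** For b(r) = phi(r) r^(d/p) the hypothesis bounds the integral of b(t)^q dt/t beyond r by C
    b(r)^q, hence also the dyadic sums of b^q. As b is almost decreasing, b(2^i r)^(p-q) <= (E
    b(r))^(p-q), which raises the exponent from q to p. *)
Lemma Gclass_power_sum : (exists2 C : R, 0 < C & forall r : R, 0 < r ->
    (\int[lambda]_(t in `]r, +oo[%classic)
       (phi t `^ q * t `^ (d%:R * q / p - 1))%:E
     <= (C * (phi r `^ q * r `^ (d%:R * q / p)))%:E)%E) ->
  exists2 C : R, 0 < C & forall r n, 0 < r ->
    \sum_(i < n) (phi (r * 2 ^+ i) `^ p * (r * 2 ^+ i) ^+ d)
    <= C * (phi r `^ p * r ^+ d).
Proof.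
move=> [C C0 HC]; have [D D0 HD] := Gclass_doubling.
have [E E0 HE] := Gclass_almost_decreasing.
pose b r := phi r * r `^ (d%:R / p).
have b0 r : 0 < r -> 0 < b r by move=> r0; rewrite mulr_gt0 ?powR_gt0 ?Gclass_gt0.
have bq r : 0 < r -> b r `^ q = phi r `^ q * r `^ (d%:R * q / p).
  move=> r0; rewrite powRM ?powR_ge0 ?(ltW (Gclass_gt0 r0))// -powRrM.
  by congr (_ * _ `^ _); rewrite mulrAC.
have bp r : 0 < r -> b r `^ p = phi r `^ p * r ^+ d.
  move=> r0; rewrite powRM ?powR_ge0 ?(ltW (Gclass_gt0 r0))// -powRrM.
  by rewrite divfK ?gt_eqF// powR_mulrn// ltW.
have sumq r n : 0 < r -> \sum_(i < n) b (r * 2 ^+ i) `^ q <= 2 * D `^ q * C * b r `^ q.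
  move=> r0.
  have Dq0 : 0 < D `^ q by rewrite powR_gt0.
  rewrite -(@ler_pM2l _ (D `^ q)^-1) ?invr_gt0// mulr_sumr -lee_fin.
  apply: (le_trans (@dyadic_sum_le_integral _ `]r, +oo[%classic
    (fun t => phi t `^ q * t `^ (d%:R * q / p - 1)) (fun i => r * 2 ^+ i)
    (fun i => (D `^ q)^-1 * b (r * 2 ^+ i) `^ q) n _ _ _ _ _ _ _)).
  - exact: measurable_itv.
  - by move=> t _; rewrite mulr_ge0 ?powR_ge0.
  - by move=> i; rewrite mulr_gt0 ?exprn_gt0.
  - by move=> i; rewrite mulr_ge0 ?invr_ge0 ?powR_ge0.
  - move=> i t /=; rewrite !in_itv/= => /andP[rt _]; rewrite andbT.
    by apply: le_lt_trans rt; rewrite ler_peMr ?(ltW r0)// exprn_ege1// ler1n.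
  - exact: trivIset_dyadic_up.
  - move=> i t /andP[ut t2u]; set u := r * 2 ^+ i in ut t2u *.
    have u0 : 0 < u by rewrite mulr_gt0 ?exprn_gt0.
    have t0 : 0 < t by exact: lt_trans ut.
    rewrite ler_pdivrMl//.
    have -> : t * (phi t `^ q * t `^ (d%:R * q / p - 1)) = b t `^ q.
      rewrite bq// mulrCA; congr (_ * _).
      rewrite -{1}(powRr1 (ltW t0)) -powRD; last by rewrite (gt_eqF t0) implybT.
      by congr (_ `^ _); ring.
    rewrite -powRM ?(ltW D0) ?(ltW (b0 _ t0))//.
    apply: le_powR; [exact: ltW|by rewrite ltW ?b0|].
    rewrite /b mulrA; apply: ler_pM; rewrite ?powR_ge0 ?(ltW (Gclass_gt0 u0))//.
      by apply: HD => //; exact: ltW.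
    by apply: le_powR => //; exact: ltW.
  apply: (le_trans (lee_wpmul2l _ (HC r r0))); first by rewrite lee_fin.
  rewrite -EFinM lee_fin -bq// le_eqVlt; apply/orP; left; apply/eqP.
  by field; rewrite gt_eqF.
have E1 : 0 < E `^ (p - q) by exact: powR_gt0.
exists (E `^ (p - q) * (2 * D `^ q * C)) => [|r n r0].
  by rewrite !mulr_gt0 ?powR_gt0.
have u0 i : 0 < r * 2 ^+ i by rewrite mulr_gt0 ?exprn_gt0.
rewrite -bp//; under eq_bigr do rewrite -bp//.
have pow x : 0 < x -> x `^ p = x `^ (p - q) * x `^ q.
  by move=> x0; rewrite -powRD ?subrK// (gt_eqF x0) implybT.
apply: (@le_trans _ _ (\sum_(i < n) ((E * b r) `^ (p - q) * b (r * 2 ^+ i) `^ q))).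
  apply: ler_sum => i _; rewrite pow ?b0// ler_wpM2r ?powR_ge0//.
  apply: le_powR; [by rewrite subr_ge0|by rewrite ltW ?b0|].
  by apply: HE => //; rewrite ler_peMr ?(ltW r0)// exprn_ege1// ler1n.
rewrite -mulr_sumr powRM ?(ltW E0) ?(ltW (b0 _ _))// (pow (b r)) ?b0//.
apply: (le_trans (ler_wpM2l _ (sumq r n r0))); first by rewrite mulr_ge0 ?powR_ge0.
by rewrite le_eqVlt; apply/orP; left; apply/eqP; ring.
Qed.

End growth_classes.

Section kernel_sums.
Context {R : realType}.
Variables (phi rho : R -> R) (th C1 C' : R).
Hypotheses (phi_gt0 : forall t, 0 < t -> 0 < phi t)
  (rho_gt0 : forall t, 0 < t -> 0 < rho t) (C10 : 0 < C1) (C'0 : 0 < C').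
Hypothesis rho_doubling : forall r t : R, 0 < r -> 0 < t ->
  2^-1 <= r / t <= 2 -> C1^-1 <= rho r / rho t <= C1.
Local Notation lambda := (@completed_lebesgue_measure R).

Lemma rho_le r t : 0 < r -> 0 < t -> 2^-1 <= r / t <= 2 -> rho r <= C1 * rho t.
Proof.
by move=> r0 t0 /(rho_doubling r0 t0)/andP[_]; rewrite ler_pdivrMr// rho_gt0.
Qed.

(** The term at radius r / 2^i is compared with [rho] on the interval (r / 2^(i+1), r / 2^i) below
    it, so that all intervals stay inside (0, r) although the first radius is r itself. *)
Lemma rho_sum_near r n : 0 < r ->
  (\int[lambda]_(t in `]0%R, r[%classic) (rho t / t)%:E <=
    (C' * phi r `^ (th - 1))%:E)%E ->
  \sum_(i < n) rho (r / 2 ^+ i) <= 2 * C1 * C' * phi r `^ (th - 1).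
Proof.
move=> r0 H.
have e2 i : r / 2 ^+ i = 2 * (r / 2 ^+ i.+1).
  by rewrite exprS; field; rewrite expf_neq0.
have u0 i : 0 < r / 2 ^+ i by rewrite divr_gt0 ?exprn_gt0.
rewrite -(@ler_pM2l _ C1^-1) ?invr_gt0// mulr_sumr -lee_fin.
apply: (le_trans (@dyadic_sum_le_integral _ `]0, r[%classic
  (fun t => rho t / t) (fun i => r / 2 ^+ i.+1)
  (fun i => C1^-1 * rho (r / 2 ^+ i)) n _ _ _ _ _ _ _)).
- exact: measurable_itv.
- by move=> t /=; rewrite in_itv/= => /andP[t0 _]; rewrite divr_ge0 ?(ltW (rho_gt0 _)) ?ltW.
- by move=> i; exact: u0.
- by move=> i; rewrite mulr_ge0 ?invr_ge0 ?(ltW C10) ?(ltW (rho_gt0 (u0 _))).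
- move=> i t /=; rewrite !in_itv/= => /andP[ut t2].
  rewrite (lt_trans (u0 i.+1) ut) (lt_le_trans t2)// -e2.
  by rewrite ler_pdivrMr ?exprn_gt0// ler_peMr ?(ltW r0)// exprn_ege1// ler1n.
- exact: trivIset_dyadic_down.
- move=> i t /andP[ut t2]; rewrite (e2 i); set u := r / 2 ^+ i.+1 in ut t2 *.
  have up : 0 < u by exact: u0.
  have t0 : 0 < t by exact: lt_trans ut.
  have -> : t * (rho t / t) = rho t by rewrite mulrCA divff ?mulr1// gt_eqF.
  rewrite ler_pdivrMl// rho_le ?mulr_gt0//.
  rewrite ler_pdivlMr// ler_pdivrMr//; apply/andP; split; last by lra.
  by rewrite mulrC ler_pdivrMr//; lra.
apply: (le_trans (lee_wpmul2l _ H)); first by rewrite lee_fin.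
rewrite -EFinM lee_fin le_eqVlt; apply/orP; left; apply/eqP.
by field; rewrite gt_eqF.
Qed.

(** Here [phi] too is moved from the radius u to points t of (u, 2u), where it may be smaller; [D]
    bounds the loss. *)
Lemma rho_sum_far (D : R) r n : 0 < r -> 0 < D ->
  (forall u t, 0 < u -> u <= t -> t <= 2 * u -> phi u <= D * phi t) ->
  (\int[lambda]_(t in `]r, +oo[%classic) (rho t * phi t / t)%:E <=
    (C' * phi r `^ th)%:E)%E ->
  \sum_(i < n) rho (r * 2 ^+ i) * phi (r * 2 ^+ i) <= 2 * C1 * D * C' * phi r `^ th.
Proof.
move=> r0 D0 HD H.
have u0 i : 0 < r * 2 ^+ i by rewrite mulr_gt0 ?exprn_gt0.
have CD : 0 < C1 * D by rewrite mulr_gt0.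
rewrite -(@ler_pM2l _ (C1 * D)^-1) ?invr_gt0// mulr_sumr -lee_fin.
apply: (le_trans (@dyadic_sum_le_integral _ `]r, +oo[%classic
  (fun t => rho t * phi t / t) (fun i => r * 2 ^+ i)
  (fun i => (C1 * D)^-1 * (rho (r * 2 ^+ i) * phi (r * 2 ^+ i))) n _ _ _ _ _ _ _)).
- exact: measurable_itv.
- move=> t /=; rewrite in_itv/= andbT => rt; have t0 := lt_trans r0 rt.
  by rewrite divr_ge0 ?mulr_ge0 ?(ltW (rho_gt0 _)) ?(ltW (phi_gt0 _)) ?ltW.
- by [].
- by move=> i; rewrite mulr_ge0 ?invr_ge0 ?(ltW CD) ?mulr_ge0 ?(ltW (rho_gt0 (u0 _))) ?(ltW (phi_gt0 (u0 _))).
- move=> i t /=; rewrite !in_itv/= => /andP[rt _]; rewrite andbT.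
  by apply: le_lt_trans rt; rewrite ler_peMr ?(ltW r0)// exprn_ege1// ler1n.
- exact: trivIset_dyadic_up.
- move=> i t /andP[ut t2]; set u := r * 2 ^+ i in ut t2 *.
  have up : 0 < u by exact: u0.
  have t0 : 0 < t by exact: lt_trans ut.
  have -> : t * (rho t * phi t / t) = rho t * phi t.
    by rewrite mulrCA divff ?mulr1// gt_eqF.
  rewrite ler_pdivrMl//.
  rewrite [leRHS](_ : _ = (C1 * rho t) * (D * phi t)); last by ring.
  apply: ler_pM; rewrite ?(ltW (rho_gt0 up)) ?(ltW (phi_gt0 up))//; last first.
    by apply: HD => //; exact: ltW.
  apply: rho_le => //; rewrite ler_pdivlMr// ler_pdivrMr//.
  by apply/andP; split; lra.
apply: (le_trans (lee_wpmul2l _ H)); first by rewrite lee_fin.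
rewrite -EFinM lee_fin le_eqVlt; apply/orP; left; apply/eqP.
by field; rewrite !gt_eqF.
Qed.

End kernel_sums.

(** * Local integrals and Morrey estimates *)

Section local_integrals.
Context {R : realType} {d : nat}.
Local Notation T := (lebesgueSpace R d).
Local Notation mu := (leb R d).
Implicit Types (U V : T -> \bar R) (x y : T) (r t : R).
Local Open Scope ereal_scope.

Definition local_int U y r : \bar R := \int[mu]_x (U x * (\1_(eball y r) x)%:E).

Lemma ball_integralE (G : T -> R) y r :
  ball_integral G y r = local_int (EFin \o G) y r.
Proof. by apply: eq_integral => x _; rewrite EFinM. Qed.

Lemma local_int_ge0 U y r : (forall x, 0 <= U x) -> 0 <= local_int U y r.
Proof.
by move=> U0; apply: integral_ge0 => x _; rewrite mule_ge0// lee_fin.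
Qed.

Lemma measurable_indic_ballE y r :
  measurable_fun setT (fun x : T => (\1_(eball y r) x : R)%:E).
Proof.
apply/measurable_EFinP.
exact: (measurable_indic_eball (f := id) (g := cst y)).
Qed.

Lemma measurable_local_integrand U y r : measurable_fun setT U ->
  measurable_fun setT (fun x => U x * (\1_(eball y r) x)%:E).
Proof. by move=> mU; apply: (emeasurable_funM mU); exact: measurable_indic_ballE. Qed.

Lemma measurable_local_int U r : measurable_fun setT U -> (forall x, 0 <= U x) ->
  measurable_fun setT (local_int U ^~ r).
Proof.
move=> mU U0.
apply: (@measurable_leb_integral R d (fun p => U p.2 * (\1_(eball p.1 r) p.2)%:E)).
  apply: emeasurable_funM; first exact: (measurableT_comp mU measurable_snd).
  by apply/measurable_EFinP; exact: measurable_indic_eball.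
by move=> p; rewrite mule_ge0// lee_fin.
Qed.

Lemma le_local_int U V y r : (forall x, 0 <= U x) ->
  (forall x, (enorm (x - y) < r)%R -> U x <= V x) -> local_int U y r <= local_int V y r.
Proof.
move=> U0 UV; apply: le_ge0_integral => x _; first by rewrite mule_ge0// lee_fin.
rewrite indicE mem_eball.
have [xy|_] := boolP (enorm (x - y) < r)%R; last by rewrite !mule0.
by rewrite !mule1 UV.
Qed.

Lemma le_local_int_ball U x y r t : (forall x, 0 <= U x) ->
  eball x r `<=` eball y t -> local_int U x r <= local_int U y t.
Proof.
move=> U0 xy; apply: le_ge0_integral => z _; first by rewrite mule_ge0// lee_fin.
rewrite !indicE; have [/set_mem/xy/mem_set ->//|_] := boolP (z \in eball x r).
by rewrite mule0 mule_ge0// lee_fin.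
Qed.

Lemma local_int_hoelder U V y r (th : R) : measurable_fun setT U ->
  measurable_fun setT V -> (forall x, 0 <= U x) -> (forall x, 0 <= V x) ->
  (0 < th < 1)%R ->
  local_int (fun x => U x `^ (1 - th) * V x `^ th) y r <=
  local_int U y r `^ (1 - th) * local_int V y r `^ th.
Proof.
move=> mU mV U0 V0 th01; have /andP[th0 th1] := th01.
apply: le_trans (ge0_integral_hoelder mu (measurable_local_integrand y r mU)
  (measurable_local_integrand y r mV) _ _ th01).
- rewrite le_eqVlt; apply/orP; left; apply/eqP; apply: eq_integral => x _.
  rewrite indicE; case: (x \in _) => /=; first by rewrite !mule1.
  by rewrite !mule0 !poweR0r ?mule0// gt_eqF// subr_gt0.
- by move=> x; rewrite mule_ge0// lee_fin.
- by move=> x; rewrite mule_ge0// lee_fin.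
Qed.

(** For U = |f|^q and e = p/q this is the p-th power of the amalgam norm of f, see
    [amalgam_normE]. *)
Definition mixed_int (e : R) U r : \bar R := \int[mu]_y (local_int U y r `^ e).

Lemma mixed_int_hoelder (e : R) U V r (th : R) : (0 < e)%R -> measurable_fun setT U ->
  measurable_fun setT V -> (forall x, 0 <= U x) -> (forall x, 0 <= V x) ->
  (0 < th < 1)%R ->
  mixed_int e (fun x => U x `^ (1 - th) * V x `^ th) r <=
  mixed_int e U r `^ (1 - th) * mixed_int e V r `^ th.
Proof.
move=> e0 mU mV U0 V0 th01.
have mp W : measurable_fun setT W -> (forall x, 0 <= W x) ->
    measurable_fun setT (fun y => local_int W y r `^ e).
  move=> mW W0; apply: (measurableT_comp (measurable_poweR e)).
  exact: measurable_local_int.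
apply: (le_trans _ (ge0_integral_hoelder mu (mp _ mU U0) (mp _ mV V0)
  (fun=> poweR_ge0 _ _) (fun=> poweR_ge0 _ _) th01)).
apply: le_ge0_integral => y _; first exact: poweR_ge0.
apply: (@le_trans _ _ ((local_int U y r `^ (1 - th) * local_int V y r `^ th) `^ e)).
  apply: le_poweR; [exact: ltW| |exact: local_int_hoelder].
  by apply: local_int_ge0 => x; rewrite mule_ge0// poweR_ge0.
rewrite poweRM ?poweR_ge0// -!poweRrM.
by rewrite [((1 - th) * e)%R]mulrC [(th * e)%R]mulrC.
Qed.

End local_integrals.

Section morrey.
Context {R : realType} {d : nat}.
Local Notation T := (lebesgueSpace R d).
Local Notation mu := (leb R d).
Variables (q p : R) (phi : R -> R) (E : R).
Hypotheses (q1 : 1 < q) (qp : q <= p) (phi_gt0 : forall t, 0 < t -> 0 < phi t).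
Hypotheses (E0 : 0 < E)
  (phi_le : forall r s, 0 < r -> r <= s -> phi s <= E * phi r).

Let q0 : 0 < q. Proof. exact: lt_trans q1. Qed.
Let p0 : 0 < p. Proof. exact: lt_le_trans qp. Qed.
Let e := p / q.
Let e0 : 0 < e. Proof. exact: divr_gt0. Qed.

(* In terms of the p-th power of the amalgam norm, this is the condition that
   the generalized Fofana norm of G is at most F. *)
Definition fofana_le (F : R) (G : T -> R) := forall r, 0 < r ->
  (mixed_int e (fun x => (G x `^ q)%:E) r <=
   (F `^ p * (phi r `^ p * r ^+ d) * (r ^+ d) `^ e)%:E)%E.

(** The factors come from phi(2r) <= E phi(r), from the two powers of (2r)^d in [fofana_le], and
    from the lower bound for the measure of a ball; the root undoes the exponent e. *)
Definition morrey_cst : R :=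
  (E `^ p * 2 ^+ d * (2 ^+ d) `^ e / (2 / d.+1%:R) ^+ d) `^ e^-1.

Lemma morrey_cst_gt0 : 0 < morrey_cst.
Proof.
by rewrite powR_gt0// divr_gt0 ?mulr_gt0 ?powR_gt0 ?exprn_gt0 ?divr_gt0.
Qed.

Variables (G : T -> R) (F : R).
Hypotheses (mG : measurable_fun setT G) (G0 : forall x, 0 <= G x) (F0 : 0 < F).
Hypothesis GF : fofana_le F G.

Let Gq x : \bar R := (G x `^ q)%:E.
Let Gq0 x : (0 <= Gq x)%E. Proof. by rewrite lee_fin powR_ge0. Qed.
Let mGq : measurable_fun setT Gq.
Proof. by apply/measurable_EFinP; exact: (measurableT_comp (measurable_powR q)). Qed.

(** A bound integrated over all centers becomes a bound at a single one: for z in B(y,r) the ball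
    B(z,2r) contains B(y,r), so the mixed integral at radius 2r is at least X^e times the measure of
    B(y,r). *)
Lemma morrey_local_int y r : 0 < r ->
  (local_int Gq y r <= (morrey_cst * (F * phi r) `^ q * r ^+ d)%:E)%E.
Proof.
move=> r0; set X := local_int Gq y r.
have X0 : (0 <= X)%E by exact: local_int_ge0.
have rd : 0 < r ^+ d by rewrite exprn_gt0.
pose c := (2 / d.+1%:R) ^+ d : R.
have c0 : 0 < c by rewrite exprn_gt0// divr_gt0.
have H1 : (X `^ e * (c * r ^+ d)%:E <= mixed_int e Gq (2 * r))%E.
  apply: (@le_trans _ _ (X `^ e * mu (eball y r))%E).
    by rewrite lee_wpmul2l ?poweR_ge0//; exact: leb_eball_ge.
  apply: (@le_trans _ _ (\int[mu]_z (X `^ e * (\1_(eball y r) z)%:E))%E).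
    rewrite (ge0_integralZl mu measurableT (measurable_indic_ballE y r) _
      (poweR_ge0 _ _)); last by move=> z _; rewrite lee_fin.
    by rewrite integral_indic ?setIT//; exact: measurable_eball.
  apply: le_ge0_integral => z _; first by rewrite mule_ge0 ?poweR_ge0 ?lee_fin.
  rewrite indicE mem_eball.
  have [zy|_] := boolP (enorm (z - y) < r); last by rewrite mule0 poweR_ge0.
  rewrite mule1; apply: le_poweR => //; first exact: ltW.
  apply: le_local_int_ball => //; apply: eball_sub.
  by rewrite enormB; lra.
have r20 : 0 < 2 * r by rewrite mulr_gt0.
have H2 := le_trans H1 (GF r20).
have phi0 := phi_gt0 r0.
have H3 : (X `^ e <= (E `^ p * 2 ^+ d * (2 ^+ d) `^ e / c *
    ((F * phi r) `^ p * (r ^+ d) `^ e))%:E)%E.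
  rewrite -(@lee_pmul2r _ (c * r ^+ d)%:E) ?lte_fin ?mulr_gt0//.
  apply: (le_trans H2); rewrite -EFinM lee_fin.
  have phi2 : phi (2 * r) `^ p <= E `^ p * phi r `^ p.
    rewrite -powRM ?(ltW E0) ?(ltW phi0)//; apply: le_powR.
    - exact: ltW.
    - by rewrite ltW// phi_gt0.
    - by apply: phi_le => //; lra.
  rewrite exprMn (powRM _ (exprn_ge0 _ _) (ltW rd))//.
  rewrite (powRM _ (ltW F0) (ltW phi0)).
  apply: (@le_trans _ _ (F `^ p * ((E `^ p * phi r `^ p) * (2 ^+ d * r ^+ d)) *
      ((2 ^+ d) `^ e * (r ^+ d) `^ e))).
    rewrite ler_wpM2r ?mulr_ge0 ?powR_ge0// ler_wpM2l ?powR_ge0//.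
    by rewrite ler_wpM2r// mulr_ge0 ?exprn_ge0// ltW.
  by rewrite le_eqVlt; apply/orP; left; apply/eqP; field; rewrite gt_eqF.
have -> : X = ((X `^ e) `^ e^-1)%E by rewrite -poweRrM mulfV ?gt_eqF// poweRe1.
apply: (le_trans (le_poweR _ (poweR_ge0 _ _) H3)); first by rewrite invr_ge0 ltW.
rewrite poweR_EFin lee_fin powRM; last 2 first.
- by rewrite divr_ge0 ?mulr_ge0 ?powR_ge0// ltW.
- by rewrite mulr_ge0 ?powR_ge0.
rewrite -[leRHS]mulrA ler_wpM2l ?(ltW morrey_cst_gt0)//.
rewrite powRM ?powR_ge0// -!powRrM mulfV ?gt_eqF// powRr1 ?(ltW rd)//.
by rewrite (_ : p * e^-1 = q)// /e invf_div mulrCA divff ?mulr1// gt_eqF.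
Qed.

Definition morrey_avg_cst : R := ((2 ^+ d) `^ (q - 1) * morrey_cst) `^ q^-1.

Lemma morrey_avg_cst_gt0 : 0 < morrey_avg_cst.
Proof.
apply: powR_gt0; apply: mulr_gt0; last exact: morrey_cst_gt0.
by apply: powR_gt0; rewrite exprn_gt0.
Qed.

Lemma ball_integral_poweR_le y r : 0 < r ->
  (ball_integral G y r `^ q <=
   ((2 ^+ d * r ^+ d) `^ (q - 1))%:E * local_int Gq y r)%E.
Proof.
move=> r0.
have := @poweR_integral_indic_le R _ T mu (eball y r) (EFin \o G) q
  (measurable_eball y r) (iffRL (measurable_EFinP _ _) mG) _ q1.
move=> /(_ (fun x => ltac:(by rewrite /= lee_fin))) H.
rewrite ball_integralE; apply: (le_trans H).
apply: lee_wpmul2r; first exact: local_int_ge0.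
rewrite -poweR_EFin; apply: le_poweR => //; first by rewrite subr_ge0 ltW.
by apply: leb_eball_le; exact: ltW.
Qed.

Lemma morrey_average y r : 0 < r ->
  (ball_integral G y r <= (morrey_avg_cst * (F * phi r) * r ^+ d)%:E)%E.
Proof.
move=> r0; have phi0 := phi_gt0 r0.
have rd : 0 < r ^+ d by rewrite exprn_gt0.
have B0 : (0 <= ball_integral G y r)%E by exact: ball_integral_ge0.
have Fp : 0 < F * phi r by rewrite mulr_gt0.
have H : (ball_integral G y r `^ q <= ((2 ^+ d) `^ (q - 1) * morrey_cst *
    ((F * phi r) `^ q * (r ^+ d) `^ q))%:E)%E.
  apply: (le_trans (ball_integral_poweR_le y r0)).
  apply: (le_trans (lee_wpmul2l _ (morrey_local_int y r0))).
    by rewrite lee_fin powR_ge0.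
  rewrite -EFinM lee_fin (powRM _ (exprn_ge0 _ _) (ltW rd))//.
  rewrite -(mulr_powRB1 (ltW rd) q0) le_eqVlt; apply/orP; left; apply/eqP; ring.
have -> : ball_integral G y r = ((ball_integral G y r `^ q) `^ q^-1)%E.
  by rewrite -poweRrM mulfV ?gt_eqF// poweRe1.
apply: (le_trans (le_poweR _ (poweR_ge0 _ _) H)); first by rewrite invr_ge0 ltW.
rewrite poweR_EFin lee_fin powRM; last 2 first.
- by rewrite mulr_ge0 ?powR_ge0// ltW// morrey_cst_gt0.
- by rewrite mulr_ge0 ?powR_ge0.
rewrite -[leRHS]mulrA ler_wpM2l ?(ltW morrey_avg_cst_gt0)//.
by rewrite powRM ?powR_ge0// -!powRrM mulfV ?gt_eqF// !powRr1// ltW.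
Qed.

End morrey.

Lemma dyadic_bracket (R : realType) (r t : R) : 0 < r -> r < t ->
  exists i, r * 2 ^+ i < t <= r * 2 ^+ i.+1.
Proof.
move=> r0 rt.
have ex : exists k, t <= r * 2 ^+ k.
  exists (Num.bound (t / r)); rewrite mulrC -ler_pdivrMr//.
  have tr : 0 <= t / r by rewrite divr_ge0 ?ltW// (lt_trans r0 rt).
  by rewrite (le_trans (ltW (archi_boundP tr)))// -natrX ler_nat ltnW// ltn_expl.
case: (ex_minnP ex) => -[|i] ti imin.
  by move: ti; rewrite expr0 mulr1 leNgt rt.
exists i; rewrite ti andbT ltNge; apply/negP => /imin.
by rewrite ltnn.
Qed.

(** * The maximal function on Fofana spaces *)

Section maxfun_fofana.
Context {R : realType} {d : nat}.
Local Notation T := (lebesgueSpace R d).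
Local Notation mu := (leb R d).
Variables (q p : R) (phi : R -> R) (E S : R).
Hypotheses (q1 : 1 < q) (qp : q <= p) (phi_gt0 : forall t, 0 < t -> 0 < phi t).
Hypotheses (E0 : 0 < E)
  (phi_le : forall r s, 0 < r -> r <= s -> phi s <= E * phi r).
Hypotheses (S0 : 0 < S)
  (phi_sum : forall r n, 0 < r ->
    \sum_(i < n) (phi (r * 2 ^+ i) `^ p * (r * 2 ^+ i) ^+ d)
    <= S * (phi r `^ p * r ^+ d)).

Let q0 : 0 < q. Proof. exact: lt_trans q1. Qed.
Let p0 : 0 < p. Proof. exact: lt_le_trans qp. Qed.
Let e := p / q.
Let e0 : 0 < e. Proof. exact: divr_gt0. Qed.

Variables (G : T -> R) (F : R).
Hypotheses (mG : measurable_fun setT G) (G0 : forall x, 0 <= G x) (F0 : 0 < F).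
Hypothesis GF : fofana_le q p phi F G.

Let Gq x : \bar R := (G x `^ q)%:E.
Let Gq0 x : (0 <= Gq x)%E. Proof. by rewrite lee_fin powR_ge0. Qed.
Let mGq : measurable_fun setT Gq.
Proof. by apply/measurable_EFinP; exact: (measurableT_comp (measurable_powR q)). Qed.

(** Up to a constant, the mean of G^q over B(y,4u) with u = 2^i r. This ball contains B(x,t)
    whenever x is in B(y,r) and u < t <= 2u. *)
Definition scaled_local r y i : \bar R :=
  (((r * 2 ^+ i) ^+ d)^-1%:E * local_int Gq y (r * 2 ^+ i.+2))%E.

(** A large radius falls into one dyadic range, so a supremum over i is enough; its e-th power is at
    most the sum of the e-th powers, which can be integrated term by term. *)
Definition tail_sup r y : \bar R := ereal_sup (range (scaled_local r y)).

Let scaled_local_ge0 r y i : 0 < r -> (0 <= scaled_local r y i)%E.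
Proof.
move=> r0; rewrite mule_ge0 ?local_int_ge0// lee_fin invr_ge0 exprn_ge0//.
by rewrite mulr_ge0 ?exprn_ge0// ltW.
Qed.

Let le_tail_sup r y i : (scaled_local r y i <= tail_sup r y)%E.
Proof. by apply: ereal_sup_ubound; exists i. Qed.

Let tail_sup_ge0 r y : 0 < r -> (0 <= tail_sup r y)%E.
Proof. by move=> r0; apply: le_trans (le_tail_sup r y 0); exact: scaled_local_ge0. Qed.

Let cutoff r y (z : T) : R := G z * \1_(eball y (r * 2 ^+ 2)) z.

Let cutoff_ge0 r y z : 0 <= cutoff r y z. Proof. by rewrite mulr_ge0. Qed.

Let mcutoff r y : measurable_fun setT (cutoff r y).
Proof. exact: measurable_ball_integrand. Qed.

(** For t <= 2r the ball B(x,t) lies in B(y,4r), so only the cutoff is seen; the factor 2^d passes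
    from dyadic radii to t. For t > 2r the ball lies in some B(y,4u) with u < t <= 2u, and Jensen's
    inequality leads to a term of [tail_sup]. *)
Lemma maxfun_localization r y x : 0 < r -> enorm (x - y) < r ->
  (maxfun G x `^ q <= ((2 ^+ d) `^ q)%:E * maxfun (cutoff r y) x `^ q +
    ((8 ^+ d) `^ (q - 1))%:E * tail_sup r y)%E.
Proof.
move=> r0 xy.
set a := (((2 ^+ d) `^ q)%:E * _ `^ q)%E.
set b := (_ * tail_sup r y)%E.
have a0 : (0 <= a)%E by rewrite mule_ge0 ?poweR_ge0// lee_fin powR_ge0.
have b0 : (0 <= b)%E by rewrite mule_ge0 ?tail_sup_ge0// lee_fin powR_ge0.
have root (z : \bar R) : (0 <= z)%E -> ((z `^ q^-1) `^ q = z)%E.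
  by move=> z0; rewrite -poweRrM mulVf ?gt_eqF// poweRe1.
have root' (z : \bar R) : (0 <= z)%E -> ((z `^ q) `^ q^-1 = z)%E.
  by move=> z0; rewrite -poweRrM mulfV ?gt_eqF// poweRe1.
have qV0 : 0 <= q^-1 by rewrite invr_ge0 ltW.
rewrite -[leRHS]root ?adde_ge0//; apply: le_poweR; [exact: ltW|exact: maxfun_ge0|].
apply: maxfun_le; first exact: poweR_ge0.
move=> t t0; have td0 : 0 < t ^+ d by rewrite exprn_gt0.
have [t2|t2] := leP t (2 * r).
  apply: (@le_trans _ _ (a `^ q^-1)%E); last first.
    by apply: le_poweR => //; rewrite leeDl.
  rewrite poweRM ?poweR_ge0 ?lee_fin ?powR_ge0// root' ?maxfun_ge0//.
  rewrite poweR_EFin -powRrM mulfV ?gt_eqF// powRr1 ?exprn_ge0//.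
  rewrite lee_pdivrMl// muleA -EFinM [t ^+ d * _]mulrC.
  apply: le_trans (ball_integral_le_maxfun _ _ _ t0) => //.
  rewrite le_eqVlt; apply/orP; left; apply/eqP; apply: eq_integral => z _.
  congr EFin; rewrite /cutoff -mulrA; congr (_ * _).
  rewrite !indicE !mem_eball; have [zx|_] := boolP (enorm (z - x) < t); last by rewrite mulr0.
  rewrite (_ : enorm (z - y) < r * 2 ^+ 2 = true) ?mulr1//.
  apply: (le_lt_trans (ler_enormBD x z y)); rewrite -natrX; lra.
apply: (@le_trans _ _ (b `^ q^-1)%E); last first.
  by apply: le_poweR => //; rewrite leeDr.
have rt : r < t by lra.
have [i /andP[it ti]] := dyadic_bracket r0 rt.
set u := r * 2 ^+ i in it.
have u0 : 0 < u by rewrite mulr_gt0 ?exprn_gt0.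
have ru : r <= u by rewrite ler_peMr ?(ltW r0)// exprn_ege1// ler1n.
have t2u : t <= 2 * u by move: ti; rewrite /u exprS mulrCA.
have u4 : r * 2 ^+ i.+2 = 4 * u by rewrite /u !exprS; ring.
set v := r * 2 ^+ i.+2 in u4.
have v0 : 0 < v by rewrite u4 mulr_gt0.
have B0 : (0 <= ball_integral G y v)%E by exact: ball_integral_ge0.
apply: (@le_trans _ _ ((u ^+ d)^-1%:E * ball_integral G y v)%E).
  apply: lee_pmul; rewrite ?ball_integral_ge0 ?lee_fin ?invr_ge0 ?(ltW td0)//.
    rewrite lef_pV2 ?posrE ?exprn_gt0// lerXn2r ?nnegrE ?(ltW u0) ?(ltW t0)//.
    exact: ltW.
  by apply: le_ball_integral => //; apply: eball_sub; rewrite u4; lra.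
have ud : 0 < u ^+ d by rewrite exprn_gt0.
have uV0 : 0 <= (u ^+ d)^-1 by rewrite invr_ge0 ltW.
rewrite -[leLHS]root' ?mule_ge0// ?lee_fin//.
apply: le_poweR => //; first exact: poweR_ge0.
rewrite poweRM ?lee_fin// poweR_EFin.
apply: (le_trans (lee_wpmul2l _ (ball_integral_poweR_le q1 mG G0 y v0))).
  by rewrite lee_fin powR_ge0.
rewrite /b muleA -EFinM.
apply: (le_trans _ (lee_wpmul2l _ (le_tail_sup r y i))); last first.
  by rewrite lee_fin powR_ge0.
rewrite /scaled_local -/u -/v muleA -EFinM; apply: lee_wpmul2r.
  exact: local_int_ge0.
rewrite lee_fin (_ : 2 ^+ d * v ^+ d = 8 ^+ d * u ^+ d); last first.
  by rewrite u4 -!exprMn; congr (_ ^+ d); ring.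
rewrite (powRM _ (exprn_ge0 _ _) (ltW ud))// mulrCA ler_wpM2l ?powR_ge0//.
rewrite -powR_inv1 ?(ltW ud)// -powRrM -powRD; last by rewrite (gt_eqF ud) implybT.
by rewrite (_ : -1 * q + (q - 1) = -1)//; ring.
Qed.

Definition maxfun_local_cst : R :=
  (2 ^+ d) `^ q * @maxfun_cst R d q + (8 ^+ d) `^ (q - 1) * 2 ^+ d.

Lemma maxfun_local_cst_gt0 : 0 < maxfun_local_cst.
Proof.
have P n (a : R) : 0 < (n.+1%:R ^+ d) `^ a by apply: powR_gt0; rewrite exprn_gt0.
apply: addr_gt0; apply: mulr_gt0; [exact: P| |exact: P|by rewrite exprn_gt0].
exact: maxfun_cst_gt0.
Qed.

Lemma local_int_maxfun_le r y : 0 < r ->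
  (local_int (fun x => maxfun G x `^ q) y r <=
   (maxfun_local_cst * r ^+ d)%:E * tail_sup r y)%E.
Proof.
move=> r0; have rd : 0 < r ^+ d by rewrite exprn_gt0.
set U := tail_sup r y; have U0 : (0 <= U)%E by exact: tail_sup_ge0.
pose c1 : R := (2 ^+ d) `^ q; pose c2 : R := (8 ^+ d) `^ (q - 1).
have c10 : 0 <= c1 by exact: powR_ge0.
have c20 : 0 <= c2 by exact: powR_ge0.
pose Mc x := (maxfun (cutoff r y) x `^ q)%E.
have mMc : measurable_fun setT Mc.
  apply: (measurableT_comp (measurable_poweR q)).
  exact: measurable_maxfun (mcutoff r y) (cutoff_ge0 r y).
have Mc0 x : (0 <= Mc x)%E by exact: poweR_ge0.
apply: (@le_trans _ _ (\int[mu]_x (c1%:E * Mc x +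
    (c2%:E * U) * (\1_(eball y r) x)%:E))%E).
  apply: le_ge0_integral => x _; first by rewrite mule_ge0 ?poweR_ge0// lee_fin.
  rewrite indicE mem_eball.
  have [xy|_] := boolP (enorm (x - y) < r); last first.
    by rewrite !mule0 adde0 mule_ge0// lee_fin.
  by rewrite !mule1; exact: maxfun_localization.
have m1 : measurable_fun setT (fun x => c1%:E * Mc x)%E by exact: measurable_funeM.
have m2 : measurable_fun setT (fun x : T => (c2%:E * U) * (\1_(eball y r) x)%:E)%E.
  exact: (measurable_local_integrand y r (measurable_cst _)).
rewrite (ge0_integralD _ measurableT _ m1 _ m2); last 2 first.
- by move=> x _; rewrite mule_ge0// lee_fin.
- by move=> x _; rewrite mule_ge0 ?lee_fin// mule_ge0// lee_fin.
rewrite (ge0_integralZl _ measurableT mMc) ?lee_fin//.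
rewrite (ge0_integralZl _ measurableT (measurable_indic_ballE y r)); last 2 first.
- by move=> x _; rewrite lee_fin.
- by rewrite mule_ge0// lee_fin.
rewrite integral_indic ?setIT//; last exact: measurable_eball.
have cutq : (\int[mu]_x (cutoff r y x `^ q)%:E <= (r ^+ d)%:E * U)%E.
  apply: (@le_trans _ _ (local_int Gq y (r * 2 ^+ 2))).
    rewrite le_eqVlt; apply/orP; left; apply/eqP; apply: eq_integral => x _.
    rewrite /cutoff indicE; case: (x \in _) => /=; first by rewrite mulr1 mule1.
    by rewrite mulr0 mule0 powR0// gt_eqF.
  (* The cutoff radius 4r is the radius of the term i = 0, so [tail_sup] controls the integral of
     the q-th power of the cutoff as well. *)
  have := le_tail_sup r y 0; rewrite /scaled_local expr0 mulr1 -/U.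
  by rewrite lee_pdivrMl.
have strong := maxfun_strong_type (mcutoff r y) (cutoff_ge0 r y) q1.
have cc : 0 < @maxfun_cst R d q by exact: maxfun_cst_gt0.
apply: (@le_trans _ _ (c1%:E * ((@maxfun_cst R d q)%:E * ((r ^+ d)%:E * U)) +
    c2%:E * U * (2 ^+ d * r ^+ d)%:E)%E).
  apply: leeD.
    rewrite lee_wpmul2l ?lee_fin//; apply: (le_trans strong).
    by rewrite lee_wpmul2l// lee_fin ltW.
  apply: lee_wpmul2l; first by rewrite mule_ge0// lee_fin.
  by apply: leb_eball_le; exact: ltW.
rewrite -[(c2%:E * U)%E]muleC -[(U * _ * _)%E]muleA -EFinM.
rewrite ![(_ * ((r ^+ d)%:E * U))%E]muleA !muleA -!EFinM [(U * _)%E]muleC.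
rewrite -ge0_muleDl ?lee_fin ?mulr_ge0 ?exprn_ge0 ?(ltW r0) ?(ltW cc)//.
rewrite -EFinD lee_wpmul2r// lee_fin le_eqVlt; apply/orP; left; apply/eqP.
  by rewrite /maxfun_local_cst -/c1 -/c2; ring.
exact: powR_ge0.
Qed.

(** By the Morrey estimate all terms of [tail_sup] stay below one constant, as phi(2^(i+2) r) <= E
    phi(r). This finiteness is what makes the integral of [Trho] converge almost everywhere. *)
Lemma local_int_maxfun_lty r y : 0 < r ->
  (local_int (fun x => maxfun G x `^ q) y r < +oo)%E.
Proof.
move=> r0; apply: (le_lt_trans (local_int_maxfun_le y r0)).
rewrite lte_mul_pinfty//.
  by rewrite lee_fin mulr_ge0 ?exprn_ge0// ltW// maxfun_local_cst_gt0.
pose B := 4 ^+ d * (@morrey_cst R d q p E * (F * (E * phi r)) `^ q).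
apply: (@le_lt_trans _ _ B%:E); last by rewrite ltry.
apply: ge_ereal_sup => _ [i _ <-]; rewrite /scaled_local.
have u0 : 0 < r * 2 ^+ i by rewrite mulr_gt0 ?exprn_gt0.
have v0 : 0 < r * 2 ^+ i.+2 by rewrite mulr_gt0 ?exprn_gt0.
rewrite lee_pdivrMl ?exprn_gt0//.
have H := morrey_local_int q1 qp phi_gt0 E0 phi_le F0 GF y v0.
apply: (le_trans H).
rewrite -EFinM lee_fin.
have vu : (r * 2 ^+ i.+2) ^+ d = 4 ^+ d * (r * 2 ^+ i) ^+ d.
  by rewrite -exprMn; congr (_ ^+ d); rewrite !exprS; ring.
have M0 := @morrey_cst_gt0 R d q p E E0.
apply: (@le_trans _ _ (@morrey_cst R d q p E * (F * (E * phi r)) `^ q *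
    (r * 2 ^+ i.+2) ^+ d)).
  rewrite ler_wpM2r ?exprn_ge0 ?(ltW v0)// ler_wpM2l ?(ltW M0)//.
  apply: le_powR; first exact: ltW.
    by rewrite mulr_ge0 ?(ltW F0) ?(ltW (phi_gt0 v0)).
  rewrite ler_wpM2l ?(ltW F0)//; apply: phi_le => //.
  by rewrite ler_peMr ?(ltW r0)// exprn_ege1// ler1n.
by rewrite vu /B le_eqVlt; apply/orP; left; apply/eqP; ring.
Qed.

Definition maxfun_fofana_cst : R :=
  maxfun_local_cst `^ e * (4 ^+ d * (4 ^+ d) `^ e * E `^ p * S).

Lemma maxfun_fofana_cst_gt0 : 0 < maxfun_fofana_cst.
Proof.
apply: mulr_gt0; first by apply: powR_gt0; exact: maxfun_local_cst_gt0.
by rewrite !mulr_gt0 ?powR_gt0 ?exprn_gt0.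
Qed.

Let integral_scaled_local_le r i : 0 < r ->
  (\int[mu]_y (scaled_local r y i `^ e) <=
   (4 ^+ d * (4 ^+ d) `^ e * E `^ p * F `^ p *
    (phi (r * 2 ^+ i) `^ p * (r * 2 ^+ i) ^+ d))%:E)%E.
Proof.
move=> r0; rewrite /scaled_local; set u := r * 2 ^+ i.
have u0 : 0 < u by rewrite mulr_gt0 ?exprn_gt0.
have vu : r * 2 ^+ i.+2 = 4 * u by rewrite /u !exprS; ring.
have v0 : 0 < r * 2 ^+ i.+2 by rewrite vu mulr_gt0.
have ud : 0 < u ^+ d by rewrite exprn_gt0.
have Ld0 y : (0 <= local_int Gq y (r * 2 ^+ i.+2))%E by exact: local_int_ge0.
under eq_integral do rewrite poweRM ?lee_fin ?invr_ge0 ?(ltW ud)// poweR_EFin.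
have mL : measurable_fun setT (fun y => local_int Gq y (r * 2 ^+ i.+2) `^ e)%E.
  apply: (measurableT_comp (measurable_poweR e)).
  exact: measurable_local_int.
rewrite (ge0_integralZl _ measurableT mL); last 2 first.
- by move=> y _; exact: poweR_ge0.
- by rewrite lee_fin powR_ge0.
apply: (le_trans (lee_wpmul2l _ (GF v0))); first by rewrite lee_fin powR_ge0.
have e4 : (4 * u) ^+ d = 4 ^+ d * u ^+ d by rewrite -exprMn.
rewrite -EFinM lee_fin vu e4 (powRM _ (exprn_ge0 _ _) (ltW ud))// -/e.
have phi4 : phi (4 * u) `^ p <= E `^ p * phi u `^ p.
  rewrite -powRM ?(ltW E0) ?(ltW (phi_gt0 u0))//; apply: le_powR.
  - exact: ltW.
  - by rewrite ltW// phi_gt0// mulr_gt0.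
  - by apply: phi_le => //; lra.
have ue : (u ^+ d)^-1 `^ e * (u ^+ d) `^ e = 1.
  by rewrite -powRM ?invr_ge0 ?(ltW ud)// mulVf ?gt_eqF// powR1.
apply: (@le_trans _ _ ((u ^+ d)^-1 `^ e * (F `^ p *
    (E `^ p * phi u `^ p * (4 ^+ d * u ^+ d)) * ((4 ^+ d) `^ e * (u ^+ d) `^ e)))).
  rewrite ler_wpM2l ?powR_ge0// ler_wpM2r ?mulr_ge0 ?powR_ge0//.
  by rewrite ler_wpM2l ?powR_ge0// ler_wpM2r// mulr_ge0 ?exprn_ge0// ltW.
rewrite [leLHS](_ : _ = ((u ^+ d)^-1 `^ e * (u ^+ d) `^ e) *
  (4 ^+ d * (4 ^+ d) `^ e * E `^ p * F `^ p * (phi u `^ p * u ^+ d))); last by ring.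
by rewrite ue mul1r.
Qed.

Let tail_sup_powR_le r y : 0 < r ->
  (tail_sup r y `^ e <= \sum_(i <oo) scaled_local r y i `^ e)%E.
Proof.
move=> r0; set Z := (\sum_(i <oo) _)%E.
have Z0 : (0 <= Z)%E by apply: nneseries_ge0 => n _ _; exact: poweR_ge0.
have -> : Z = ((Z `^ e^-1) `^ e)%E by rewrite -poweRrM mulVf ?gt_eqF// poweRe1.
apply: le_poweR; [exact: ltW|exact: tail_sup_ge0|].
apply: ge_ereal_sup => _ [i _ <-].
have -> : scaled_local r y i = ((scaled_local r y i `^ e) `^ e^-1)%E.
  by rewrite -poweRrM mulfV ?gt_eqF// poweRe1// scaled_local_ge0.
apply: le_poweR; [by rewrite invr_ge0 ltW|exact: poweR_ge0|].
apply: (@le_trans _ _ (\sum_(0 <= k < i.+1) scaled_local r y k `^ e)%E).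
  rewrite big_nat_recr//= leeDr// sume_ge0// => k _; exact: poweR_ge0.
by apply: nneseries_lim_ge => n _ _; exact: poweR_ge0.
Qed.

(** Integrating the e-th powers term by term leaves the sum of phi(2^i r)^p (2^i r)^d, which
    [phi_sum] compares with its first term. *)
Lemma mixed_maxfun_le r : 0 < r ->
  (mixed_int e (fun x => maxfun G x `^ q) r <=
   (maxfun_fofana_cst * (F `^ p * (phi r `^ p * r ^+ d) * (r ^+ d) `^ e))%:E)%E.
Proof.
move=> r0; have rd : 0 < r ^+ d by rewrite exprn_gt0.
have K0 := maxfun_local_cst_gt0.
have Kr : 0 < maxfun_local_cst * r ^+ d by rewrite mulr_gt0.
have msl i : measurable_fun setT (fun y => scaled_local r y i `^ e)%E.
  apply: (measurableT_comp (measurable_poweR e)); apply: measurable_funeM.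
  exact: measurable_local_int.
have msum : measurable_fun setT (fun y => \sum_(i <oo) scaled_local r y i `^ e)%E.
  by apply: ge0_emeasurable_sum => // i y _ _; exact: poweR_ge0.
have sum0 y : (0 <= \sum_(i <oo) scaled_local r y i `^ e)%E.
  by apply: nneseries_ge0 => n _ _; exact: poweR_ge0.
apply: (@le_trans _ _ (\int[mu]_y (((maxfun_local_cst * r ^+ d) `^ e)%:E *
    \sum_(i <oo) scaled_local r y i `^ e))%E).
  apply: le_ge0_integral => y _; first exact: poweR_ge0.
  apply: (@le_trans _ _ (((maxfun_local_cst * r ^+ d)%:E * tail_sup r y) `^ e)%E).
    apply: le_poweR; [exact: ltW| |exact: local_int_maxfun_le].
    by apply: local_int_ge0 => x; exact: poweR_ge0.
  rewrite poweRM ?tail_sup_ge0 ?lee_fin ?(ltW Kr)// poweR_EFin.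
  by rewrite lee_wpmul2l ?lee_fin ?powR_ge0// tail_sup_powR_le.
rewrite (ge0_integralZl _ measurableT msum) ?lee_fin ?powR_ge0//.
rewrite integral_nneseries//; last by move=> n y _; exact: poweR_ge0.
pose c3 := 4 ^+ d * (4 ^+ d) `^ e * E `^ p * F `^ p.
have c30 : 0 <= c3 by rewrite !mulr_ge0 ?powR_ge0 ?exprn_ge0.
apply: (@le_trans _ _ (((maxfun_local_cst * r ^+ d) `^ e)%:E *
    (c3 * (S * (phi r `^ p * r ^+ d)))%:E)%E).
  rewrite lee_wpmul2l ?lee_fin ?powR_ge0//.
  apply: lime_le.
    apply: is_cvg_nneseries => n _ _; apply: integral_ge0 => y _; exact: poweR_ge0.
  apply: nearW => n; rewrite big_mkord.
  apply: (@le_trans _ _ (\sum_(i < n) (c3 * (phi (r * 2 ^+ i) `^ p *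
      (r * 2 ^+ i) ^+ d))%:E)%E).
    by apply: lee_sum => i _; exact: integral_scaled_local_le.
  by rewrite sumEFin lee_fin -mulr_sumr ler_wpM2l// phi_sum.
rewrite -EFinM lee_fin (powRM _ (ltW K0) (ltW rd)) le_eqVlt.
by apply/orP; left; apply/eqP; rewrite /maxfun_fofana_cst /c3; ring.
Qed.

End maxfun_fofana.

(** * Hedberg's inequality *)

Section hedberg.
Context {R : realType} {d : nat}.
Local Notation T := (lebesgueSpace R d).
Local Notation mu := (leb R d).
Local Notation lambda := (@completed_lebesgue_measure R).
Variables (q p : R) (phi rho : R -> R) (th E D C1 C' : R).
Hypotheses (d0 : (0 < d)%N) (q1 : 1 < q) (qp : q <= p).
Hypotheses (phi_gt0 : forall t, 0 < t -> 0 < phi t)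
  (rho_gt0 : forall t, 0 < t -> 0 < rho t) (th01 : 0 < th < 1).
Hypotheses (E0 : 0 < E)
  (phi_le : forall r s, 0 < r -> r <= s -> phi s <= E * phi r).
Hypotheses (D0 : 0 < D) (phi_doubling : forall u t, 0 < u -> u <= t ->
  t <= 2 * u -> phi u <= D * phi t).
Hypotheses (C10 : 0 < C1) (rho_doubling : forall r t : R, 0 < r -> 0 < t ->
    2^-1 <= r / t <= 2 -> C1^-1 <= rho r / rho t <= C1).
Hypotheses (C'0 : 0 < C') (rho_near : forall r, 0 < r ->
    (\int[lambda]_(t in `]0%R, r[%classic) (rho t / t)%:E
      <= (C' * phi r `^ (th - 1))%:E)%E)
  (rho_far : forall r, 0 < r ->
    (\int[lambda]_(t in `]r, +oo[%classic) (rho t * phi t / t)%:E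
      <= (C' * phi r `^ th)%:E)%E).

(** At x = y nothing is known about [rho 0]; the kernel vanishes there because 0^d = 0 for d > 0 and
    the inverse of 0 is 0. *)
Lemma rho_kernel_ge0 (x y : 'rV[R]_d) : 0 <= rho_kernel rho x y.
Proof.
rewrite /rho_kernel; have := enorm_ge0 (x - y); rewrite le_eqVlt => /orP[/eqP <-|t0].
  by rewrite expr0n (gtn_eqF d0) invr0 mulr0.
by rewrite divr_ge0 ?exprn_ge0 ?enorm_ge0// ltW// rho_gt0.
Qed.

Variables (G : T -> R) (F : R).
Hypotheses (mG : measurable_fun setT G) (G0 : forall x, 0 <= G x) (F0 : 0 < F).
Hypothesis GF : fofana_le q p phi F G.

Definition potential (x : T) : \bar R :=
  (\int[mu]_y (rho_kernel rho x y * G y)%:E)%E.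

(** These constants bound the kernel on rings: [near_cst] on u/2 <= |x - y| < u with u = r / 2^i,
    and [far_cst] on u <= |x - y| <= 2u with u = 2^i r. *)
Let near_cst (r : R) i : R := C1 * 2 ^+ d * rho (r / 2 ^+ i) / (r / 2 ^+ i) ^+ d.
Let far_cst (r : R) i : R := C1 * rho (r * 2 ^+ i) / (r * 2 ^+ i) ^+ d.

Let near_fun r x i (y : T) : \bar R :=
  ((near_cst r i)%:E * (G y * \1_(eball x (r / 2 ^+ i)) y)%:E)%E.
(** The radius is 4u because the ring contains the points with |x - y| = 2u, which the open ball of
    radius 2u misses. *)
Let far_fun r x i (y : T) : \bar R :=
  ((far_cst r i)%:E * (G y * \1_(eball x (r * 2 ^+ i.+2)) y)%:E)%E.

Let near_pos (r : R) i : 0 < r -> 0 < r / 2 ^+ i.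
Proof. by move=> r0; rewrite divr_gt0 ?exprn_gt0. Qed.

Let far_pos (r : R) i : 0 < r -> 0 < r * 2 ^+ i.
Proof. by move=> r0; rewrite mulr_gt0 ?exprn_gt0. Qed.

Let near_cst_ge0 r i : 0 < r -> 0 <= near_cst r i.
Proof.
move=> r0; have u0 := near_pos i r0.
by rewrite divr_ge0 ?mulr_ge0 ?exprn_ge0 ?(ltW C10) ?(ltW u0)// ltW// rho_gt0.
Qed.

Let far_cst_ge0 r i : 0 < r -> 0 <= far_cst r i.
Proof.
move=> r0; have u0 := far_pos i r0.
by rewrite divr_ge0 ?mulr_ge0 ?exprn_ge0 ?(ltW C10) ?(ltW u0)// ltW// rho_gt0.
Qed.

Let near_fun_ge0 r x i y : 0 < r -> (0 <= near_fun r x i y)%E.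
Proof. by move=> r0; rewrite mule_ge0 ?lee_fin ?near_cst_ge0// mulr_ge0. Qed.

Let far_fun_ge0 r x i y : 0 < r -> (0 <= far_fun r x i y)%E.
Proof. by move=> r0; rewrite mule_ge0 ?lee_fin ?far_cst_ge0// mulr_ge0. Qed.

Let term_le_series (u : nat -> \bar R) i : (forall k, 0 <= u k)%E ->
  (u i <= \sum_(k <oo) u k)%E.
Proof.
move=> u0; apply: (@le_trans _ _ (\sum_(0 <= k < i.+1) u k)%E).
  by rewrite big_nat_recr//= leeDr// sume_ge0.
exact: nneseries_lim_ge.
Qed.

(** The point y lies in some ring, whose term alone bounds the integrand; all other terms are
    nonnegative. *)
Lemma rho_kernel_le r (x y : T) : 0 < r -> ((rho_kernel rho x y * G y)%:E <=
  (\sum_(i <oo) near_fun r x i y) + (\sum_(i <oo) far_fun r x i y))%E.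
Proof.
move=> r0.
have N0 : (0 <= \sum_(i <oo) near_fun r x i y)%E.
  by apply: nneseries_ge0 => i _ _; exact: near_fun_ge0.
have Fa0 : (0 <= \sum_(i <oo) far_fun r x i y)%E.
  by apply: nneseries_ge0 => i _ _; exact: far_fun_ge0.
rewrite /rho_kernel; set t := enorm (x - y).
have yx : enorm (y - x) = t by rewrite enormB.
have := enorm_ge0 (x - y); rewrite -/t le_eqVlt => /orP[/eqP <-|t0].
  by rewrite expr0n (gtn_eqF d0) invr0 mulr0 mul0r adde_ge0.
have far i : r * 2 ^+ i <= t <= 2 * (r * 2 ^+ i) ->
    ((rho t / t ^+ d * G y)%:E <= \sum_(i <oo) far_fun r x i y)%E.
  set u := r * 2 ^+ i => /andP[ut tu]; have u0 : 0 < u by exact: far_pos.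
  apply: le_trans (term_le_series i (fun k => far_fun_ge0 x k y r0)).
  rewrite /far_fun indicE mem_eball yx (_ : t < _ = true); last first.
    by rewrite (le_lt_trans tu)//; move: u0; rewrite /u !exprS; lra.
  rewrite mulr1 -EFinM lee_fin ler_wpM2r// /far_cst -/u.
  apply: ler_pM; rewrite ?invr_ge0 ?exprn_ge0 ?(ltW t0) ?(ltW (rho_gt0 t0))//.
    apply: (rho_le rho_gt0 rho_doubling) => //.
    by rewrite ler_pdivlMr// ler_pdivrMr//; apply/andP; split; lra.
  by rewrite lef_pV2 ?posrE ?exprn_gt0// lerXn2r ?nnegrE ?(ltW u0) ?(ltW t0).
have [tr|rt|tr] := ltgtP t r; last first.
- apply: (le_trans (far 0%N _)); last by rewrite leeDr.
  by rewrite expr0 mulr1 tr lexx/=; lra.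
- have [i /andP[it ti]] := dyadic_bracket r0 rt.
  apply: (le_trans (far i _)); last by rewrite leeDr.
  by rewrite (ltW it)/= (le_trans ti)// exprS mulrCA.
have [i /andP[it ti]] := dyadic_bracket t0 tr.
rewrite -ltr_pdivlMr ?exprn_gt0// in it.
set u := r / 2 ^+ i in it; have u0 : 0 < u by exact: near_pos.
have ut : u <= 2 * t.
  by rewrite /u ler_pdivrMr ?exprn_gt0//; move: ti; rewrite exprS mulrCA mulrA.
apply: (@le_trans _ _ (\sum_(i <oo) near_fun r x i y)%E); last by rewrite leeDl.
apply: le_trans (term_le_series i (fun k => near_fun_ge0 x k y r0)).
rewrite /near_fun indicE mem_eball yx -/u it mulr1 -EFinM lee_fin ler_wpM2r//.
rewrite /near_cst -/u [leRHS](_ : _ = (C1 * rho u) * ((u / 2) ^+ d)^-1).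
  apply: ler_pM; rewrite ?invr_ge0 ?exprn_ge0 ?(ltW t0) ?(ltW (rho_gt0 t0))//.
    apply: (rho_le rho_gt0 rho_doubling) => //.
    by rewrite ler_pdivlMr// ler_pdivrMr//; apply/andP; split; lra.
  rewrite lef_pV2 ?posrE ?exprn_gt0 ?divr_gt0// lerXn2r ?nnegrE ?(ltW t0)//.
    by rewrite divr_ge0// ltW.
  by rewrite ler_pdivrMr// mulrC.
by rewrite (expr_div_n u 2) invfM invrK; ring.
Qed.

(** In [near_tot] one factor 2^d of 4^d comes from [near_cst] and the other from
    [ball_integral_le_maxfun]; in [far_tot] the 4^d is the ratio of (4u)^d to u^d. *)
Let near_tot : R := C1 * 4 ^+ d * (2 * C1 * C').
Let far_tot : R :=
  C1 * 4 ^+ d * E * @morrey_avg_cst R d q p E * (2 * C1 * D * C').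

Let near_tot_gt0 : 0 < near_tot.
Proof. by rewrite /near_tot !mulr_gt0 ?exprn_gt0. Qed.

Let far_tot_gt0 : 0 < far_tot.
Proof.
by rewrite /far_tot !mulr_gt0 ?exprn_gt0//; exact: morrey_avg_cst_gt0.
Qed.

Let measurable_ball_term (x : T) t (c : R) :
  measurable_fun setT (fun y => c%:E * (G y * \1_(eball x t) y)%:E)%E.
Proof.
by apply: measurable_funeM; apply/measurable_EFinP; exact: measurable_ball_integrand.
Qed.

Let integral_ball_term (x : T) t (c : R) : 0 <= c ->
  (\int[mu]_y (c%:E * (G y * \1_(eball x t) y)%:E) = c%:E * ball_integral G x t)%E.
Proof.
move=> c0.
have m : measurable_fun setT (fun y : T => (G y * \1_(eball x t) y)%:E).
  by apply/measurable_EFinP; exact: measurable_ball_integrand.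
have g0 y : setT y -> (0 <= (G y * \1_(eball x t) y)%:E)%E.
  by move=> _; rewrite lee_fin mulr_ge0.
exact: (ge0_integralZl_EFin mu measurableT g0 m c0).
Qed.

Let near_sum_le r x : 0 < r -> (\sum_(i <oo) (\int[mu]_y near_fun r x i y) <=
  (near_tot * phi r `^ (th - 1))%:E * maxfun G x)%E.
Proof.
move=> r0; apply: lime_le.
  apply: is_cvg_nneseries => n _ _; apply: integral_ge0 => y _; exact: near_fun_ge0.
apply: nearW => n; rewrite big_mkord.
apply: (@le_trans _ _ (\sum_(i < n) ((C1 * 4 ^+ d * rho (r / 2 ^+ i))%:E * maxfun G x))%E).
  apply: lee_sum => i _; rewrite integral_ball_term ?near_cst_ge0//.
  have u0 := near_pos i r0.
  apply: (le_trans (lee_wpmul2l _ (ball_integral_le_maxfun x mG G0 u0))).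
    by rewrite lee_fin near_cst_ge0.
  rewrite muleA -EFinM lee_wpmul2r ?maxfun_ge0// lee_fin /near_cst.
  have ud : (r / 2 ^+ i) ^+ d != 0 by rewrite expf_neq0// gt_eqF.
  have e4 : (4 : R) ^+ d = 2 ^+ d * 2 ^+ d by rewrite -exprMn; congr (_ ^+ d); ring.
  rewrite e4 le_eqVlt; apply/orP; left; apply/eqP.
  move: ud; set v := (r / 2 ^+ i) ^+ d => ud.
  by field.
rewrite -ge0_sume_distrl; last first.
  by move=> i _; rewrite lee_fin !mulr_ge0 ?exprn_ge0 ?(ltW C10) ?(ltW (rho_gt0 (near_pos i r0))).
rewrite lee_wpmul2r ?maxfun_ge0// sumEFin lee_fin -mulr_sumr /near_tot -mulrA.
rewrite ler_wpM2l ?mulr_ge0 ?exprn_ge0 ?(ltW C10)//.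
by apply: rho_sum_near => //; exact: rho_near.
Qed.

Let far_sum_le r x : 0 < r -> (\sum_(i <oo) (\int[mu]_y far_fun r x i y) <=
  (far_tot * phi r `^ th * F)%:E)%E.
Proof.
move=> r0; apply: lime_le.
  apply: is_cvg_nneseries => n _ _; apply: integral_ge0 => y _; exact: far_fun_ge0.
apply: nearW => n; rewrite big_mkord.
have A0 := @morrey_avg_cst_gt0 R d q p E E0.
apply: (@le_trans _ _ (\sum_(i < n) (C1 * 4 ^+ d * E * @morrey_avg_cst R d q p E * F *
    (rho (r * 2 ^+ i) * phi (r * 2 ^+ i)))%:E)%E).
  apply: lee_sum => i _; rewrite integral_ball_term ?far_cst_ge0//.
  have u0 := far_pos i r0; have v0 := far_pos i.+2 r0.
  have H := morrey_average q1 qp phi_gt0 E0 phi_le mG G0 F0 GF x v0.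
  apply: (le_trans (lee_wpmul2l _ H)).
    by rewrite lee_fin far_cst_ge0.
  rewrite -EFinM lee_fin /far_cst; set A := morrey_avg_cst q p E.
  have vu : (r * 2 ^+ i.+2) ^+ d = 4 ^+ d * (r * 2 ^+ i) ^+ d.
    by rewrite -exprMn; congr (_ ^+ d); rewrite !exprS; ring.
  have phi4 : phi (r * 2 ^+ i.+2) <= E * phi (r * 2 ^+ i).
    apply: phi_le => //; rewrite ler_wpM2l ?(ltW r0)// ler_eXn2l ?ltr1n//.
    by rewrite !leqW.
  have ud : (r * 2 ^+ i) ^+ d != 0 by rewrite expf_neq0// gt_eqF.
  have ru := rho_gt0 u0.
  apply: (@le_trans _ _ (C1 * rho (r * 2 ^+ i) / (r * 2 ^+ i) ^+ d *
    (A * (F * (E * phi (r * 2 ^+ i))) * (4 ^+ d * (r * 2 ^+ i) ^+ d)))).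
    rewrite vu ler_wpM2l ?far_cst_ge0// ler_wpM2r ?mulr_ge0 ?exprn_ge0 ?(ltW u0)//.
    by rewrite ler_wpM2l ?(ltW A0)// ler_wpM2l// ltW.
  rewrite le_eqVlt; apply/orP; left; apply/eqP.
  by move: ud; set v := (r * 2 ^+ i) ^+ d => ud; field.
rewrite sumEFin lee_fin -mulr_sumr.
rewrite [leRHS](_ : _ = C1 * 4 ^+ d * E * @morrey_avg_cst R d q p E * F *
  (2 * C1 * D * C' * phi r `^ th)); last by rewrite /far_tot; ring.
rewrite ler_wpM2l ?mulr_ge0 ?exprn_ge0 ?(ltW C10) ?(ltW E0) ?(ltW F0) ?(ltW A0)//.
by apply: rho_sum_far => //; exact: rho_far.
Qed.

Lemma potential_split_le r x : 0 < r -> (potential x <=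
  (near_tot * phi r `^ (th - 1))%:E * maxfun G x + (far_tot * phi r `^ th * F)%:E)%E.
Proof.
move=> r0.
have mn i : measurable_fun setT (near_fun r x i) by exact: measurable_ball_term.
have mf i : measurable_fun setT (far_fun r x i) by exact: measurable_ball_term.
have n0 i y : setT y -> (0 <= near_fun r x i y)%E by move=> _; exact: near_fun_ge0.
have f0 i y : setT y -> (0 <= far_fun r x i y)%E by move=> _; exact: far_fun_ge0.
apply: (@le_trans _ _ (\int[mu]_y ((\sum_(i <oo) near_fun r x i y) +
    (\sum_(i <oo) far_fun r x i y)))%E).
  apply: le_ge0_integral => y _; last exact: rho_kernel_le.
  by rewrite lee_fin mulr_ge0// rho_kernel_ge0.
have sn0 y : setT y -> (0 <= \sum_(i <oo) near_fun r x i y)%E.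
  by move=> _; apply: nneseries_ge0 => i _ _; exact: near_fun_ge0.
have sf0 y : setT y -> (0 <= \sum_(i <oo) far_fun r x i y)%E.
  by move=> _; apply: nneseries_ge0 => i _ _; exact: far_fun_ge0.
have msn : measurable_fun setT (fun y => \sum_(i <oo) near_fun r x i y)%E.
  by apply: ge0_emeasurable_sum => [i y _ _|i _]; [exact: near_fun_ge0|exact: mn].
have msf : measurable_fun setT (fun y => \sum_(i <oo) far_fun r x i y)%E.
  by apply: ge0_emeasurable_sum => [i y _ _|i _]; [exact: far_fun_ge0|exact: mf].
rewrite (ge0_integralD mu measurableT sn0 msn sf0 msf).
rewrite (integral_nneseries _ measurableT mn n0).
rewrite (integral_nneseries _ measurableT mf f0).
by apply: leeD; [exact: near_sum_le|exact: far_sum_le].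
Qed.

Definition hedberg_cst : R := near_tot + far_tot.

Lemma hedberg_cst_gt0 : 0 < hedberg_cst.
Proof. exact: addr_gt0. Qed.

(* Optimize the splitting radius: phi r = maxfun G x / F. *)
Lemma hedberg x : (forall u, 0 < u -> exists2 t, 0 < t & phi t = u) ->
  (potential x <= (hedberg_cst * F `^ (1 - th))%:E * maxfun G x `^ th)%E.
Proof.
move=> phi_surj; have /andP[th0 th1] := th01.
have FF : 0 < F `^ (1 - th) by exact: powR_gt0.
have M0 := maxfun_ge0 G x.
case EM : (maxfun G x) M0 => [m| |]// m0; last first.
  rewrite poweRyr ?gt_eqF// gt0_muley ?leey// lte_fin.
  by rewrite mulr_gt0// hedberg_cst_gt0.
rewrite lee_fin le_eqVlt in m0; have {m0}[/eqP m0|m0] := orP m0.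
  (* When the maximal function vanishes no radius is optimal; surjectivity makes phi(r) so small
     that the outer term equals [eps]. *)
  rewrite -m0 poweR0r ?gt_eqF// mule0; apply/lee_addgt0Pr => eps eps0.
  rewrite add0e.
  have fF : 0 < far_tot * F by rewrite mulr_gt0.
  have z0 : 0 < (eps / (far_tot * F)) `^ th^-1 by rewrite powR_gt0// divr_gt0.
  have [r r0 rE] := phi_surj _ z0.
  apply: (le_trans (potential_split_le x r0)).
  rewrite EM -m0 mule0 add0e rE -powRrM mulVf ?gt_eqF// powRr1; last first.
    by rewrite divr_ge0 ?ltW.
  rewrite lee_fin mulrAC.
  by rewrite mulrC divfK ?lexx ?gt_eqF.
have z0 : 0 < m / F by rewrite divr_gt0.
have [r r0 rE] := phi_surj _ z0.
apply: (le_trans (potential_split_le x r0)); rewrite EM rE.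
rewrite poweR_EFin -!EFinM -EFinD lee_fin.
have FV : (F^-1) `^ th = (F `^ th)^-1 by rewrite -powR_inv1 ?(ltW F0)// -powRrM mulN1r powRN.
have e1 : (m / F) `^ th * F = m `^ th * F `^ (1 - th).
  rewrite powRM ?invr_ge0 ?(ltW m0) ?(ltW F0)// FV -mulrA; congr (_ * _).
  rewrite powRD; last by rewrite (gt_eqF F0) implybT.
  by rewrite powRr1 ?(ltW F0)// powRN mulrC.
have e2 : (m / F) `^ (th - 1) * m = m `^ th * F `^ (1 - th).
  rewrite -e1 powRD; last by rewrite (gt_eqF z0) implybT.
  rewrite -mulrA; congr (_ * _); rewrite powR_inv1 ?(ltW z0)//.
  by rewrite invf_div divfK// gt_eqF.
rewrite [leLHS](_ : _ = near_tot * ((m / F) `^ (th - 1) * m) +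
  far_tot * ((m / F) `^ th * F)); last by ring.
by rewrite e1 e2 -mulrDl mulrA mulrAC.
Qed.

End hedberg.

(** * Norms and measurability *)

Section norms.
Context {R : realType} {d : nat}.
Local Notation T := (lebesgueSpace R d).
Local Notation mu := (leb R d).

Lemma cabs_ge0 (z : R[i]) : 0 <= cabs z.
Proof. by case: z => a b; rewrite /cabs/= sqrtr_ge0. Qed.

Lemma amalgam_normE (q p r : R) (f : 'rV[R]_d -> R[i]) : 0 < q -> 0 < p ->
  (amalgam_norm r q%:E p%:E f =
   mixed_int (p / q) (fun x => (cabs (f x) `^ q)%:E) r `^ p^-1)%E.
Proof.
move=> q0 p0; rewrite /amalgam_norm unlock /Lnorm; congr (_ `^ _)%E.
apply: eq_integral => y _.
have -> : (\int[mu]_x `|(cabs (f x) * \1_(eball y r) x)%:E| `^ q =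
    local_int (fun x => (cabs (f x) `^ q)%:E) y r)%E.
  apply: eq_integral => x _; rewrite abse_EFin poweR_EFin -EFinM indicE.
  case: (x \in _); last by rewrite !mulr0 normr0 powR0// gt_eqF.
  by rewrite !mulr1 ger0_norm ?cabs_ge0.
have L0 : (0 <= local_int (fun x => (cabs (f x) `^ q)%:E) y r)%E.
  by apply: local_int_ge0 => x; rewrite lee_fin powR_ge0.
by rewrite gee0_abs ?poweR_ge0// -poweRrM mulrC.
Qed.

Lemma poweRV_le (p a : R) (X : \bar R) : 0 < p -> 0 <= a -> (0 <= X)%E ->
  (X `^ p^-1 <= a%:E)%E = (X <= (a `^ p)%:E)%E.
Proof.
move=> p0 a0 X0; apply/idP/idP => H.
  have -> : X = ((X `^ p^-1) `^ p)%E by rewrite -poweRrM mulVf ?gt_eqF// poweRe1.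
  by rewrite -poweR_EFin le_poweR ?poweR_ge0// ltW.
have -> : a%:E = ((a%:E `^ p) `^ p^-1)%E.
  by rewrite -poweRrM mulfV ?gt_eqF// poweRe1// lee_fin.
by rewrite le_poweR ?poweR_EFin// invr_ge0 ltW.
Qed.

Lemma fofana_normP (q p F : R) (phi : R -> R) (f : 'rV[R]_d -> R[i]) :
  0 < q -> 0 < p -> 0 <= F -> (forall t, 0 < t -> 0 < phi t) ->
  (fofana_norm q%:E p%:E phi f <= F%:E)%E <-> fofana_le q p phi F (fun x => cabs (f x)).
Proof.
move=> q0 p0 F0 phi0.
have key r : 0 < r -> (((phi r)^-1 * r `^ (d%:R * (- recip q%:E - recip p%:E)))%:E *
      amalgam_norm r q%:E p%:E f <= F%:E)%E =
    (mixed_int (p / q) (fun x => (cabs (f x) `^ q)%:E) r <=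
     (F `^ p * (phi r `^ p * r ^+ d) * (r ^+ d) `^ (p / q))%:E)%E.
  move=> r0; have fr := phi0 _ r0.
  have M0 : (0 <= mixed_int (p / q) (fun x => (cabs (f x) `^ q)%:E) r)%E.
    by apply: integral_ge0 => y _; exact: poweR_ge0.
  (* The inverse of [b] is the weight in the norm, and b^p = phi(r)^p r^d (r^d)^(p/q) is the
     right-hand side of [fofana_le] apart from F^p. *)
  pose b := phi r * (r ^+ d) `^ q^-1 * (r ^+ d) `^ p^-1.
  have b0 : 0 < b by rewrite !mulr_gt0 ?powR_gt0 ?exprn_gt0.
  have -> : (phi r)^-1 * r `^ (d%:R * (- recip q%:E - recip p%:E)) = b^-1.
    rewrite !recipE ?gt_eqF// mulrBr mulrN powRD; last by rewrite (gt_eqF r0) implybT.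
    by rewrite !powRN !powRrM !powR_mulrn ?(ltW r0)// /b !invfM mulrA.
  rewrite lee_pdivrMl// amalgam_normE// -EFinM (poweRV_le p0 (mulr_ge0 (ltW b0) F0) M0).
  have fr0 := ltW fr; have rd0 : 0 <= r ^+ d by rewrite exprn_ge0// ltW.
  have rq0 := powR_ge0 (r ^+ d) q^-1; have rp0 := powR_ge0 (r ^+ d) p^-1.
  congr (_ <= _%:E)%E; rewrite (powRM _ (ltW b0) F0) /b.
  rewrite (powRM _ (mulr_ge0 fr0 rq0) rp0) (powRM _ fr0 rq0).
  rewrite -!powRrM mulVf ?gt_eqF// powRr1 ?exprn_ge0 ?(ltW r0)// (mulrC q^-1).
  ring.
split=> [H r r0|H].
  rewrite -key//; apply: le_trans H; apply: ereal_sup_ubound.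
  by exists r.
by apply: ge_ereal_sup => _ [r r0 <-]; rewrite key//; exact: H.
Qed.

Lemma fofana_norm_ge0 (q p : \bar R) (phi : R -> R) (f : 'rV[R]_d -> R[i]) :
  (forall t, 0 < t -> 0 < phi t) -> (0 <= fofana_norm q p phi f)%E.
Proof.
move=> phi0; apply: (@le_trans _ _ (((phi 1)^-1 *
    1 `^ (d%:R * (- recip q - recip p)))%:E * amalgam_norm 1 q p f)%E).
  rewrite mule_ge0 ?Lnorm_ge0// lee_fin mulr_ge0 ?powR_ge0// invr_ge0 ltW//.
  exact: phi0.
by apply: ereal_sup_ubound; exists 1 => //=.
Qed.

Lemma fofana_norm_fin (q p : \bar R) (phi : R -> R) (f : 'rV[R]_d -> R[i]) :
  (forall t, 0 < t -> 0 < phi t) -> (fofana_norm q p phi f < +oo)%E ->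
  exists2 a, 0 <= a & fofana_norm q p phi f = a%:E.
Proof.
move=> phi0; have := fofana_norm_ge0 q p f phi0.
by case: (fofana_norm q p phi f) => [a| |]//; rewrite lee_fin => a0 _; exists a.
Qed.

End norms.

(** * Hoelder's inequality in Fofana spaces *)

Section holder_fofana.
Context {R : realType} {d : nat}.
Local Notation T := (lebesgueSpace R d).
Local Notation mu := (leb R d).
Local Open Scope ereal_scope.

Lemma le_mixed_int (e : R) (U V : T -> \bar R) r : (0 <= e)%R ->
  (forall x, 0 <= U x) -> (forall x, U x <= V x) ->
  mixed_int e U r <= mixed_int e V r.
Proof.
move=> e0 U0 UV; apply: le_ge0_integral => y _; first exact: poweR_ge0.
apply: le_poweR => //; first exact: local_int_ge0.
exact: le_local_int.
Qed.

Lemma mixed_intZ (e c : R) (U : T -> \bar R) r : (0 <= c)%R ->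
  measurable_fun setT U -> (forall x, 0 <= U x) ->
  mixed_int e (fun x => c%:E * U x) r = (c `^ e)%:E * mixed_int e U r.
Proof.
move=> c0 mU U0.
have L0 y : 0 <= local_int U y r by exact: local_int_ge0.
have mL : measurable_fun setT (fun y => local_int U y r `^ e).
  by apply: (measurableT_comp (measurable_poweR e)); exact: measurable_local_int.
rewrite /mixed_int -(ge0_integralZl_EFin mu measurableT _ mL (powR_ge0 _ _)); last first.
  by move=> y _; exact: poweR_ge0.
apply: eq_integral => y _; rewrite -poweR_EFin -poweRM ?lee_fin//; congr (_ `^ _).
rewrite -(ge0_integralZl_EFin mu measurableT _ (measurable_local_integrand y r mU) c0).
  by apply: eq_integral => x _; rewrite muleA.
by move=> x _; rewrite mule_ge0// lee_fin.
Qed.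

End holder_fofana.

Section holder_fofana_le.
Context {R : realType} {d : nat}.
Local Notation T := (lebesgueSpace R d).
Local Notation mu := (leb R d).
Variables (q p th s l : R) (phi : R -> R) (H M : R).
Hypotheses (q0 : 0 < q) (p0 : 0 < p) (th01 : 0 < th < 1).
Hypotheses (sE : s = q / (1 - th)) (lE : l = p / (1 - th)).
Hypotheses (phi_gt0 : forall t, 0 < t -> 0 < phi t) (H0 : 0 < H) (M0 : 0 < M).
Variables (G V h : T -> R) (F w : R).
Hypotheses (F0 : 0 < F) (w0 : 0 <= w).
Hypotheses (mG : measurable_fun setT G) (mV : measurable_fun setT V).
Hypotheses (G0 : forall x, 0 <= G x) (V0 : forall x, 0 <= V x) (h0 : forall x, 0 <= h x).
Hypothesis maxfun_bound : forall r, 0 < r ->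
  (mixed_int (p / q) (fun x => maxfun G x `^ q) r <=
   (M * (F `^ p * (phi r `^ p * r ^+ d) * (r ^+ d) `^ (p / q)))%:E)%E.
Hypothesis V_bound : fofana_le s l (fun r => phi r `^ (q / s)) w V.
Hypothesis h_le : forall x,
  ((h x)%:E <= (H * F `^ (1 - th))%:E * maxfun G x `^ th)%E.

Let th0 : 0 < th. Proof. by case/andP: th01. Qed.
Let th1 : 0 < 1 - th. Proof. by case/andP: th01 => _; rewrite subr_gt0. Qed.
Let e := p / q.
Let e0 : 0 < e. Proof. exact: divr_gt0. Qed.
Let lse : l / s = e.
Proof. by rewrite lE sE /e; field; rewrite !gt_eqF. Qed.
Let qs : q / s = 1 - th.
Proof. by rewrite sE; field; rewrite !gt_eqF. Qed.
Let B := H * F `^ (1 - th).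
Let B0 : 0 < B. Proof. by rewrite mulr_gt0 ?powR_gt0. Qed.

Lemma product_power_le x : (((V x * h x) `^ q)%:E <= (B `^ q)%:E *
  ((V x `^ s)%:E `^ (1 - th) * (maxfun G x `^ q) `^ th))%E.
Proof.
have MG0 := maxfun_ge0 G x.
have hq : ((h x `^ q)%:E <= (B `^ q)%:E * maxfun G x `^ (th * q))%E.
  rewrite -!poweR_EFin poweRrM -poweRM ?poweR_ge0 ?lee_fin ?(ltW B0)//.
  by apply: le_poweR; rewrite ?lee_fin ?(ltW q0)//; exact: h_le.
rewrite powRM// EFinM poweR_EFin -powRrM -poweRrM.
have -> : s * (1 - th) = q by rewrite sE divfK ?gt_eqF.
by rewrite (mulrC q) muleCA lee_wpmul2l ?lee_fin ?powR_ge0.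
Qed.

(** The weight phi^(q/s) of [V] raised to the power l is phi^p, because q l / s = p. Both mixed
    integrals thus carry the same factor X, and X^(1-th) X^th = X; likewise F^(1-th) from [h_le] and
    F^th from [maxfun_bound] combine to F. *)
Lemma holder_fofana_le :
  fofana_le q p phi (H * M `^ (th / p) * w * F) (fun x => V x * h x).
Proof.
move=> r r0; have rd : 0 < r ^+ d by rewrite exprn_gt0.
have fr := phi_gt0 r0.
pose X := phi r `^ p * r ^+ d * (r ^+ d) `^ e.
have X0 : 0 < X by rewrite !mulr_gt0 ?powR_gt0.
pose U (x : T) : \bar R := (V x `^ s)%:E.
pose N (x : T) : \bar R := (maxfun G x `^ q)%E.
have U0 x : (0 <= U x)%E by rewrite lee_fin powR_ge0.
have N0 x : (0 <= N x)%E by exact: poweR_ge0.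
have mU : measurable_fun setT U.
  by apply/measurable_EFinP; exact: (measurableT_comp (measurable_powR s)).
have mN : measurable_fun setT N.
  by apply: (measurableT_comp (measurable_poweR q)); exact: measurable_maxfun.
have mUN : measurable_fun setT (fun x => U x `^ (1 - th) * N x `^ th)%E.
  apply: emeasurable_funM; first exact: (measurableT_comp (measurable_poweR _) mU).
  exact: (measurableT_comp (measurable_poweR _) mN).
have UN0 x : (0 <= U x `^ (1 - th) * N x `^ th)%E by rewrite mule_ge0 ?poweR_ge0.
have HU : (mixed_int e U r <= (w `^ l * X)%:E)%E.
  have := V_bound r0; rewrite lse => /le_trans; apply.
  rewrite lee_fin -mulrA ler_wpM2l ?powR_ge0// -powRrM.
  by rewrite qs lE mulrCA mulfV ?gt_eqF// mulr1 lexx.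
have HN : (mixed_int e N r <= (M * (F `^ p * X))%:E)%E.
  by have := maxfun_bound r0; rewrite -(mulrA (F `^ p)).
have mix0 (W : T -> \bar R) : (0 <= mixed_int e W r)%E.
  by apply: integral_ge0 => y _; exact: poweR_ge0.
apply: (le_trans (le_mixed_int r (ltW e0) _ product_power_le)).
  by move=> x; rewrite lee_fin powR_ge0.
rewrite (mixed_intZ e r (powR_ge0 _ _) mUN UN0) -powRrM.
have -> : q * e = p by rewrite /e mulrC divfK ?gt_eqF.
have HH : (mixed_int e (fun x => U x `^ (1 - th) * N x `^ th) r <=
    (w `^ p * (M `^ th * F `^ (p * th)) * X)%:E)%E.
  apply: (le_trans (mixed_int_hoelder r e0 mU mN U0 N0 th01)).
  apply: (@le_trans _ _ ((w `^ l * X)%:E `^ (1 - th) *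
      (M * (F `^ p * X))%:E `^ th)%E).
    by apply: lee_pmul; rewrite ?poweR_ge0//; apply: le_poweR => //; exact: ltW.
  have Fp0 := powR_ge0 F p.
  rewrite !poweR_EFin -EFinM lee_fin (powRM _ (powR_ge0 _ _) (ltW X0)).
  rewrite (powRM _ (ltW M0) (mulr_ge0 Fp0 (ltW X0))) (powRM _ Fp0 (ltW X0)).
  rewrite -!powRrM.
  have -> : l * (1 - th) = p by rewrite lE divfK ?gt_eqF.
  have XX : X `^ (1 - th) * X `^ th = X.
    by rewrite -powRD ?(gt_eqF X0) ?implybT// subrK powRr1// ltW.
  by rewrite mulrACA (mulrCA (X `^ (1 - th))) XX [in leRHS]mulrA !mulrA lexx.
apply: (le_trans (lee_wpmul2l _ HH)); first by rewrite lee_fin powR_ge0.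
rewrite -EFinM lee_fin -[leRHS]mulrA -[X in _ <= _ * X]/X [leLHS]mulrA.
apply: (ler_wpM2r (ltW X0)); rewrite /B.
have F1 := powR_ge0 F (1 - th); have Mt := powR_ge0 M (th / p).
rewrite (powRM _ (ltW H0) F1) (powRM _ (mulr_ge0 (mulr_ge0 (ltW H0) Mt) w0) (ltW F0)).
rewrite (powRM _ (mulr_ge0 (ltW H0) Mt) w0) (powRM _ (ltW H0) Mt) -!powRrM.
rewrite divfK ?gt_eqF//.
have -> : F `^ p = F `^ ((1 - th) * p) * F `^ (p * th).
  by rewrite -powRD ?(gt_eqF F0) ?implybT//; congr (_ `^ _); ring.
move: (H `^ p) (F `^ ((1 - th) * p)) (w `^ p) (M `^ th) (F `^ (p * th)) => a b c m k.
by rewrite le_eqVlt; apply/orP; left; apply/eqP; ring.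
Qed.

End holder_fofana_le.

(** * Domination of the complex integral by the potential *)

Section potential_bound.
Context {R : realType} {d : nat}.
Local Notation T := (lebesgueSpace R d).
Local Notation mu := (leb R d).

(** The positive and negative parts of [g] both have integral at most that of [k], and the
    difference of two numbers in [0, K] is at most K in absolute value. Only monotonicity enters, so
    [g] and [k] are arbitrary. *)
Lemma abse_integral_le dsp (S : measurableType dsp)
    (m : {measure set S -> \bar R}) (g k : S -> \bar R) :
  (forall x, `|g x| <= k x)%E -> (`|\int[m]_x g x| <= \int[m]_x k x)%E.
Proof.
move=> gk; rewrite integralE.
have le_k (u : S -> \bar R) : (forall x, 0 <= u x)%E -> (forall x, u x <= `|g x|)%E ->
    (\int[m]_x u x <= \int[m]_x k x)%E.
  by move=> u0 ug; apply: le_ge0_integral => // x _; exact: le_trans (gk x).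
have P : (\int[m]_x g^\+ x <= \int[m]_x k x)%E.
  by apply: le_k => x; rewrite ?funepos_ge0// funeposE ge_max lee_abs abse_ge0.
have N : (\int[m]_x g^\- x <= \int[m]_x k x)%E.
  by apply: le_k => x; rewrite ?funeneg_ge0// funenegE ge_max -{1}abseN lee_abs abse_ge0.
have P0 : (0 <= \int[m]_x g^\+ x)%E by exact: integral_ge0.
have N0 : (0 <= \int[m]_x g^\- x)%E by exact: integral_ge0.
move: P N P0 N0.
set K := (\int[m]_x k x)%E; set A := (\int[m]_x g^\+ x)%E; set C := (\int[m]_x g^\- x)%E.
case: A => [a| |]; case: C => [b| |]; case: K => [c| |] //=; rewrite ?lee_fin ?leey//.
by move=> ac bc a0 b0; rewrite ler_norml; apply/andP; split; lra.
Qed.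

Variables (rho : R -> R) (f : 'rV[R]_d -> R[i]).
Hypotheses (d0 : (0 < d)%N) (rho_gt0 : forall t, 0 < t -> 0 < rho t).

Lemma cabs_Re_le (z : R[i]) : `|complex.Re z| <= cabs z.
Proof.
case: z => a b; rewrite /cabs/= -sqrtr_sqr ler_sqrt ?addr_ge0 ?sqr_ge0//.
by rewrite lerDl sqr_ge0.
Qed.

Lemma cabs_Im_le (z : R[i]) : `|complex.Im z| <= cabs z.
Proof.
case: z => a b; rewrite /cabs/= -sqrtr_sqr ler_sqrt ?addr_ge0 ?sqr_ge0//.
by rewrite lerDr sqr_ge0.
Qed.

Lemma cabs_le_ReIm (z : R[i]) : cabs z <= `|complex.Re z| + `|complex.Im z|.
Proof.
case: z => a b; rewrite /cabs/= -[leRHS]ger0_norm ?addr_ge0// -[leRHS]sqrtr_sqr.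
rewrite ler_sqrt ?sqr_ge0// sqrrD !real_normK ?num_real//.
by rewrite addrAC lerDl mulrn_wge0// mulr_ge0.
Qed.

Lemma ReM_real (a : R) (z : R[i]) : complex.Re (a%:C%C * z) = a * complex.Re z.
Proof. by case: z => b c /=; rewrite mul0r subr0. Qed.

Lemma ImM_real (a : R) (z : R[i]) : complex.Im (a%:C%C * z) = a * complex.Im z.
Proof. by case: z => b c /=; rewrite mul0r addr0. Qed.

(** The factor 2 pays for treating real and imaginary parts separately. The bound also covers points
    of divergence, since [fine] sends infinite values to 0. *)
Lemma cabs_Trho_le x : ((cabs (Trho rho f x))%:E <=
  2%:E * potential rho (fun y => cabs (f y)) x)%E.
Proof.
have fine_le (a : \bar R) : ((`|fine a|)%:E <= `|a|)%E.
  by case: a => [a| |] //=; rewrite ?normr0 ?leey.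
have key (u : R[i] -> R) : (forall z, `|u z| <= cabs z) ->
    (forall a z, u (a%:C%C * z) = a * u z) ->
    ((`|Rintegral mu setT (fun y => u ((rho_kernel rho x y)%:C%C * f y))|)%:E <=
      potential rho (fun y => cabs (f y)) x)%E.
  move=> ule uM; apply: (le_trans (fine_le _)); apply: abse_integral_le => y.
  rewrite abse_EFin lee_fin uM normrM ger0_norm ?rho_kernel_ge0//.
  by rewrite ler_wpM2l ?rho_kernel_ge0.
apply: (@le_trans _ _ (`|complex.Re (Trho rho f x)| + `|complex.Im (Trho rho f x)|)%:E).
  by rewrite lee_fin cabs_le_ReIm.
rewrite EFinD (_ : 2%:E = 1%:E + 1%:E)%E; last by rewrite -EFinD; congr _%:E; ring.
rewrite ge0_muleDl ?lee_fin// !mul1e.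
by apply: leeD; apply: key; [exact: cabs_Re_le|exact: ReM_real|
  exact: cabs_Im_le|exact: ImM_real].
Qed.

End potential_bound.

(** * Measurability and convergence of the fractional integral *)

Section kernel_measurability.
Context {R : realType} {d : nat}.
Local Notation T := (lebesgueSpace R d).
Local Notation mu := (leb R d).
Hypothesis d0 : (0 < d)%N.

(* With 0 `^ (- d) = 0, as for the inverse. *)
Lemma measurable_exprVn dsp (S : measurableType dsp) (g : S -> R) :
  measurable_fun setT g -> (forall x, 0 <= g x) ->
  measurable_fun setT (fun x => (g x ^+ d)^-1).
Proof.
move=> mg g0; have := measurableT_comp (measurable_powR (- d%:R)) mg.
by apply: eq_measurable_fun => x _ /=; rewrite powRN powR_mulrn.
Qed.

Lemma measurable_rho_kernel (g : R -> R) : measurable_fun setT g ->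
  measurable_fun setT (fun u : T * T => rho_kernel g u.1 u.2).
Proof.
move=> mg.
have me : measurable_fun setT (fun u : T * T => enorm (u.1 - u.2)).
  exact: (measurable_enorm measurable_fst measurable_snd).
apply: measurable_funM; first exact: (measurableT_comp mg me).
by apply: measurable_exprVn => // u; exact: enorm_ge0.
Qed.

Variable rho : R -> R.
Hypothesis rho_gt0 : forall t, 0 < t -> 0 < rho t.
Hypothesis mrho : lebesgue_measurable_on `]0, +oo[%classic rho.

(** The radii at which [rho] is altered form a null set, so for each x the two kernels differ only
    on a null set of y by [leb_null_distance]. At radius 0 both kernels vanish. *)
Lemma rho_kernel_borel : exists g : R -> R, [/\ measurable_fun setT g,
  forall t, 0 < t -> 0 <= g t &
  forall x : T, {ae mu, forall y, rho_kernel rho x y = rho_kernel g x y}].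
Proof.
have [E [mE ED N mg]] :=
  lebesgue_measurable_borel (@measurable_itv R _) mrho.
exists (rho \_ E); split=> // [t t0|x].
  by rewrite patchE; case: ifP => // _; exact: ltW (rho_gt0 t0).
apply: (@negligibleS _ T R mu _ _ _ (leb_null_distance x d0 N)) => y /= H.
apply: contrapT => H2; apply: H; rewrite /rho_kernel.
have := enorm_ge0 (x - y); rewrite le_eqVlt => /orP[/eqP <-|t0].
  by rewrite expr0n (gtn_eqF d0) invr0 !mulr0.
congr (_ / _); rewrite patchE; case: ifPn => // /negP tE.
exfalso; apply: H2; split; first by rewrite /= in_itv/= t0.
by move=> /mem_set.
Qed.

Lemma measurable_rho_kernel_fun (x : T) (g : T -> R) : measurable_fun setT g ->
  measurable_fun setT (fun y : T => rho_kernel rho x y * g y).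
Proof.
move=> mg; have [r' [mr' _ rr']] := rho_kernel_borel.
apply/measurable_EFinP.
have mk : measurable_fun setT (fun y : T => (rho_kernel r' x y * g y)%:E).
  apply/measurable_EFinP; apply: (measurable_funM _ mg).
  exact: (measurableT_comp (measurable_rho_kernel mr') (measurable_pair1 x)).
apply: (ae_measurable_fun leb_complete _ mk).
by apply: (@filterS _ _ (ae_filter_ringOfSetsType mu) _ _ _ (rr' x)) => y /= -> _.
Qed.

(** Tonelli's theorem applies to the Borel kernel, which is jointly measurable. For every x, and not
    merely almost every x, both kernels give the same integral over y. *)
Lemma measurable_kernel_integral_ge0 (g : T -> R) : measurable_fun setT g ->
  (forall y, 0 <= g y) ->
  measurable_fun setT (fun x : T => \int[mu]_y (rho_kernel rho x y * g y)%:E)%E.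
Proof.
move=> mg g0; have [r' [mr' r'0 rr']] := rho_kernel_borel.
have mk : measurable_fun setT
    (fun u : T * T => (rho_kernel r' u.1 u.2 * g u.2)%:E).
  apply/measurable_EFinP; apply: measurable_funM; first exact: measurable_rho_kernel.
  exact: (measurableT_comp mg measurable_snd).
have k0 (u : T * T) : (0 <= (rho_kernel r' u.1 u.2 * g u.2)%:E)%E.
  rewrite lee_fin mulr_ge0// /rho_kernel.
  have := enorm_ge0 (u.1 - u.2); rewrite le_eqVlt => /orP[/eqP <-|t0].
    by rewrite expr0n (gtn_eqF d0) invr0 !mulr0.
  by rewrite divr_ge0 ?exprn_ge0 ?(ltW t0)// r'0.
have H := measurable_leb_integral mk k0; apply: eq_measurable_fun H => x _.
have mk1 : measurable_fun setT (fun y : T => (rho_kernel r' x y * g y)%:E).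
  exact: (measurableT_comp mk (measurable_pair1 x)).
have mk2 : measurable_fun setT (fun y : T => (rho_kernel rho x y * g y)%:E).
  by apply/measurable_EFinP; exact: measurable_rho_kernel_fun.
apply: (ae_eq_integral _ _ measurableT mk1 mk2).
by apply: (@filterS _ _ (ae_filter_ringOfSetsType mu) _ _ _ (rr' x)) => y /= -> _.
Qed.

Lemma measurable_kernel_Rintegral (g : T -> R) : measurable_fun setT g ->
  measurable_fun setT (fun x : T => Rintegral mu setT (fun y => rho_kernel rho x y * g y)).
Proof.
move=> mg.
have k0 := rho_kernel_ge0 d0 rho_gt0.
have mneg : measurable_fun setT (fun y => Num.max (- g y) 0).
  by apply: measurable_maxr; [exact: measurable_funN|exact: measurable_cst].
have mpos : measurable_fun setT (fun y => Num.max (g y) 0).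
  by apply: measurable_maxr; [exact: mg|exact: measurable_cst].
have p0 y : 0 <= Num.max (g y) 0 by rewrite le_max lexx orbT.
have n0 y : 0 <= Num.max (- g y) 0 by rewrite le_max lexx orbT.
have mP := measurable_kernel_integral_ge0 mpos p0.
have mN := measurable_kernel_integral_ge0 mneg n0.
have := measurableT_comp (@fine_measurable R setT measurableT) (emeasurable_funB mP mN).
apply: eq_measurable_fun => x _ /=; congr fine; rewrite [RHS]integralE.
congr (_ - _)%E; apply: eq_integral => y _.
  by rewrite funeposE -EFin_max maxr_pMr ?k0// mulr0.
by rewrite funenegE -EFinN -EFin_max maxr_pMr ?k0// mulr0 mulrN.
Qed.

Lemma L0_mul_Trho (W f : 'rV[R]_d -> R[i]) : L0 W -> L0 f ->
  L0 (fun x => W x * Trho rho f x).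
Proof.
move=> [mW1 mW2] [mf1 mf2].
have m1 : measurable_fun [set: T] (fun x : T => complex.Re (Trho rho f x)).
  have := measurable_kernel_Rintegral mf1; apply: eq_measurable_fun => x _ /=.
  by apply: eq_Rintegral => y _; rewrite ReM_real.
have m2 : measurable_fun [set: T] (fun x : T => complex.Im (Trho rho f x)).
  have := measurable_kernel_Rintegral mf2; apply: eq_measurable_fun => x _ /=.
  by apply: eq_Rintegral => y _; rewrite ImM_real.
have ReM (a b : R[i]) : complex.Re (a * b) =
    complex.Re a * complex.Re b - complex.Im a * complex.Im b.
  by case: a => ? ?; case: b.
have ImM (a b : R[i]) : complex.Im (a * b) =
    complex.Re a * complex.Im b + complex.Im a * complex.Re b.
  by case: a => ? ?; case: b.
split.
  have := measurable_funB (measurable_funM mW1 m1) (measurable_funM mW2 m2).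
  by apply: eq_measurable_fun => x _; rewrite ReM.
have := measurable_funD (measurable_funM mW1 m2) (measurable_funM mW2 m1).
by apply: eq_measurable_fun => x _; rewrite ImM.
Qed.

Lemma measurable_cabs (f : 'rV[R]_d -> R[i]) : L0 f ->
  measurable_fun [set: T] (fun x : T => cabs (f x)).
Proof.
move=> [m1 m2].
have m : measurable_fun [set: T]
    (fun x : T => complex.Re (f x) ^+ 2 + complex.Im (f x) ^+ 2).
  by apply: measurable_funD; exact: measurable_funX.
have := measurableT_comp (@measurable_sqrt R) m.
by apply: eq_measurable_fun => x _ /=; case: (f x).
Qed.

Lemma Trho_definedP (f : 'rV[R]_d -> R[i]) (x : T) : L0 f ->
  (potential rho (fun y => cabs (f y)) x < +oo)%E -> Trho_defined rho f x.
Proof.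
move=> [m1 m2] fin.
have key (u : R[i] -> R) : (forall z, `|u z| <= cabs z) ->
    (forall a z, u (a%:C%C * z) = a * u z) ->
    measurable_fun [set: T] (fun y : T => u (f y)) ->
    mu.-integrable setT (fun y : T => (u ((rho_kernel rho x y)%:C%C * f y))%:E).
  move=> ule uM mu_; apply/integrableP; split.
    apply/measurable_EFinP; have := measurable_rho_kernel_fun x mu_.
    by apply: eq_measurable_fun => y _ /=; rewrite uM.
  apply: le_lt_trans fin; apply: le_ge0_integral => y _; first exact: abse_ge0.
  rewrite abse_EFin lee_fin uM normrM ger0_norm ?rho_kernel_ge0//.
  by rewrite ler_wpM2l ?rho_kernel_ge0.
split; apply: key => //; [exact: cabs_Re_le|exact: ReM_real|exact: cabs_Im_le|exact: ImM_real].
Qed.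

End kernel_measurability.

Section maxfun_ae.
Context {R : realType} {d : nat}.
Local Notation T := (lebesgueSpace R d).
Local Notation mu := (leb R d).

Lemma maxfun_ae_lty (q : R) (G : T -> R) : 0 < q -> measurable_fun setT G ->
  (forall x, 0 <= G x) ->
  (forall r, 0 < r ->
    (local_int (fun x => maxfun G x `^ q) (0 : 'rV[R]_d)%R r < +oo)%E) ->
  {ae mu, forall x, (maxfun G x < +oo)%E}.
Proof.
move=> q0 mG G0 loc.
have mN : measurable_fun setT (fun x => maxfun G x `^ q)%E.
  by apply: (measurableT_comp (measurable_poweR q)); exact: measurable_maxfun.
have H n : {ae mu, forall x, setT x ->
    (maxfun G x `^ q * (\1_(eball (0 : 'rV[R]_d) n.+1%:R) x)%R%:E)%E \is a fin_num}.
  apply: integrable_ae => //; apply/integrableP; split.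
    exact: measurable_local_integrand.
  apply: le_lt_trans (loc n.+1%:R _) => //.
  apply: le_ge0_integral => x _; first exact: abse_ge0.
  by rewrite gee0_abs// mule_ge0 ?poweR_ge0// lee_fin.
apply: (@filterS _ _ (ae_filter_ringOfSetsType mu) _ _ _ (ae_foralln H)) => x Hx.
have [n xn] : exists n, enorm x < n.+1%:R.
  exists (Num.bound (enorm x)); apply: (lt_trans (archi_boundP (enorm_ge0 x))).
  by rewrite ltr_nat.
have := Hx n I; rewrite indicE mem_eball subr0 xn mule1.
have := maxfun_ge0 G x; case: (maxfun G x) => [a| |]//= _.
  by rewrite ltry.
by rewrite gt_eqF.
Qed.

End maxfun_ae.

(** The first two conclusions give the norm estimate its meaning: the integral defining [Trho]
    converges absolutely at almost every point, and the product is a measurable function. *)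
Theorem theorem5p3 (R : realType) (d : nat) (hd : (0 < d)%N)
  (q p : R) (hq : 1 < q) (hqp : q <= p)
  (phi : R -> R) (hphi : Gclass d q%:E p%:E phi)
  (hphi_surj : forall u : R, 0 < u -> exists2 t : R, 0 < t & phi t = u)
  (hphi_int : exists2 C : R, 0 < C & forall r : R, 0 < r ->
    (\int[@completed_lebesgue_measure R]_(t in `]r, +oo[%classic)
       (phi t `^ q * t `^ (d%:R * q / p - 1))%:E
     <= (C * (phi r `^ q * r `^ (d%:R * q / p)))%:E)%E)
  (qbar pbar : R) (hqbar : 0 < qbar) (hpbar : 0 < pbar)
  (hratio : q / qbar = p / pbar) (hratio1 : q / qbar < 1)
  (l s : R) (hl : l^-1 = p^-1 - pbar^-1) (hs : s^-1 = q^-1 - qbar^-1)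
  (rho : R -> R) (hrho : forall t : R, 0 < t -> 0 < rho t)
  (hrho_meas : lebesgue_measurable_on `]0, +oo[%classic rho)
  (hrho_doubling : exists2 C1 : R, 0 < C1 & forall r t : R, 0 < r -> 0 < t ->
    2^-1 <= r / t <= 2 -> C1^-1 <= rho r / rho t <= C1)
  (hrho_int : exists2 C' : R, 0 < C' & forall r : R, 0 < r ->
    (\int[@completed_lebesgue_measure R]_(t in `]0%R, r[%classic)
       (rho t / t)%:E <= (C' * phi r `^ (q / qbar - 1))%:E)%E /\
    (\int[@completed_lebesgue_measure R]_(t in `]r, +oo[%classic)
       (rho t * phi t / t)%:E <= (C' * phi r `^ (q / qbar))%:E)%E) :
  exists2 K : R, 0 < K & forall W f : 'rV[R]_d -> R[i],
    fofana s%:E l%:E (fun r => (phi r `^ (q / s))%R) W ->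
    fofana q%:E p%:E phi f ->
    [/\ {ae leb R d, forall x, Trho_defined rho f x},
        L0 (fun x => W x * Trho rho f x) &
        (fofana_norm q%:E p%:E phi (fun x => (W x * Trho rho f x)%R)
         <= K%:E * fofana_norm s%:E l%:E (fun r => (phi r `^ (q / s))%R) W
                 * fofana_norm q%:E p%:E phi f)%E].
Proof.
have q0 : 0 < q by exact: lt_trans hq.
have p0 : 0 < p by exact: lt_le_trans hqp.
have phi0 : forall t, 0 < t -> 0 < phi t by case: hphi.
pose th := q / qbar.
have th0 : 0 < th by exact: divr_gt0.
have th01 : 0 < th < 1 by rewrite th0.
have th1 : 0 < 1 - th by rewrite subr_gt0.
have sE : s = q / (1 - th).
  rewrite -[LHS]invrK hs -[RHS]invrK; congr (_^-1).
  by rewrite invf_div mulrBl mul1r /th mulrAC mulfV ?mul1r// gt_eqF.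
have lE : l = p / (1 - th).
  rewrite -[LHS]invrK hl -[RHS]invrK; congr (_^-1).
  by rewrite invf_div mulrBl mul1r /th hratio mulrAC mulfV ?mul1r// gt_eqF.
have s0 : 0 < s by rewrite sE divr_gt0.
have l0 : 0 < l by rewrite lE divr_gt0.
have psi0 t : 0 < t -> 0 < phi t `^ (q / s) by move=> t0; exact: powR_gt0 (phi0 t t0).
have [E E0 HE] := Gclass_le hq hqp hphi.
have [D D0 HD] := Gclass_doubling hq hphi.
have [S S0 HS] := Gclass_power_sum hq hqp hphi hphi_int.
have [C1 C10 HC1] := hrho_doubling.
have [C' C'0 HC'] := hrho_int.
have near r (r0 : 0 < r) := proj1 (HC' r r0).
have far r (r0 : 0 < r) := proj2 (HC' r r0).
(* [H] is the constant of Hedberg's bound, doubled for the real and imaginary parts; [M] below is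
   that of the maximal function. *)
have [H H0 HE2] : exists2 H, 0 < H & H = 2 * @hedberg_cst R d q p E D C1 C'.
  by eexists; last reflexivity; rewrite mulr_gt0//; exact: hedberg_cst_gt0.
have [M M0 ME] : exists2 M, 0 < M & M = @maxfun_fofana_cst R d q p E S.
  by eexists; last reflexivity; exact: maxfun_fofana_cst_gt0.
have K0 : 0 < H * M `^ (th / p) by rewrite mulr_gt0// powR_gt0.
exists (H * M `^ (th / p)); first exact: K0.
move=> W f [LW Woo] [Lf foo].
have mf := measurable_cabs Lf; have mW := measurable_cabs LW.
have f0 (x : lebesgueSpace R d) : 0 <= cabs (f x) by exact: cabs_ge0.
have W0 (x : lebesgueSpace R d) : 0 <= cabs (W x) by exact: cabs_ge0.
have [w w0 NW] := fofana_norm_fin psi0 Woo.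
have [n n0 Nf] := fofana_norm_fin phi0 foo.
have fle F : n < F -> fofana_le q p phi F (fun x => cabs (f x)).
  move=> nF; have F0 : 0 <= F by exact: le_trans (ltW nF).
  by apply/(fofana_normP f q0 p0 F0 phi0); rewrite Nf lee_fin ltW.
have Wle : fofana_le s l (fun r => phi r `^ (q / s)) w (fun x => cabs (W x)).
  by apply/(fofana_normP W s0 l0 w0 psi0); rewrite NW.
have hed F : n < F -> forall x : lebesgueSpace R d,
    (potential rho (fun y => cabs (f y)) x <=
     (@hedberg_cst R d q p E D C1 C' * F `^ (1 - th))%:E *
     maxfun (fun y => cabs (f y)) x `^ th)%E.
  move=> nF x; have F0 : 0 < F by exact: le_lt_trans nF.
  exact: (hedberg hd hq hqp phi0 hrho th01 E0 HE D0 HD C10 HC1 C'0 near far mf f0 F0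
    (fle F nF) x hphi_surj).
split; last 1 first.
(* The norm n of f may be 0, while Hedberg's bound divides by F. The estimate is proved for each F >
   n; the choice F = n + eps / (k + 1) then exceeds the target by at most eps. *)
- suff bound F : n < F ->
      (fofana_norm q%:E p%:E phi (fun x => (W x * Trho rho f x)%R) <=
       (H * M `^ (th / p) * w * F)%:E)%E.
    rewrite NW Nf; apply/lee_addgt0Pr => eps eps0.
    have k0 : 0 <= H * M `^ (th / p) * w by rewrite mulr_ge0// ltW.
    move: k0 bound; rewrite -!EFinM; set k := H * M `^ (th / p) * w => k0 bound.
    have k1 : 0 < k + 1 by rewrite ltr_wpDl.
    apply: (le_trans (bound (n + eps / (k + 1)) _)).
      by rewrite ltrDl divr_gt0.
    rewrite -EFinD lee_fin mulrDr lerD2l mulrCA ger_pMr//.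
    by rewrite ler_pdivrMr// mul1r lerDl.
  move=> nF; have F0 : 0 < F by exact: le_lt_trans nF.
  have k0 : 0 <= H * M `^ (th / p) * w * F.
    by rewrite mulr_ge0 ?(ltW F0)// mulr_ge0// ltW.
  apply/(fofana_normP _ q0 p0 k0 phi0).
  rewrite [X in fofana_le _ _ _ _ X](_ : _ =
      fun x => cabs (W x) * cabs (Trho rho f x)); last first.
    by apply/funext => x; exact: ComplexField.Normc.normcM.
  have h0 (x : lebesgueSpace R d) : 0 <= cabs (Trho rho f x) by exact: cabs_ge0.
  apply: (holder_fofana_le q0 p0 th01 sE lE phi0 H0 M0 F0 w0 mf mW f0 W0 h0 _ Wle).
    move=> r r0; rewrite ME.
    exact: (mixed_maxfun_le hq hqp phi0 E0 HE HS mf f0 (fle F nF) r0).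
  move=> x; apply: (le_trans (cabs_Trho_le f hd hrho x)).
  apply: (le_trans (lee_wpmul2l _ (hed F nF x))); first by rewrite lee_fin.
  by rewrite muleA -EFinM mulrA -HE2.
- have nF : n < n + 1 by rewrite ltrDl.
  have F0 : 0 < n + 1 by exact: le_lt_trans nF.
  have loc r : 0 < r -> (local_int (fun x => maxfun (fun y => cabs (f y)) x `^ q)
      (0 : 'rV[R]_d)%R r < +oo)%E.
    exact: (local_int_maxfun_lty hq hqp phi0 E0 HE mf f0 F0 (fle _ nF)).
  apply: (@filterS _ _ (ae_filter_ringOfSetsType (leb R d)) _ _ _
    (maxfun_ae_lty q0 mf f0 loc)) => x Mx.
  apply: (Trho_definedP hd hrho hrho_meas Lf); apply: (le_lt_trans (hed _ nF x)).
  apply: lte_mul_pinfty => //; last by rewrite poweR_lty.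
  by rewrite lee_fin mulr_ge0 ?powR_ge0// ltW// hedberg_cst_gt0.
- exact: (L0_mul_Trho hd hrho hrho_meas LW Lf).
Qed.
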